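(* Let $N\ge3$, $\mu\ge0$, and let $K$ satisfy (K0) and $f$ satisfy (F0). Assume $p_S(\alpha)<p<p_{JL}(\alpha)$. If $(E_\mu)$ has a singular solution $u^*$, then $(E_\mu)$ has infinitely many bounded solutions $\{u_j\}_{j=0}^\infty$ such that $\|u_j\|_{L^\infty}\to\infty$ as $j\to\infty$.
   Context: Throughout, $N\ge3$. $K:(0,\infty)\to(0,\infty)$ is continuous and satisfies (K0): $K(r)=(k_0+o(1))r^{\alpha}$ as $r\to0$ for some $\alpha>-2$ and $k_0>0$. $f:(0,\infty)\to[0,\infty)$ is continuous, not identically zero, and satisfies (F0): $f(r)=O(r^{\nu})$ as $r\to0$ for some $\nu>-2$. For $\mu\ge0$, equation $(E_\mu)$ is $u''+\frac{N-1}{r}u'+K(r)u^p+\mu f(r)=0$, $u>0$ for $r>0$. A bounded solution of $(E_\mu)$ is $u\in C^2(0,\infty)$ satisfying $(E_\mu)$ pointwise on $(0,\infty)$ with $\lim_{r\to0}u(r)$ finite. A singular solution is $u\in C^2(0,\infty)$ satisfying $(E_\mu)$ pointwise on $(0,\infty)$ with $\lim_{r\to0}u(r)=\infty$. $p_S(\alpha):=\frac{N+2+2\alpha}{N-2}$; $p_{JL}(\alpha):=1+\frac{2(2+\alpha)}{N-4-\alpha-\sqrt{(2+\alpha)(2N-2+\alpha)}}$ if $N>10+4\alpha$, and $p_{JL}(\alpha):=\infty$ if $N\le 10+4\alpha$. *)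

(* Defs.v *)
From Stdlib Require Import Reals.
From Coquelicot Require Import Coquelicot.
Open Scope R_scope.

Definition K0_cond (K : R -> R) (alpha k0 : R) : Prop :=
  alpha > -2 /\ k0 > 0 /\
  filterlim (fun r => K r / Rpower r alpha) (at_right 0) (locally k0).

Definition K_standing (K : R -> R) : Prop :=
  forall r, 0 < r -> continuous K r /\ 0 < K r.

Definition F0_cond (f : R -> R) : Prop :=
  exists nu C delta, nu > -2 /\ 0 < delta /\
    forall r, 0 < r < delta -> Rabs (f r) <= C * Rpower r nu.

Definition f_standing (f : R -> R) : Prop :=
  (forall r, 0 < r -> continuous f r /\ 0 <= f r) /\
  (exists r, 0 < r /\ f r <> 0).

Definition solves_E (N : nat) (K f : R -> R) (p mu : R) (u : R -> R) : Prop :=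
  exists u1 u2 : R -> R,
    forall r, 0 < r ->
      is_derive u r (u1 r) /\ is_derive u1 r (u2 r) /\ continuous u2 r /\
      0 < u r /\
      u2 r + (INR N - 1) / r * u1 r + K r * Rpower (u r) p + mu * f r = 0.

Definition bounded_solution (N : nat) (K f : R -> R) (p mu : R) (u : R -> R) : Prop :=
  solves_E N K f p mu u /\ exists L : R, filterlim u (at_right 0) (locally L).

Definition singular_solution (N : nat) (K f : R -> R) (p mu : R) (u : R -> R) : Prop :=
  solves_E N K f p mu u /\ filterlim u (at_right 0) (Rbar_locally p_infty).

Definition p_S (N : nat) (alpha : R) : R := (INR N + 2 + 2 * alpha) / (INR N - 2).

Definition p_JL (N : nat) (alpha : R) : Rbar :=
  if Rlt_dec (10 + 4 * alpha) (INR N) then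
    Finite (1 + 2 * (2 + alpha) /
      (INR N - 4 - alpha - sqrt ((2 + alpha) * (2 * INR N - 2 + alpha))))
  else p_infty.

(* Main.v *)
(* In the variable [t = ln r], with [y = - u_t] and [m = N - 2], the equation is the system [orbit]:
   [u' = - y], [y' = - m y + k u^p + h]. The regular solutions [u_xi] (with [u -> xi] at [t = -oo])
   exist for every [xi > 0], decrease, and depend continuously on [xi]; they yield bounded solutions
   unless they reach zero. Suppose that all of them with [xi >= xi0] reach zero. The difference
   [u_xi - u*] is negative near [-oo] and beyond the zero of [u_xi], and its zeros are simple, so the
   number of zeros is finite and independent of [xi >= xi0].

   On the other hand this number tends to infinity with [xi]. Set [theta = (2 + alpha) / (p - 1)] and
   [A] the constant with [k0 A^(p-1) = theta (m - theta)]. A Lyapunov function shows that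
   [exp (theta t) u* -> A] at [-oo], and that the limit problem [K = k0 r^alpha], [f = 0], has a regular
   orbit with [exp (theta t) u0 -> A] at [+oo]; here [p > p_S] is used. As [xi -> oo], the rescaled
   [u_xi] converge to [u0], hence [u_xi] and [u*] are both close to [A exp (- theta t)] on windows of
   arbitrary length, where [p < p_JL] makes the equation of the difference oscillatory. *)
Require Import Defs.
From Stdlib Require Import Arith Reals Lra Lia Classical ClassicalEpsilon.
From Coquelicot Require Import Coquelicot.
Open Scope R_scope.

(** * Calculus on the line and truncated powers *)

(** The power is truncated at zero, so a regular orbit continues past its zero to the whole line,
    where it decreases and stays negative. The family is thus global, and the number of
    intersections with the singular orbit can change only if zeros merge or escape. They cannot
    merge: a tangency would, by backward uniqueness, identify the two orbits up to [-oo], where only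
    one is bounded.

    The origin [r = 0] is [t = -oo], so there is no initial time. Integral equations, Picard
    iteration and Gronwall estimates all start at [-oo]; the exponential decay that makes this
    possible is what [alpha > -2] and [nu > -2] provide.

    With [b = theta (m - theta)] and [a = m - 2 theta], the condition [p > p_S] says that the
    damping [a] is positive, and [p < p_JL] that [z'' + a z' + (p - 1) b z = 0] has nonreal
    characteristic roots. The energy of the rescaled equation controls only the velocity; a cross
    term with the force is added so that one function controls velocity and force together, which
    replaces an invariance argument in the nonautonomous case. *)

Lemma D_eq (f : R -> R) (x l l' : R) : is_derive f x l -> l = l' -> is_derive f x l'.
Proof. intros H <-; exact H. Qed.

Lemma D_const (a x : R) : is_derive (fun _ : R => a) x 0.
Proof. exact (is_derive_const a x). Qed.

Lemma D_id (x : R) : is_derive (fun t : R => t) x 1.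
Proof. exact (is_derive_id x). Qed.

Lemma D_opp (f : R -> R) (x df : R) : is_derive f x df -> is_derive (fun t => - f t) x (- df).
Proof. intros H; exact (is_derive_opp f x df H). Qed.

Lemma D_plus (f g : R -> R) (x df dg : R) :
  is_derive f x df -> is_derive g x dg -> is_derive (fun t => f t + g t) x (df + dg).
Proof. intros Hf Hg; exact (is_derive_plus f g x df dg Hf Hg). Qed.

Lemma D_minus (f g : R -> R) (x df dg : R) :
  is_derive f x df -> is_derive g x dg -> is_derive (fun t => f t - g t) x (df - dg).
Proof. intros Hf Hg; exact (is_derive_minus f g x df dg Hf Hg). Qed.

Lemma D_mult (f g : R -> R) (x df dg : R) :
  is_derive f x df -> is_derive g x dg -> is_derive (fun t => f t * g t) x (df * g x + f x * dg).
Proof. intros Hf Hg; exact (Derive.is_derive_mult f g x df dg Hf Hg). Qed.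

Lemma D_div (f g : R -> R) (x df dg : R) :
  is_derive f x df -> is_derive g x dg -> g x <> 0 ->
  is_derive (fun t => f t / g t) x ((df * g x - f x * dg) / g x ^ 2).
Proof. intros; now apply is_derive_div. Qed.

Lemma D_comp (f g : R -> R) (x df dg : R) :
  is_derive f (g x) df -> is_derive g x dg -> is_derive (fun t => f (g t)) x (df * dg).
Proof.
intros Hf Hg. apply D_eq with (scal dg df).
- exact (is_derive_comp f g x df dg Hf Hg).
- apply Rmult_comm.
Qed.

Lemma D_exp (f : R -> R) (x df : R) :
  is_derive f x df -> is_derive (fun t => exp (f t)) x (exp (f x) * df).
Proof. intros H; exact (D_comp exp f x (exp (f x)) df (is_derive_exp (f x)) H). Qed.

Lemma D_ln (f : R -> R) (x df : R) :
  is_derive f x df -> 0 < f x -> is_derive (fun t => ln (f t)) x (/ f x * df).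
Proof. intros H H0; exact (D_comp ln f x (/ f x) df (is_derive_ln (f x) H0) H). Qed.

Lemma D_pow (f : R -> R) (n : nat) (x df : R) :
  is_derive f x df -> is_derive (fun t => f t ^ n) x (INR n * df * f x ^ pred n).
Proof. intros; now apply is_derive_pow. Qed.

Lemma D_sin (f : R -> R) (x df : R) :
  is_derive f x df -> is_derive (fun t => sin (f t)) x (cos (f x) * df).
Proof. intros H; exact (D_comp sin f x _ df (is_derive_sin (f x)) H). Qed.

Lemma D_cos (f : R -> R) (x df : R) :
  is_derive f x df -> is_derive (fun t => cos (f t)) x (- sin (f x) * df).
Proof. intros H; exact (D_comp cos f x _ df (is_derive_cos (f x)) H). Qed.

Ltac der1 :=
  lazymatch goal with
  | |- is_derive (Rmult ?a) _ _ => apply (D_mult (fun _ => a) (fun t => t))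
  | |- is_derive (Rplus ?a) _ _ => apply (D_plus (fun _ => a) (fun t => t))
  | |- is_derive (Rminus ?a) _ _ => apply (D_minus (fun _ => a) (fun t => t))
  | |- is_derive Ropp _ _ => apply (D_opp (fun t => t))
  | |- is_derive (Rdiv ?a) _ _ => apply (D_div (fun _ => a) (fun t => t))
  | |- is_derive exp _ _ => apply (D_exp (fun t => t))
  | |- is_derive ln _ _ => apply (D_ln (fun t => t))
  | |- is_derive (fun _ => ?a) _ _ => apply D_const
  | |- is_derive (fun t => t) _ _ => apply D_id
  | |- is_derive (fun t => - _) _ _ => apply D_opp
  | |- is_derive (fun t => _ + _) _ _ => apply D_plus
  | |- is_derive (fun t => _ - _) _ _ => apply D_minus
  | |- is_derive (fun t => _ * _) _ _ => apply D_mult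
  | |- is_derive (fun t => _ / _) _ _ => apply D_div
  | |- is_derive (fun t => _ ^ _) _ _ => apply D_pow
  | |- is_derive (fun t => exp _) _ _ => apply D_exp
  | |- is_derive (fun t => ln _) _ _ => apply D_ln
  | |- is_derive (fun t => sin _) _ _ => apply D_sin
  | |- is_derive (fun t => cos _) _ _ => apply D_cos
  end.

(** Derivatives of named functions are taken from the context, hence the facts posed before its
    uses. What remains are the side conditions of quotients and logarithms and, last, the equation
    between the computed and the claimed derivative. *)
Ltac der := eapply D_eq; [repeat (first [eassumption | der1]) | ]; cbv beta.

Lemma derive_continuous (f : R -> R) (x l : R) : is_derive f x l -> continuous f x.
Proof. intros H; apply (@ex_derive_continuous R_AbsRing R_NormedModule f x); exists l; exact H. Qed.

Lemma derive_continuity_pt (f : R -> R) (x l : R) : is_derive f x l -> continuity_pt f x.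
Proof.
intros H; apply continuity_pt_filterlim.
exact (derive_continuous f x l H).
Qed.

Lemma mvt (f df : R -> R) (a b : R) : a < b ->
  (forall t, a <= t <= b -> is_derive f t (df t)) ->
  exists c, a <= c <= b /\ f b - f a = df c * (b - a).
Proof.
intros Hab H.
destruct (MVT_gen f a b df) as [c Hc].
- intros x; rewrite Rmin_left, Rmax_right by lra; intros; apply H; lra.
- intros x; rewrite Rmin_left, Rmax_right by lra; intros.
  apply derive_continuity_pt with (df x), H; lra.
- rewrite Rmin_left, Rmax_right in Hc by lra; exists c; exact Hc.
Qed.

Lemma derive_incr (f df : R -> R) (a b : R) : a <= b ->
  (forall t, a <= t <= b -> is_derive f t (df t)) ->
  (forall t, a <= t <= b -> 0 <= df t) -> f a <= f b.
Proof.
intros Hab H H0. destruct (Req_dec a b) as [->|Hn]; [lra|].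
destruct (mvt f df a b) as [c [Hc E]]; [lra|auto|].
assert (0 <= df c * (b - a)) by (apply Rmult_le_pos; [apply H0; lra | lra]). lra.
Qed.

Lemma derive_decr (f df : R -> R) (a b : R) : a <= b ->
  (forall t, a <= t <= b -> is_derive f t (df t)) ->
  (forall t, a <= t <= b -> df t <= 0) -> f b <= f a.
Proof.
intros Hab H H0.
enough (- f a <= - f b) by lra.
apply (derive_incr (fun t => - f t) (fun t => - df t)); auto.
- intros; apply D_opp; auto.
- intros t Ht; specialize (H0 t Ht); lra.
Qed.

Lemma derive_incr_strict (f df : R -> R) (a b : R) : a < b ->
  (forall t, a <= t <= b -> is_derive f t (df t)) ->
  (forall t, a <= t <= b -> 0 < df t) -> f a < f b.
Proof.
intros Hab H H0.
destruct (mvt f df a b) as [c [Hc E]]; [lra|auto|].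
assert (0 < df c * (b - a)) by (apply Rmult_lt_0_compat; [apply H0; lra | lra]). lra.
Qed.

(** * Limits at infinity and comparison from [-oo] *)

Lemma is_lim_minf (f : R -> R) (l : R) :
  is_lim f m_infty l <-> forall eps, 0 < eps -> exists T, forall t, t <= T -> Rabs (f t - l) < eps.
Proof.
rewrite <- is_lim_spec; split.
- intros H eps He. destruct (H (mkposreal eps He)) as [M HM].
  exists (M - 1); intros; apply HM; lra.
- intros H eps. destruct (H eps (cond_pos eps)) as [T HT].
  exists T; intros; apply HT; lra.
Qed.

Lemma is_lim_pinf (f : R -> R) (l : R) :
  is_lim f p_infty l <-> forall eps, 0 < eps -> exists T, forall t, T <= t -> Rabs (f t - l) < eps.
Proof.
rewrite <- is_lim_spec; split.
- intros H eps He. destruct (H (mkposreal eps He)) as [M HM].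
  exists (M + 1); intros; apply HM; lra.
- intros H eps. destruct (H eps (cond_pos eps)) as [T HT].
  exists T; intros; apply HT; lra.
Qed.

Lemma is_lim_mult' (f g : R -> R) (x : Rbar) (a b : R) :
  is_lim f x a -> is_lim g x b -> is_lim (fun t => f t * g t) x (a * b).
Proof. intros Hf Hg. now apply (is_lim_mult f g x a b). Qed.

(** The form of monotonicity used throughout: the limit at [-oo] takes the place of an initial
    value. *)
Lemma incr_ge_lim (f df : R -> R) (T l : R) :
  (forall t, t <= T -> is_derive f t (df t)) -> (forall t, t <= T -> 0 <= df t) ->
  is_lim f m_infty l -> forall t, t <= T -> l <= f t.
Proof.
intros H H0 Hl t Ht.
apply Rnot_lt_le; intros Hlt.
destruct (proj1 (is_lim_minf f l) Hl ((l - f t) / 2)) as [T' HT']; [lra|].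
specialize (HT' (Rmin T' t) (Rmin_l _ _)).
assert (f (Rmin T' t) <= f t).
{ apply (derive_incr f df); [apply Rmin_r| |]; intros; [apply H|apply H0]; lra. }
apply Rabs_def2 in HT'. lra.
Qed.

Lemma decr_le_lim (f df : R -> R) (T l : R) :
  (forall t, t <= T -> is_derive f t (df t)) -> (forall t, t <= T -> df t <= 0) ->
  is_lim f m_infty l -> forall t, t <= T -> f t <= l.
Proof.
intros H H0 Hl t Ht.
enough (- l <= - f t) by lra.
apply (incr_ge_lim (fun t => - f t) (fun t => - df t) T (- l)); auto.
- intros; apply D_opp; auto.
- intros s Hs; specialize (H0 s Hs); lra.
- exact (is_lim_opp f m_infty l Hl).
Qed.

(** For the singular orbit, whose quantities are known only to be nonnegative near [-oo]: an
    asymptotic lower bound is enough. *)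
Lemma incr_ge_liminf (f df : R -> R) (T l : R) :
  (forall t, t <= T -> is_derive f t (df t)) -> (forall t, t <= T -> 0 <= df t) ->
  (forall eps, 0 < eps -> exists T', forall t, t <= T' -> l - eps <= f t) ->
  forall t, t <= T -> l <= f t.
Proof.
intros H H0 Hl t Ht.
apply Rnot_lt_le; intros Hlt.
destruct (Hl ((l - f t) / 2)) as [T' HT']; [lra|].
specialize (HT' (Rmin T' t) (Rmin_l _ _)).
assert (f (Rmin T' t) <= f t).
{ apply (derive_incr f df); [apply Rmin_r| |]; intros; [apply H|apply H0]; lra. }
lra.
Qed.

Lemma is_lim_exp_minf (c : R) : 0 < c -> is_lim (fun t => exp (c * t)) m_infty 0.
Proof.
intros Hc. apply is_lim_minf; intros eps He.
exists ((ln eps - 1) / c); intros t Ht.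
rewrite Rminus_0_r, Rabs_pos_eq by (left; apply exp_pos).
rewrite <- (exp_ln eps) at 1 by lra. apply exp_increasing.
apply Rmult_le_compat_l with (r := c) in Ht; [|lra].
replace (c * ((ln eps - 1) / c)) with (ln eps - 1) in Ht by (field; lra). lra.
Qed.

(** Zero on the negative half-line, and still continuously differentiable because [p > 1]. Orbits
    can therefore be continued beyond their zeros, and on [u <= M] the power is Lipschitz with the
    constant taken at [M]. *)
Definition ppow (p x : R) : R := if Rlt_dec 0 x then Rpower x p else 0.

Lemma ppow_pos_eq (p x : R) : 0 < x -> ppow p x = Rpower x p.
Proof. intros; unfold ppow; destruct (Rlt_dec 0 x); lra. Qed.

Lemma ppow_neg (p x : R) : x <= 0 -> ppow p x = 0.
Proof. intros; unfold ppow; destruct (Rlt_dec 0 x); lra. Qed.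

Lemma ppow_pos (p x : R) : 0 < x -> 0 < ppow p x.
Proof. intros; rewrite ppow_pos_eq by lra; apply exp_pos. Qed.

Lemma ppow_nonneg (p x : R) : 0 <= ppow p x.
Proof.
destruct (Rlt_le_dec 0 x) as [H|H].
- now left; apply ppow_pos.
- rewrite ppow_neg; lra.
Qed.

Lemma ppow_le (p x y : R) : 0 <= p -> x <= y -> ppow p x <= ppow p y.
Proof.
intros Hp Hxy. destruct (Rlt_le_dec 0 x) as [H|H].
- rewrite !ppow_pos_eq by lra. apply Rle_Rpower_l; lra.
- rewrite (ppow_neg p x) by lra. apply ppow_nonneg.
Qed.

Lemma ppow_mult (p x y : R) : 0 < x -> ppow p (x * y) = ppow p x * ppow p y.
Proof.
intros Hx. destruct (Rlt_le_dec 0 y) as [H|H].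
- rewrite !ppow_pos_eq by (try apply Rmult_lt_0_compat; lra).
  now rewrite <- Rpower_mult_distr.
- rewrite (ppow_neg p y) by lra. rewrite ppow_neg; [ring|nra].
Qed.

Lemma ppow_exp (p x : R) : ppow p (exp x) = exp (p * x).
Proof. rewrite ppow_pos_eq by apply exp_pos; unfold Rpower; now rewrite ln_exp. Qed.

Lemma ppow_plus (p q x : R) : ppow (p + q) x = ppow p x * ppow q x.
Proof.
destruct (Rlt_le_dec 0 x) as [H|H].
- rewrite !ppow_pos_eq by lra. apply Rpower_plus.
- rewrite !ppow_neg by lra. ring.
Qed.

Lemma ppow_1 (x : R) : 0 <= x -> ppow 1 x = x.
Proof.
intros [H|<-].
- rewrite ppow_pos_eq by lra. now apply Rpower_1.
- now apply ppow_neg; lra.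
Qed.

Lemma ppow_pred (p x : R) : ppow p x = ppow (p - 1) x * x.
Proof.
destruct (Rlt_le_dec 0 x) as [H|H].
- rewrite <- (ppow_1 x) at 3 by lra. rewrite <- ppow_plus. f_equal; ring.
- rewrite !ppow_neg by lra; ring.
Qed.

Lemma is_derive_Rpower (p x : R) : 0 < x -> is_derive (fun s => Rpower s p) x (p * Rpower x (p - 1)).
Proof.
intros Hx. apply is_derive_Reals. now apply derivable_pt_lim_power.
Qed.

Lemma ppow_small (p : R) : 0 < p -> forall eps, 0 < eps ->
  exists d, 0 < d /\ forall x, x <= d -> ppow p x <= eps.
Proof.
intros Hp eps He. exists (Rpower eps (/ p)). split; [apply exp_pos|].
intros x Hx. apply Rle_trans with (ppow p (Rpower eps (/ p))).
- apply ppow_le; lra.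
- rewrite ppow_pos_eq by apply exp_pos. rewrite Rpower_mult.
  rewrite Rinv_l by lra. rewrite Rpower_1; lra.
Qed.

Lemma is_derive_ppow (p x : R) : 1 < p -> is_derive (ppow p) x (p * ppow (p - 1) x).
Proof.
intros Hp. destruct (Rtotal_order x 0) as [H|[H|H]].
- rewrite ppow_neg by lra. rewrite Rmult_0_r.
  apply (is_derive_ext_loc (fun _ => 0)); [|apply D_const].
  exists (mkposreal (- x) ltac:(lra)); intros y Hy.
  apply Rabs_def2 in Hy; cbn in Hy; unfold minus, plus, opp in Hy; cbn in Hy.
  rewrite ppow_neg; lra.
- subst x. rewrite ppow_neg by lra. rewrite Rmult_0_r.
  apply is_derive_Reals. intros eps He.
  destruct (ppow_small (p - 1) ltac:(lra) (eps / 2) ltac:(lra)) as [d [Hd Hs]].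
  exists (mkposreal d Hd); intros h Hh Hhd; cbn in Hhd.
  rewrite Rplus_0_l, (ppow_neg p 0) by lra. rewrite ppow_pred.
  replace ((ppow (p - 1) h * h - 0) / h - 0) with (ppow (p - 1) h) by (field; auto).
  rewrite Rabs_pos_eq by apply ppow_nonneg.
  apply Rle_lt_trans with (eps / 2); [|lra]. apply Hs.
  apply Rabs_def2 in Hhd; lra.
- rewrite ppow_pos_eq by lra.
  apply (is_derive_ext_loc (fun s => Rpower s p)); [|now apply is_derive_Rpower].
  exists (mkposreal x H); intros y Hy.
  apply Rabs_def2 in Hy; cbn in Hy; unfold minus, plus, opp in Hy; cbn in Hy.
  rewrite ppow_pos_eq; lra.
Qed.

Lemma D_ppow (p : R) (f : R -> R) (x df : R) : 1 < p ->
  is_derive f x df -> is_derive (fun t => ppow p (f t)) x (p * ppow (p - 1) (f x) * df).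
Proof. intros Hp H; exact (D_comp (ppow p) f x _ df (is_derive_ppow p (f x) Hp) H). Qed.

Lemma continuous_ppow (p x : R) : 1 < p -> continuous (ppow p) x.
Proof. intros; eapply derive_continuous; now apply is_derive_ppow. Qed.

(** The slope between [y] and [x] is at least the slope at [a], as the derivative is nondecreasing.
    This is the linear minorant needed for Sturm comparison. *)
Lemma ppow_lower_tangent (p a x y : R) : 1 < p -> 0 < a -> a <= y -> y <= x ->
  p * ppow (p - 1) a * (x - y) <= ppow p x - ppow p y.
Proof.
intros Hp Ha Hy Hxy.
destruct (Req_dec y x) as [->|Hn]; [lra|].
destruct (mvt (ppow p) (fun s => p * ppow (p - 1) s) y x) as [c [Hc ->]]; [lra| |].
- intros; now apply is_derive_ppow.
- apply Rmult_le_compat_r; [lra|]. apply Rmult_le_compat_l; [lra|]. apply ppow_le; lra.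
Qed.

Lemma ppow_lipschitz (p M x y : R) : 1 < p -> x <= M -> y <= M ->
  Rabs (ppow p x - ppow p y) <= p * ppow (p - 1) M * Rabs (x - y).
Proof.
intros Hp. enough (W : forall x y, x <= M -> y <= M -> y <= x ->
  Rabs (ppow p x - ppow p y) <= p * ppow (p - 1) M * Rabs (x - y)).
{ intros Hx Hy. destruct (Rle_dec y x); [now apply W|].
  rewrite (Rabs_minus_sym _ (ppow p y)), (Rabs_minus_sym x). apply W; lra. }
clear x y; intros x y Hx Hy Hyx.
destruct (Req_dec y x) as [->|Hn].
- rewrite !Rminus_diag, !Rabs_R0, Rmult_0_r. lra.
- destruct (mvt (ppow p) (fun s => p * ppow (p - 1) s) y x) as [c [Hc ->]]; [lra| |].
  + intros; now apply is_derive_ppow.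
  + rewrite Rabs_mult. apply Rmult_le_compat_r; [apply Rabs_pos|].
    rewrite Rabs_pos_eq by (apply Rmult_le_pos; [lra|apply ppow_nonneg]).
    apply Rmult_le_compat_l; [lra|]. apply ppow_le; lra.
Qed.

Definition orbit (m p : R) (k h u y : R -> R) : Prop :=
  forall t : R, is_derive u t (- y t) /\
    is_derive y t (- m * y t + (k t * ppow p (u t) + h t)).

Definition regular (xi : R) (u y : R -> R) : Prop :=
  is_lim u m_infty xi /\ is_lim y m_infty 0.

(** Exponential decay at [-oo] with rate [c]; for [c > 0] it makes [F] integrable there. *)
Definition tame (c : R) (F : R -> R) : Prop :=
  (forall t : R, continuous F t) /\
  exists C T, forall t, t <= T -> Rabs (F t) <= C * exp (c * t).

(** * Regular orbits: existence *)

Lemma exp_mono (x y : R) : x <= y -> exp x <= exp y.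
Proof. intros [H| ->]; [left; now apply exp_increasing | right; reflexivity]. Qed.

Lemma continuous_of_eps (f : R -> R) (x : R) :
  (forall eps, 0 < eps -> exists d, 0 < d /\ forall y, Rabs (y - x) < d -> Rabs (f y - f x) < eps) ->
  continuous f x.
Proof.
intros H. apply filterlim_locally; intros eps.
destruct (H eps (cond_pos eps)) as [d [Hd Hy]].
exists (mkposreal d Hd); intros y Hb; apply Hy; exact Hb.
Qed.

Lemma eps_of_continuous (f : R -> R) (x : R) : continuous f x ->
  forall eps, 0 < eps -> exists d, 0 < d /\ forall y, Rabs (y - x) < d -> Rabs (f y - f x) < eps.
Proof.
intros H eps He. destruct (proj1 (filterlim_locally f (f x)) H (mkposreal eps He)) as [d Hd].
exists d; split; [apply cond_pos|]; intros y Hy; apply Hd; exact Hy.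
Qed.

Lemma cont_mult (f g : R -> R) (x : R) : continuous f x -> continuous g x ->
  continuous (fun t => f t * g t) x.
Proof. intros; now apply (continuous_mult f g). Qed.

Lemma cont_plus (f g : R -> R) (x : R) : continuous f x -> continuous g x ->
  continuous (fun t => f t + g t) x.
Proof. intros; now apply (continuous_plus f g). Qed.

Lemma cont_comp (f g : R -> R) (x : R) : continuous g x -> continuous f (g x) ->
  continuous (fun t => f (g t)) x.
Proof. intros; now apply (continuous_comp g f). Qed.

Lemma cont_exp_lin (c x : R) : continuous (fun t => exp (c * t)) x.
Proof. eapply derive_continuous. der; reflexivity. Qed.

Lemma tame_mult (c B : R) (F g : R -> R) : tame c F -> (forall t : R, continuous g t) ->
  (exists T, forall t, t <= T -> Rabs (g t) <= B) -> tame c (fun t => F t * g t).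
Proof.
intros [HF [C [T H]]] Hg [T' H']. split; [intros; now apply cont_mult|].
exists (Rabs C * B), (Rmin T T'); intros t Ht.
pose proof (Rmin_l T T'); pose proof (Rmin_r T T').
rewrite Rabs_mult.
replace (Rabs C * B * exp (c * t)) with (Rabs C * exp (c * t) * B) by ring.
apply Rmult_le_compat; try apply Rabs_pos; [|apply H'; lra].
eapply Rle_trans; [apply H; lra|]. apply Rmult_le_compat_r; [left; apply exp_pos|apply Rle_abs].
Qed.

Lemma tame_plus (c : R) (F G : R -> R) : tame c F -> tame c G -> tame c (fun t => F t + G t).
Proof.
intros [HF [C [T H]]] [HG [C' [T' H']]]. split; [intros; now apply cont_plus|].
exists (C + C'), (Rmin T T'); intros t Ht.
pose proof (Rmin_l T T'); pose proof (Rmin_r T T').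
eapply Rle_trans; [apply Rabs_triang|]. rewrite Rmult_plus_distr_r.
apply Rplus_le_compat; [apply H|apply H']; lra.
Qed.

Lemma tame_scal (c a : R) (F : R -> R) : tame c F -> tame c (fun t => a * F t).
Proof.
intros [HF [C [T H]]]. split.
- intros; apply (cont_mult (fun _ => a)); [apply continuous_const|auto].
- exists (Rabs a * C), T; intros t Ht. rewrite Rabs_mult, Rmult_assoc.
  apply Rmult_le_compat_l; [apply Rabs_pos|auto].
Qed.

Lemma tame_exp (c m : R) (F : R -> R) : 0 < m -> tame c F -> tame c (fun t => exp (m * t) * F t).
Proof.
intros Hm [HF [C [T H]]]. split.
- intros; apply cont_mult; [apply cont_exp_lin|auto].
- exists C, (Rmin T 0); intros t Ht.
  pose proof (Rmin_l T 0); pose proof (Rmin_r T 0).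
  rewrite Rabs_mult, (Rabs_pos_eq (exp _)) by (left; apply exp_pos).
  rewrite <- (Rmult_1_l (C * _)). apply Rmult_le_compat; try apply Rabs_pos.
  + left; apply exp_pos.
  + rewrite <- exp_0. apply exp_mono. nra.
  + apply H; lra.
Qed.

(* The substitution [s = exp (c t / 2)] turns the integral over [(-oo, t]] into
   the integral of a continuous function over a bounded interval. *)
Definition tail_integrand (c : R) (F : R -> R) (s : R) : R :=
  if Rlt_dec 0 s then F (2 * ln s / c) * (2 / (c * s)) else 0.

Definition tail_integral (c : R) (F : R -> R) (t : R) : R :=
  RInt (tail_integrand c F) 0 (exp (c / 2 * t)).

Lemma continuous_tail_integrand (c : R) (F : R -> R) : 0 < c -> tame c F ->
  forall s : R, continuous (tail_integrand c F) s.
Proof.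
intros Hc [HF [C [T HC]]] s. destruct (Rtotal_order s 0) as [H|[H|H]].
- apply (continuous_ext_loc _ (fun _ => 0)); [|apply continuous_const].
  exists (mkposreal (- s) ltac:(lra)); intros y Hy.
  apply Rabs_def2 in Hy; cbn in Hy; unfold minus, plus, opp in Hy; cbn in Hy.
  unfold tail_integrand; destruct (Rlt_dec 0 y); lra.
(* With [s = exp (c t / 2)] the bound [C * exp (c * t)] becomes [C * s ^ 2], one power more than the
   Jacobian [2 / (c * s)] removes. The exponent is halved in order to gain continuity at 0. *)
- subst s. apply continuous_of_eps; intros eps He.
  set (B := 2 * (Rabs C + 1) / c).
  assert (HB : 0 < B).
  { unfold B; apply Rdiv_lt_0_compat; [|lra]. pose proof (Rabs_pos C); lra. }
  exists (Rmin (exp (c / 2 * T)) (eps / B)). split.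
  { apply Rmin_pos; [apply exp_pos|now apply Rdiv_lt_0_compat]. }
  intros y Hy. rewrite Rminus_0_r in Hy.
  unfold tail_integrand. destruct (Rlt_dec 0 0) as [|_]; [lra|]. rewrite Rminus_0_r.
  destruct (Rlt_dec 0 y) as [H|H]; [|rewrite Rabs_R0; lra].
  rewrite Rabs_pos_eq in Hy by lra.
  pose proof (Rmin_l (exp (c / 2 * T)) (eps / B)); pose proof (Rmin_r (exp (c / 2 * T)) (eps / B)).
  assert (Hln : 2 * ln y / c <= T).
  { assert (ln y <= c / 2 * T).
    { rewrite <- (ln_exp (c / 2 * T)). apply ln_le; lra. }
    apply Rmult_le_reg_r with c; [lra|].
    replace (2 * ln y / c * c) with (2 * ln y) by (field; lra). lra. }
  rewrite Rabs_mult, (Rabs_pos_eq (2 / (c * y))).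
  2:{ left; apply Rdiv_lt_0_compat; [lra|]. now apply Rmult_lt_0_compat. }
  assert (E : exp (c * (2 * ln y / c)) = y * y).
  { replace (c * (2 * ln y / c)) with (ln y + ln y) by (field; lra).
    now rewrite exp_plus, exp_ln. }
  specialize (HC _ Hln). rewrite E in HC.
  apply Rle_lt_trans with (B * y).
  + unfold B.
    replace (2 * (Rabs C + 1) / c * y) with ((Rabs C + 1) * (y * y) * (2 / (c * y))) by (field; lra).
    apply Rmult_le_compat_r.
    { left; apply Rdiv_lt_0_compat; [lra|]. now apply Rmult_lt_0_compat. }
    eapply Rle_trans; [exact HC|]. apply Rmult_le_compat_r; [nra|].
    pose proof (Rle_abs C); lra.
  + apply Rlt_le_trans with (B * (eps / B)); [apply Rmult_lt_compat_l; lra|].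
    right; field; lra.
- apply (continuous_ext_loc _ (fun s => F (2 * ln s / c) * (2 / (c * s)))).
  + exists (mkposreal s H); intros y Hy.
    apply Rabs_def2 in Hy; cbn in Hy; unfold minus, plus, opp in Hy; cbn in Hy.
    unfold tail_integrand; destruct (Rlt_dec 0 y); lra.
  + apply cont_mult.
    * apply (cont_comp F (fun s => 2 * ln s / c)); [|apply HF].
      eapply derive_continuous. der; [lra|reflexivity].
    * eapply derive_continuous. der; [|reflexivity]. nra.
Qed.

Lemma is_derive_tail_integral (c : R) (F : R -> R) : 0 < c -> tame c F ->
  forall t : R, is_derive (tail_integral c F) t (F t).
Proof.
intros Hc HF t.
pose proof (continuous_tail_integrand c F Hc HF) as Hcont.
eapply D_eq.
- apply (D_comp (fun x => RInt (tail_integrand c F) 0 x) (fun t => exp (c / 2 * t))).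
  + apply (is_derive_RInt (tail_integrand c F) _ 0); [|apply Hcont].
    exists (mkposreal 1 Rlt_0_1); intros b _.
    apply (@RInt_correct R_CompleteNormedModule).
    apply (@ex_RInt_continuous R_CompleteNormedModule). intros; apply Hcont.
  + der; reflexivity.
- cbn beta. unfold tail_integrand. pose proof (exp_pos (c / 2 * t)).
  destruct (Rlt_dec 0 (exp (c / 2 * t))); [|lra].
  rewrite ln_exp. replace (2 * (c / 2 * t) / c) with t by (field; lra). field; lra.
Qed.

Lemma is_lim_tail_integral (c : R) (F : R -> R) : 0 < c -> tame c F ->
  is_lim (tail_integral c F) m_infty 0.
Proof.
intros Hc HF.
pose proof (continuous_tail_integrand c F Hc HF) as Hcont.
assert (H0 : continuous (fun x => RInt (tail_integrand c F) 0 x) 0).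
{ eapply derive_continuous. apply (is_derive_RInt (tail_integrand c F) _ 0); [|apply Hcont].
  exists (mkposreal 1 Rlt_0_1); intros b _.
  apply (@RInt_correct R_CompleteNormedModule).
    apply (@ex_RInt_continuous R_CompleteNormedModule). intros; apply Hcont. }
unfold continuous in H0. rewrite RInt_point in H0.
apply (filterlim_comp _ _ _ (fun t => exp (c / 2 * t)) (fun x => RInt (tail_integrand c F) 0 x)
  _ (locally 0) _); [|exact H0].
apply (is_lim_exp_minf (c / 2)); lra.
Qed.

Lemma lim0_bound (f F : R -> R) (C c T : R) : 0 < c ->
  (forall t, t <= T -> is_derive f t (F t)) -> is_lim f m_infty 0 ->
  (forall t, t <= T -> Rabs (F t) <= C * exp (c * t)) ->
  forall t, t <= T -> Rabs (f t) <= C / c * exp (c * t).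
Proof.
intros Hc Hf Hl HF t Ht.
assert (He : is_lim (fun t => C / c * exp (c * t)) m_infty 0).
{ replace (Finite 0) with (Rbar_mult (C / c) 0) by (cbn; f_equal; ring).
  apply is_lim_scal_l. now apply is_lim_exp_minf. }
assert (D : forall s : R, is_derive (fun t => C / c * exp (c * t)) s (C * exp (c * s))).
{ intros s. der. field; lra. }
assert (A1 : 0 <= C / c * exp (c * t) - f t).
{ apply (incr_ge_lim (fun t => C / c * exp (c * t) - f t) (fun t => C * exp (c * t) - F t) T); auto.
  - intros s Hs; apply D_minus; auto.
  - intros s Hs; specialize (HF s Hs); apply Rabs_le_between in HF; lra.
  - replace (Finite 0) with (Finite (0 - 0)) by (f_equal; ring).
    now apply is_lim_minus'. }
assert (A2 : 0 <= C / c * exp (c * t) + f t).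
{ apply (incr_ge_lim (fun t => C / c * exp (c * t) + f t) (fun t => C * exp (c * t) + F t) T); auto.
  - intros s Hs; apply D_plus; auto.
  - intros s Hs; specialize (HF s Hs); apply Rabs_le_between in HF; lra.
  - replace (Finite 0) with (Finite (0 + 0)) by (f_equal; ring).
    now apply is_lim_plus'. }
apply Rabs_le; lra.
Qed.

Lemma tail_integral_le (c a : R) (F : R -> R) (g dg : R -> R) (T : R) : 0 < c -> tame c F ->
  (forall t, t <= T -> is_derive g t (dg t)) -> is_lim g m_infty a ->
  (forall t, t <= T -> F t <= dg t) -> forall t, t <= T -> tail_integral c F t <= g t - a.
Proof.
intros Hc HF Hg Hl H t Ht.
enough (a - 0 <= g t - tail_integral c F t) by lra.
apply (incr_ge_lim (fun t => g t - tail_integral c F t) (fun t => dg t - F t) T); auto.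
- intros s Hs; apply D_minus; [auto|now apply is_derive_tail_integral].
- intros s Hs; specialize (H s Hs); lra.
- apply is_lim_minus'; [auto|now apply is_lim_tail_integral].
Qed.

Lemma tail_integral_nonneg (c : R) (F : R -> R) : 0 < c -> tame c F -> (forall t, 0 <= F t) ->
  forall t, 0 <= tail_integral c F t.
Proof.
intros Hc HF H t. apply (incr_ge_lim (tail_integral c F) F t); auto; try lra.
- intros; now apply is_derive_tail_integral.
- now apply is_lim_tail_integral.
Qed.

Lemma tail_integral_mono (c : R) (F : R -> R) : 0 < c -> tame c F -> (forall t, 0 <= F t) ->
  forall s t, s <= t -> tail_integral c F s <= tail_integral c F t.
Proof.
intros Hc HF H s t Hst. apply (derive_incr (tail_integral c F) F); auto.
intros; now apply is_derive_tail_integral.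
Qed.

(* [damped_integral c m F] solves [y' = - m y + F], and [damped_primitive c m F] is its primitive;
   both vanish at [-oo], and [c] is only the decay rate of [F]. *)
Definition damped_integral (c m : R) (F : R -> R) (t : R) : R :=
  exp (- m * t) * tail_integral c (fun s => exp (m * s) * F s) t.

Definition damped_primitive (c m : R) (F : R -> R) (t : R) : R := (tail_integral c F t - damped_integral c m F t) / m.

Lemma is_derive_damped_integral (c m : R) (F : R -> R) : 0 < c -> 0 < m -> tame c F ->
  forall t : R, is_derive (damped_integral c m F) t (- m * damped_integral c m F t + F t).
Proof.
intros Hc Hm HF t. unfold damped_integral.
pose proof (is_derive_tail_integral c _ Hc (tame_exp c m F Hm HF) t) as H.
der. replace (- m * t) with (- (m * t)) by ring.
pose proof (exp_pos (m * t)). rewrite exp_Ropp. field; lra.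
Qed.

(** The factor [exp (- m * t)] explodes at [-oo], so the limit of the tail integral does not
    suffice: its rate [exp ((m + c) * t)] is needed. *)
Lemma is_lim_damped_integral (c m : R) (F : R -> R) : 0 < c -> 0 < m -> tame c F ->
  is_lim (damped_integral c m F) m_infty 0.
Proof.
intros Hc Hm HF.
pose proof (tame_exp c m F Hm HF) as HF'.
destruct HF as [HF [C [T HC]]].
assert (B : forall t, t <= T -> Rabs (damped_integral c m F t) <= C / (m + c) * exp (c * t)).
{ intros t Ht. unfold damped_integral. rewrite Rabs_mult, Rabs_pos_eq by (left; apply exp_pos).
  replace (C / (m + c) * exp (c * t)) with (exp (- m * t) * (C / (m + c) * exp ((m + c) * t))).
  2:{ replace ((m + c) * t) with (c * t + m * t) by ring.
      replace (- m * t) with (- (m * t)) by ring.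
      rewrite exp_plus, exp_Ropp. field. split; [lra|apply Rgt_not_eq, exp_pos]. }
  apply Rmult_le_compat_l; [left; apply exp_pos|].
  apply (lim0_bound _ (fun s => exp (m * s) * F s) _ _ T); try lra.
  - intros; now apply (is_derive_tail_integral c (fun s => exp (m * s) * F s)).
  - now apply is_lim_tail_integral.
  - intros s Hs. rewrite Rabs_mult, Rabs_pos_eq by (left; apply exp_pos).
    replace ((m + c) * s) with (m * s + c * s) by ring. rewrite exp_plus.
    replace (C * (exp (m * s) * exp (c * s))) with (exp (m * s) * (C * exp (c * s))) by ring.
    apply Rmult_le_compat_l; [left; apply exp_pos|auto]. }
apply is_lim_minf; intros eps He.
assert (L : is_lim (fun t => C / (m + c) * exp (c * t)) m_infty 0).
{ replace (Finite 0) with (Rbar_mult (C / (m + c)) 0) by (cbn; f_equal; ring).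
  apply is_lim_scal_l. now apply is_lim_exp_minf. }
destruct (proj1 (is_lim_minf _ _) L eps He) as [T' HT'].
exists (Rmin T T'); intros t Ht.
pose proof (Rmin_l T T'); pose proof (Rmin_r T T').
rewrite Rminus_0_r. eapply Rle_lt_trans; [apply B; lra|].
eapply Rle_lt_trans; [apply Rle_abs|]. rewrite <- (Rminus_0_r (C / _ * _)). apply HT'; lra.
Qed.

Lemma damped_integral_nonneg (c m : R) (F : R -> R) : 0 < c -> 0 < m -> tame c F -> (forall t, 0 <= F t) ->
  forall t, 0 <= damped_integral c m F t.
Proof.
intros Hc Hm HF H t. unfold damped_integral. apply Rmult_le_pos; [left; apply exp_pos|].
apply tail_integral_nonneg; auto; [now apply tame_exp|].
intros; apply Rmult_le_pos; [left; apply exp_pos|auto].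
Qed.

(** The damped integral [J] satisfies [J' = - m J + F], so the derivative of [tail_integral - J] is
    [m J]. *)
Lemma is_derive_damped_primitive (c m : R) (F : R -> R) : 0 < c -> 0 < m -> tame c F ->
  forall t : R, is_derive (damped_primitive c m F) t (damped_integral c m F t).
Proof.
intros Hc Hm HF t. unfold damped_primitive.
pose proof (is_derive_tail_integral c F Hc HF t) as H1.
pose proof (is_derive_damped_integral c m F Hc Hm HF t) as H2.
der; [lra|]. field; lra.
Qed.

Lemma is_lim_damped_primitive (c m : R) (F : R -> R) : 0 < c -> 0 < m -> tame c F ->
  is_lim (damped_primitive c m F) m_infty 0.
Proof.
intros Hc Hm HF. unfold damped_primitive.
apply is_lim_ext with (fun t => / m * (tail_integral c F t - damped_integral c m F t)); [intros; field; lra|].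
replace (Finite 0) with (Rbar_mult (/ m) (0 - 0)) by (cbn; f_equal; ring).
apply is_lim_scal_l. apply is_lim_minus'; [now apply is_lim_tail_integral|now apply is_lim_damped_integral].
Qed.

(** The damped integrals are compared first, after multiplication by [exp (m * t)], which cancels
    the damping. Dropping a nonnegative damped integral at the end leaves a plain tail integral, to
    which a weighted norm adapts easily. *)
Lemma damped_primitive_diff (c m : R) (F G D : R -> R) (T : R) : 0 < c -> 0 < m ->
  tame c F -> tame c G -> tame c D -> (forall t, 0 <= D t) ->
  (forall t, t <= T -> Rabs (F t - G t) <= D t) ->
  forall t, t <= T -> Rabs (damped_primitive c m F t - damped_primitive c m G t) <= tail_integral c D t / m.
Proof.
intros Hc Hm HF HG HD HD0 H.
assert (HJ : forall t, t <= T -> Rabs (damped_integral c m F t - damped_integral c m G t) <= damped_integral c m D t).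
{ intros t Ht. apply Rabs_le.
  assert (L : forall X, is_lim X m_infty 0 -> is_lim (fun t => exp (m * t) * X t) m_infty 0).
  { intros X HX. replace (Finite 0) with (Finite (0 * 0)) by (f_equal; ring).
    apply is_lim_mult'; [now apply is_lim_exp_minf|exact HX]. }
  assert (E1 : 0 <= exp (m * t) * (damped_integral c m D t - (damped_integral c m F t - damped_integral c m G t))).
  { apply (incr_ge_lim (fun t => exp (m * t) * (damped_integral c m D t - (damped_integral c m F t - damped_integral c m G t)))
      (fun t => exp (m * t) * (D t - (F t - G t))) T); auto.
    - intros s _.
      pose proof (is_derive_damped_integral c m F Hc Hm HF s). pose proof (is_derive_damped_integral c m G Hc Hm HG s).
      pose proof (is_derive_damped_integral c m D Hc Hm HD s). der. ring.
    - intros s Hs. apply Rmult_le_pos; [left; apply exp_pos|].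
      specialize (H s Hs); apply Rabs_le_between in H; lra.
    - apply L. replace (Finite 0) with (Finite (0 - (0 - 0))) by (f_equal; ring).
      repeat apply is_lim_minus'; now apply is_lim_damped_integral. }
  assert (E2 : 0 <= exp (m * t) * (damped_integral c m D t + (damped_integral c m F t - damped_integral c m G t))).
  { apply (incr_ge_lim (fun t => exp (m * t) * (damped_integral c m D t + (damped_integral c m F t - damped_integral c m G t)))
      (fun t => exp (m * t) * (D t + (F t - G t))) T); auto.
    - intros s _.
      pose proof (is_derive_damped_integral c m F Hc Hm HF s). pose proof (is_derive_damped_integral c m G Hc Hm HG s).
      pose proof (is_derive_damped_integral c m D Hc Hm HD s). der. ring.
    - intros s Hs. apply Rmult_le_pos; [left; apply exp_pos|].
      specialize (H s Hs); apply Rabs_le_between in H; lra.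
    - apply L. replace (Finite 0) with (Finite (0 + (0 - 0))) by (f_equal; ring).
      apply is_lim_plus'; [|apply is_lim_minus']; now apply is_lim_damped_integral. }
  pose proof (exp_pos (m * t)). split; nra. }
intros t Ht.
apply Rle_trans with (damped_primitive c m D t).
- apply Rabs_le.
  assert (E1 : 0 <= damped_primitive c m D t - (damped_primitive c m F t - damped_primitive c m G t)).
  { apply (incr_ge_lim (fun t => damped_primitive c m D t - (damped_primitive c m F t - damped_primitive c m G t))
      (fun t => damped_integral c m D t - (damped_integral c m F t - damped_integral c m G t)) T); auto.
    - intros s _. repeat apply D_minus; now apply is_derive_damped_primitive.
    - intros s Hs; specialize (HJ s Hs); apply Rabs_le_between in HJ; lra.
    - replace (Finite 0) with (Finite (0 - (0 - 0))) by (f_equal; ring).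
      repeat apply is_lim_minus'; now apply is_lim_damped_primitive. }
  assert (E2 : 0 <= damped_primitive c m D t + (damped_primitive c m F t - damped_primitive c m G t)).
  { apply (incr_ge_lim (fun t => damped_primitive c m D t + (damped_primitive c m F t - damped_primitive c m G t))
      (fun t => damped_integral c m D t + (damped_integral c m F t - damped_integral c m G t)) T); auto.
    - intros s _. apply D_plus; [|apply D_minus]; now apply is_derive_damped_primitive.
    - intros s Hs; specialize (HJ s Hs); apply Rabs_le_between in HJ; lra.
    - replace (Finite 0) with (Finite (0 + (0 - 0))) by (f_equal; ring).
      apply is_lim_plus'; [|apply is_lim_minus']; now apply is_lim_damped_primitive. }
  lra.
- unfold damped_primitive. apply Rmult_le_compat_r; [left; now apply Rinv_0_lt_compat|].
  pose proof (damped_integral_nonneg c m D Hc Hm HD HD0 t). lra.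
Qed.

Lemma geometric_cauchy (a : nat -> R) (B : R) :
  (forall n, Rabs (a (S n) - a n) <= B / 2 ^ n) ->
  forall n, Rabs (real (Lim_seq a) - a n) <= 2 * B / 2 ^ n.
Proof.
intros H.
assert (P2 : forall n, 0 < 2 ^ n) by (intros; apply pow_lt; lra).
assert (HB : 0 <= B).
{ specialize (H O). cbn in H. pose proof (Rabs_pos (a 1%nat - a O)). lra. }
assert (W : forall n k, Rabs (a (n + k)%nat - a n) <= 2 * B / 2 ^ n * (1 - / 2 ^ k)).
{ intros n; induction k as [|k IH].
  - rewrite Nat.add_0_r, Rminus_diag, Rabs_R0. cbn; lra.
  - replace (a (n + S k)%nat - a n) with ((a (S (n + k)) - a (n + k)%nat) + (a (n + k)%nat - a n))
      by (rewrite Nat.add_succ_r; ring).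
    eapply Rle_trans; [apply Rabs_triang|].
    eapply Rle_trans; [apply Rplus_le_compat; [apply H|exact IH]|].
    rewrite pow_add. cbn [pow]. specialize (P2 n) as Hn; specialize (P2 k) as Hk.
    right; field; lra. }
assert (W' : forall n k, Rabs (a (n + k)%nat - a n) <= 2 * B / 2 ^ n).
{ intros n k. eapply Rle_trans; [apply W|].
  assert (0 <= 2 * B / 2 ^ n).
  { apply Rmult_le_pos; [lra|]. left; now apply Rinv_0_lt_compat. }
  assert (0 < / 2 ^ k) by now apply Rinv_0_lt_compat. nra. }
assert (L0 : is_lim_seq (fun n => 2 * B / 2 ^ n) 0).
{ apply is_lim_seq_ext with (fun n => 2 * B * (/ 2) ^ n).
  - intros n. rewrite pow_inv. reflexivity.
  - replace (Finite 0) with (Rbar_mult (2 * B) 0) by (cbn; f_equal; ring).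
    apply is_lim_seq_scal_l, is_lim_seq_geom. rewrite Rabs_pos_eq; lra. }
assert (Hex : ex_finite_lim_seq a).
{ apply ex_lim_seq_cauchy_corr. intros eps.
  apply is_lim_seq_spec in L0.
  destruct (L0 (mkposreal (eps / 2) ltac:(destruct eps; cbn; lra))) as [N HN]; cbn in HN.
  exists N. assert (HN2 : forall n, (N <= n)%nat -> Rabs (a n - a N) < eps / 2).
  { intros n Hn. replace n with (N + (n - N))%nat by lia.
    eapply Rle_lt_trans; [apply W'|]. specialize (HN N (le_n _)).
    rewrite Rminus_0_r in HN. eapply Rle_lt_trans; [apply Rle_abs|exact HN]. }
  intros n n' Hn Hn'.
  replace (a n - a n') with ((a n - a N) - (a n' - a N)) by ring.
  eapply Rle_lt_trans; [apply Rabs_triang|]. rewrite Rabs_Ropp.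
  specialize (HN2 n Hn) as H1; specialize (HN2 n' Hn') as H2. lra. }
apply Lim_seq_correct' in Hex. intros n.
assert (Hl : is_lim_seq (fun k => Rabs (a (n + k)%nat - a n)) (Rabs (real (Lim_seq a) - a n))).
{ apply (is_lim_seq_abs _ (Finite (real (Lim_seq a) - a n))).
  apply is_lim_seq_minus'; [|apply is_lim_seq_const].
  apply is_lim_seq_ext with (fun k => a (k + n)%nat); [intros; f_equal; lia|].
  now apply (is_lim_seq_incr_n a n). }
apply (is_lim_seq_le (fun k => Rabs (a (n + k)%nat - a n)) (fun _ => 2 * B / 2 ^ n)
  (Finite _) (Finite _) (W' n) Hl (is_lim_seq_const _)).
Qed.

(** * Picard iteration with data at [-oo] *)

Section Picard.

Variables (m p c xi : R) (k h : R -> R).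
Hypotheses (Hm : 0 < m) (Hp : 1 < p) (Hc : 0 < c) (Hk : tame c k) (Hh : tame c h)
  (Hk0 : forall t, 0 <= k t) (Hh0 : forall t, 0 <= h t).

Let source (u : R -> R) (t : R) : R := k t * ppow p (u t) + h t.

Lemma source_tame (u : R -> R) : (forall t : R, continuous u t) -> (forall t, u t <= xi) ->
  tame c (source u).
Proof.
intros Hu Hb. apply (tame_plus c (fun t => k t * ppow p (u t))); [|exact Hh].
apply tame_mult with (ppow p xi); auto.
- intros t. apply (cont_comp (ppow p) u); [auto|now apply continuous_ppow].
- exists 0; intros t _. rewrite Rabs_pos_eq by apply ppow_nonneg. apply ppow_le; [lra|auto].
Qed.

Lemma source_nonneg (u : R -> R) (t : R) : 0 <= source u t.
Proof.
unfold source. specialize (Hk0 t); specialize (Hh0 t). pose proof (ppow_nonneg p (u t)). nra.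
Qed.

(** The value [xi] at [-oo] is built into the integral equation. The source is nonnegative, so all
    iterates stay below [xi], and one Lipschitz constant of the truncated power serves for all of
    them, however negative they become. *)
Fixpoint picard (n : nat) (t : R) : R :=
  match n with
  | O => xi
  | S n => xi - damped_primitive c m (source (picard n)) t
  end.

Lemma picard_inv (n : nat) : (forall t : R, continuous (picard n) t) /\ (forall t, picard n t <= xi).
Proof.
induction n as [|n [IH1 IH2]].
- split; [intros; apply continuous_const|intros; apply Rle_refl].
- pose proof (source_tame _ IH1 IH2) as HG.
  assert (HD : forall t : R, is_derive (picard (S n)) t (0 - damped_integral c m (source (picard n)) t)).
  { intros t. apply (D_minus (fun _ => xi)); [apply D_const|]. now apply is_derive_damped_primitive. }
  split.
  + intros t. eapply derive_continuous. apply HD.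
  + intros t. cbn. enough (0 <= damped_primitive c m (source (picard n)) t) by lra.
    apply (incr_ge_lim _ (damped_integral c m (source (picard n))) t); try lra.
    * intros; now apply is_derive_damped_primitive.
    * intros; apply damped_integral_nonneg; auto. apply source_nonneg.
    * now apply is_lim_damped_primitive.
Qed.

Lemma picard_tame (n : nat) : tame c (source (picard n)).
Proof. apply source_tame; apply picard_inv. Qed.

Let L : R := p * ppow (p - 1) xi.

Lemma picard_const_nonneg : 0 <= L.
Proof. apply Rmult_le_pos; [lra|apply ppow_nonneg]. Qed.

Lemma source_diff (u v : R -> R) (t : R) : u t <= xi -> v t <= xi ->
  Rabs (source u t - source v t) <= k t * (L * Rabs (u t - v t)).
Proof.
intros Hu Hv. unfold source.
replace (k t * ppow p (u t) + h t - (k t * ppow p (v t) + h t))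
  with (k t * (ppow p (u t) - ppow p (v t))) by ring.
rewrite Rabs_mult, (Rabs_pos_eq (k t)) by auto.
apply Rmult_le_compat_l; auto. now apply ppow_lipschitz.
Qed.

(** Primitive of the coefficient [L * k / m] in the difference estimate of the Picard map; the norm
    is of Bielecki type, with weight [exp (2 H)]. *)
Let H (t : R) : R := L / m * tail_integral c k t.

Lemma picard_weight_derive (t : R) : is_derive H t (L / m * k t).
Proof.
pose proof (is_derive_tail_integral c k Hc Hk t). unfold H. der. ring.
Qed.

Lemma picard_weight_lim : is_lim H m_infty 0.
Proof.
unfold H. replace (Finite 0) with (Rbar_mult (L / m) 0) by (cbn; f_equal; ring).
apply is_lim_scal_l. now apply is_lim_tail_integral.
Qed.

Lemma picard_weight_exp_lim : is_lim (fun t => exp (2 * H t)) m_infty 1.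
Proof.
rewrite <- exp_0.
apply (is_lim_comp_continuous (fun t => 2 * H t) exp m_infty 0).
- replace (Finite 0) with (Rbar_mult 2 0) by (cbn; f_equal; ring).
  apply is_lim_scal_l. apply picard_weight_lim.
- eapply derive_continuous, is_derive_exp.
Qed.

Lemma picard_weight_nonneg (t : R) : 0 <= H t.
Proof.
apply Rmult_le_pos; [|now apply tail_integral_nonneg].
apply Rmult_le_pos; [apply picard_const_nonneg|left; now apply Rinv_0_lt_compat].
Qed.

Lemma picard_weight_mono (s t : R) : s <= t -> H s <= H t.
Proof.
intros Hst. apply Rmult_le_compat_l; [|now apply tail_integral_mono].
apply Rmult_le_pos; [apply picard_const_nonneg|left; now apply Rinv_0_lt_compat].
Qed.

(* The weight [exp (2 H)] makes the Picard map a contraction with factor 1/2. *)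
Lemma picard_step (T : R) (n : nat) (t : R) : t <= T ->
  Rabs (picard (S n) t - picard n t) <= damped_primitive c m (source (picard 0)) T / 2 ^ n * exp (2 * H t).
Proof.
set (B := damped_primitive c m (source (picard 0)) T).
assert (KD : forall t : R, is_derive (damped_primitive c m (source (picard 0))) t (damped_integral c m (source (picard 0)) t)).
{ intros; apply is_derive_damped_primitive; auto. apply picard_tame. }
assert (J0 : forall t, 0 <= damped_integral c m (source (picard 0)) t).
{ intros; apply damped_integral_nonneg; auto. apply picard_tame. apply source_nonneg. }
assert (K0 : forall t, 0 <= damped_primitive c m (source (picard 0)) t).
{ intros s. apply (incr_ge_lim _ (damped_integral c m (source (picard 0))) s); auto; try lra.
  apply is_lim_damped_primitive; auto. apply picard_tame. }
assert (HB : 0 <= B) by apply K0.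
revert t; induction n as [|n IH]; intros t Ht.
- cbn -[picard]. rewrite Rdiv_1_r.
  replace (picard 1 t - picard 0 t) with (- damped_primitive c m (source (picard 0)) t) by (cbn; ring).
  rewrite Rabs_Ropp, Rabs_pos_eq by apply K0.
  assert (damped_primitive c m (source (picard 0)) t <= B) by (apply (derive_incr _ _ t T Ht (fun s _ => KD s)); auto).
  assert (1 <= exp (2 * H t)).
  { rewrite <- exp_0. apply exp_mono. pose proof (picard_weight_nonneg t). lra. }
  nra.
- assert (HBn : 0 <= B / 2 ^ n).
  { apply Rmult_le_pos; [auto|]. left; apply Rinv_0_lt_compat, pow_lt; lra. }
  set (D := fun s => k s * (L * (B / 2 ^ n) * exp (2 * H s))).
  assert (HD : tame c D).
  { apply tame_mult with (L * (B / 2 ^ n) * 2); auto.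
    - intros s. eapply derive_continuous. pose proof (picard_weight_derive s). der. reflexivity.
    - destruct (proj1 (is_lim_minf _ _) picard_weight_exp_lim 1) as [T' HT']; [lra|].
      exists T'. intros s Hs. specialize (HT' s Hs). apply Rabs_def2 in HT'.
      pose proof picard_const_nonneg. rewrite Rabs_pos_eq.
      + apply Rmult_le_compat_l; [nra|lra].
      + apply Rmult_le_pos; [nra|left; apply exp_pos]. }
  assert (HD0 : forall s, 0 <= D s).
  { intros s; unfold D. pose proof picard_const_nonneg. specialize (Hk0 s).
    pose proof (exp_pos (2 * H s)). apply Rmult_le_pos; [auto|].
    apply Rmult_le_pos; [nra|lra]. }
  replace (picard (S (S n)) t - picard (S n) t)
    with (- (damped_primitive c m (source (picard (S n))) t - damped_primitive c m (source (picard n)) t)) by (cbn; ring).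
  rewrite Rabs_Ropp.
  eapply Rle_trans.
  { apply (damped_primitive_diff c m _ _ D T); auto; try apply picard_tame.
    intros s Hs. eapply Rle_trans; [apply source_diff; apply picard_inv|].
    unfold D. apply Rmult_le_compat_l; auto. rewrite Rmult_assoc.
    apply Rmult_le_compat_l; [apply picard_const_nonneg|]. now apply IH. }
  (* The right-hand side has derivative exactly [D]: differentiating [exp (2 H)] yields
     [2 * L / m * k], and the 2 is the gained factor. *)
  assert (E : tail_integral c D t <= m * (B / 2 ^ (S n)) * exp (2 * H t) - m * (B / 2 ^ (S n)) * 1).
  { apply (tail_integral_le c (m * (B / 2 ^ (S n)) * 1) D (fun t => m * (B / 2 ^ (S n)) * exp (2 * H t))
      D t); auto; try lra.
    - intros s _. pose proof (picard_weight_derive s). der. unfold D. cbn [pow]. field.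
      split; [apply pow_nonzero; lra|lra].
    - replace (Finite (m * (B / 2 ^ (S n)) * 1)) with (Rbar_mult (m * (B / 2 ^ (S n))) 1) by reflexivity.
      apply is_lim_scal_l, picard_weight_exp_lim.
    - intros; apply Rle_refl. }
  assert (0 <= m * (B / 2 ^ S n) * 1).
  { rewrite Rmult_1_r. apply Rmult_le_pos; [lra|]. apply Rmult_le_pos; [auto|].
    left; apply Rinv_0_lt_compat, pow_lt; lra. }
  apply Rmult_le_reg_r with m; [lra|].
  replace (tail_integral c D t / m * m) with (tail_integral c D t) by (field; lra). lra.
Qed.

Let u (t : R) : R := real (Lim_seq (fun n => picard n t)).

(** Uniform on whole half-lines [(-oo, T]], as needed to pass to the limit in integrals that start
    at [-oo]. *)
Lemma picard_limit (T : R) : exists B, 0 <= B /\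
  forall t n, t <= T -> Rabs (u t - picard n t) <= B / 2 ^ n.
Proof.
set (B := damped_primitive c m (source (picard 0)) T * exp (2 * H T)).
assert (K0 : 0 <= damped_primitive c m (source (picard 0)) T).
{ apply (incr_ge_lim _ (damped_integral c m (source (picard 0))) T); try lra.
  - intros; apply is_derive_damped_primitive; auto. apply picard_tame.
  - intros; apply damped_integral_nonneg; auto. apply picard_tame. apply source_nonneg.
  - apply is_lim_damped_primitive; auto. apply picard_tame. }
exists (2 * B). split.
- pose proof (exp_pos (2 * H T)). unfold B; nra.
- intros t n Ht. apply (geometric_cauchy (fun n => picard n t)). intros j.
  eapply Rle_trans; [now apply (picard_step T)|]. unfold B.
  replace (damped_primitive c m (source (picard 0)) T * exp (2 * H T) / 2 ^ j) with
    (damped_primitive c m (source (picard 0)) T / 2 ^ j * exp (2 * H T)) by (unfold Rdiv; ring).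
  apply Rmult_le_compat_l.
  + apply Rmult_le_pos; [auto|]. left; apply Rinv_0_lt_compat, pow_lt; lra.
  + apply exp_mono. pose proof (picard_weight_mono t T Ht). lra.
Qed.

Lemma half_pow_small (B eps : R) : 0 <= B -> 0 < eps -> exists n, B / 2 ^ n < eps.
Proof.
intros HB He. destruct (pow_lt_1_zero (/ 2) ltac:(rewrite Rabs_pos_eq; lra) (eps / (B + 1))) as [n Hn].
- apply Rdiv_lt_0_compat; lra.
- exists n. specialize (Hn n (le_n _)). rewrite Rabs_pos_eq in Hn by (apply pow_le; lra).
  rewrite pow_inv in Hn.
  assert (0 < / 2 ^ n) by (apply Rinv_0_lt_compat, pow_lt; lra).
  apply Rle_lt_trans with ((B + 1) * / 2 ^ n).
  + unfold Rdiv. apply Rmult_le_compat_r; lra.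
  + apply Rlt_le_trans with ((B + 1) * (eps / (B + 1))).
    * apply Rmult_lt_compat_l; lra.
    * right; field; lra.
Qed.

Lemma picard_limit_continuous (t : R) : continuous u t.
Proof.
apply continuous_of_eps; intros eps He.
destruct (picard_limit (t + 1)) as [B [HB HT]].
destruct (half_pow_small B (eps / 4) HB ltac:(lra)) as [n Hn].
destruct (eps_of_continuous (picard n) t (proj1 (picard_inv n) t) (eps / 4) ltac:(lra)) as [d [Hd Hy]].
exists (Rmin d 1). split; [apply Rmin_pos; lra|]. intros y Hyt.
pose proof (Rmin_l d 1); pose proof (Rmin_r d 1).
specialize (Hy y ltac:(lra)). apply Rabs_def2 in Hyt.
pose proof (HT t n ltac:(lra)) as Q1. pose proof (HT y n ltac:(lra)) as Q2.
apply Rabs_le_between in Q1, Q2. apply Rabs_def2 in Hy. apply Rabs_def1; lra.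
Qed.

Lemma picard_limit_le (t : R) : u t <= xi.
Proof.
apply Rnot_lt_le; intros Hlt.
destruct (picard_limit t) as [B [HB HT]].
destruct (half_pow_small B (u t - xi) HB ltac:(lra)) as [n Hn].
specialize (HT t n ltac:(lra)). apply Rabs_le_between in HT.
pose proof (proj2 (picard_inv n) t). lra.
Qed.

Lemma picard_limit_fixed (t : R) : u t = xi - damped_primitive c m (source u) t.
Proof.
destruct (picard_limit t) as [B [HB HT]].
pose proof (source_tame u picard_limit_continuous picard_limit_le) as Hu.
assert (HP : 0 <= tail_integral c k t) by now apply tail_integral_nonneg.
pose proof picard_const_nonneg as HL.
apply Rminus_diag_uniq. apply NNPP; intros Hne. apply Rabs_pos_lt in Hne.
(* The two terms bound the distance from [u] to the next iterate and the change of the integral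
   term; both decay like [1 / 2 ^ n]. *)
set (B' := B + B * L * tail_integral c k t / m).
assert (HB' : 0 <= B').
{ unfold B'. apply Rplus_le_le_0_compat; auto. apply Rmult_le_pos; [|left; now apply Rinv_0_lt_compat].
  apply Rmult_le_pos; [apply Rmult_le_pos|]; assumption. }
destruct (half_pow_small B' _ HB' Hne) as [n Hn].
apply (Rlt_irrefl (Rabs (u t - (xi - damped_primitive c m (source u) t)))).
eapply Rle_lt_trans; [|exact Hn].
assert (HBn : 0 <= B / 2 ^ n).
{ apply Rmult_le_pos; [auto|]. left; apply Rinv_0_lt_compat, pow_lt; lra. }
set (D := fun s => L * (B / 2 ^ n) * k s).
assert (HD : tame c D) by now apply tame_scal.
replace (u t - (xi - damped_primitive c m (source u) t)) with ((u t - picard (S n) t) +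
  (damped_primitive c m (source u) t - damped_primitive c m (source (picard n)) t)) by (cbn; ring).
eapply Rle_trans; [apply Rabs_triang|].
assert (E1 : Rabs (damped_primitive c m (source u) t - damped_primitive c m (source (picard n)) t) <= tail_integral c D t / m).
{ apply (damped_primitive_diff c m _ _ D t); auto; try lra.
  - apply picard_tame.
  - intros s. unfold D. apply Rmult_le_pos; [nra|auto].
  - intros s Hs. eapply Rle_trans; [apply source_diff; [apply picard_limit_le|apply picard_inv]|].
    unfold D. rewrite Rmult_comm. apply Rmult_le_compat_r; [auto|].
    apply Rmult_le_compat_l; auto. }
assert (E2 : tail_integral c D t <= L * (B / 2 ^ n) * tail_integral c k t).
{ enough (tail_integral c D t <= L * (B / 2 ^ n) * tail_integral c k t - L * (B / 2 ^ n) * 0) by lra.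
  apply (tail_integral_le c (L * (B / 2 ^ n) * 0) D (fun t => L * (B / 2 ^ n) * tail_integral c k t) D t);
    auto; try lra.
  - intros s _. pose proof (is_derive_tail_integral c k Hc Hk s). der. unfold D; ring.
  - replace (Finite (L * (B / 2 ^ n) * 0)) with (Rbar_mult (L * (B / 2 ^ n)) 0) by reflexivity.
    apply is_lim_scal_l. now apply is_lim_tail_integral.
  - intros; apply Rle_refl. }
pose proof (HT t (S n) ltac:(lra)) as E3.
assert (E4 : B / 2 ^ S n <= B / 2 ^ n).
{ cbn [pow]. rewrite Rdiv_mult_distr. lra. }
assert (E5 : tail_integral c D t / m <= L * (B / 2 ^ n) * tail_integral c k t / m).
{ apply Rmult_le_compat_r; [left; now apply Rinv_0_lt_compat|auto]. }
replace (B' / 2 ^ n) with (B / 2 ^ n + L * (B / 2 ^ n) * tail_integral c k t / m).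
- lra.
- unfold B'. field. split; [lra|apply pow_nonzero; lra].
Qed.

Theorem regular_orbit_exists : exists u y, orbit m p k h u y /\ regular xi u y /\ forall t, 0 <= y t.
Proof.
pose proof (source_tame u picard_limit_continuous picard_limit_le) as Hu.
exists u, (damped_integral c m (source u)). split; [|split; [split|]].
- intros t. split.
  + apply (is_derive_ext (fun t => xi - damped_primitive c m (source u) t)); [intros; symmetry; apply picard_limit_fixed|].
    pose proof (is_derive_damped_primitive c m _ Hc Hm Hu t). der. ring.
  + apply (is_derive_damped_integral c m (source u)); auto.
- apply (is_lim_ext (fun t => xi - damped_primitive c m (source u) t)); [intros; symmetry; apply picard_limit_fixed|].
  replace (Finite xi) with (Finite (xi - 0)) by (f_equal; ring).
  apply is_lim_minus'; [apply is_lim_const|now apply is_lim_damped_primitive].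
- now apply is_lim_damped_integral.
- apply damped_integral_nonneg; auto. apply source_nonneg.
Qed.

End Picard.

(** * Gronwall estimate from [-oo] and backward uniqueness *)

(* In the variables [z = d - e / m] and [e], where [d = u1 - u2] and [e = y1 - y2],
   the linear part is dissipative, so that Gronwall's argument can start from [-oo]. *)
Lemma gronwall_minf (m T eps a : R) (u1 y1 u2 y2 G1 G2 hh H : R -> R) :
  1 <= m ->
  (forall t, t <= T -> is_derive u1 t (- y1 t) /\ is_derive y1 t (- m * y1 t + G1 t)) ->
  (forall t, t <= T -> is_derive u2 t (- y2 t) /\ is_derive y2 t (- m * y2 t + G2 t)) ->
  (forall t, t <= T -> Rabs (G1 t - G2 t) <= hh t * (Rabs (u1 t - u2 t) + eps)) ->
  (forall t, t <= T -> 0 <= hh t) -> (forall t, t <= T -> is_derive H t (hh t)) ->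
  0 <= eps ->
  is_lim H m_infty 0 -> is_lim (fun t => u1 t - u2 t) m_infty a ->
  is_lim y1 m_infty 0 -> is_lim y2 m_infty 0 ->
  forall t, t <= T ->
    (u1 t - u2 t) ^ 2 + (y1 t - y2 t) ^ 2 <= 4 * (a ^ 2 + eps ^ 2) * exp (6 * H t).
Proof.
intros Hm O1 O2 HG Hh HH He LH Lu L1 L2 t Ht.
set (z := fun t => (u1 t - u2 t) - (y1 t - y2 t) / m).
set (e := fun t => y1 t - y2 t).
set (S := fun t => z t * z t + e t * e t).
assert (Le : is_lim e m_infty 0).
{ replace (Finite 0) with (Finite (0 - 0)) by (f_equal; ring). now apply is_lim_minus'. }
assert (Lz : is_lim z m_infty a).
{ apply is_lim_ext with (fun t => (u1 t - u2 t) - / m * e t); [intros; unfold z, e; field; lra|].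
  replace (Finite a) with (Finite (a - / m * 0)) by (f_equal; ring).
  apply is_lim_minus'; [exact Lu|].
  replace (Finite (/ m * 0)) with (Rbar_mult (/ m) 0) by reflexivity. now apply is_lim_scal_l. }
assert (LS : is_lim S m_infty (a * a + 0 * 0)).
{ apply is_lim_plus'; now apply is_lim_mult'. }
assert (LE : is_lim (fun t => exp (- 6 * H t)) m_infty 1).
{ rewrite <- exp_0. replace 0 with (- 6 * 0) by ring.
  apply (is_lim_comp_continuous (fun t => - 6 * H t) exp m_infty (-6 * 0)).
  - replace (Finite (- 6 * 0)) with (Rbar_mult (- 6) 0) by reflexivity. now apply is_lim_scal_l.
  - eapply derive_continuous, is_derive_exp. }
(* Here [z' = - (G1 - G2) / m] has no linear term and [e' = - m e + (G1 - G2)] is damped, so only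
   the source difference can make [S] grow. The 6 comes from [2 (x + y) (x + y + eps) <= 6 (x^2 +
   y^2 + eps^2)]. *)
assert (Main : (S t + eps ^ 2) * exp (- 6 * H t) <= (a * a + 0 * 0 + eps ^ 2) * 1).
{ apply (decr_le_lim (fun t => (S t + eps ^ 2) * exp (- 6 * H t))
    (fun t => (2 * z t * (- (G1 t - G2 t) / m) + 2 * e t * (- m * e t + (G1 t - G2 t))
               - 6 * hh t * (S t + eps ^ 2)) * exp (- 6 * H t)) T); auto.
  - intros s Hs. destruct (O1 s Hs) as [A1 A2]. destruct (O2 s Hs) as [A3 A4].
    pose proof (HH s Hs) as A5. unfold S, z, e. der; [lra|lra|]. cbn. field. lra.
  - intros s Hs. specialize (HG s Hs). specialize (Hh s Hs).
    pose proof (exp_pos (- 6 * H s)) as Hex.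
    enough (2 * z s * (- (G1 s - G2 s) / m) + 2 * e s * (- m * e s + (G1 s - G2 s))
      <= 6 * hh s * (S s + eps ^ 2)) by nra.
    set (x := Rabs (z s)). set (y := Rabs (e s)). set (g := Rabs (G1 s - G2 s)) in *.
    assert (Hx : 0 <= x) by apply Rabs_pos. assert (Hy : 0 <= y) by apply Rabs_pos.
    assert (Hg : 0 <= g) by apply Rabs_pos.
    assert (Im : 0 < / m <= 1).
    { split; [apply Rinv_0_lt_compat; lra|]. rewrite <- Rinv_1. apply Rinv_le_contravar; lra. }
    assert (B1 : z s * (- (G1 s - G2 s) / m) <= x * g).
    { eapply Rle_trans; [apply Rle_abs|]. unfold Rdiv.
      rewrite !Rabs_mult, Rabs_Ropp, (Rabs_pos_eq (/ m)) by lra. fold x g.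
      assert (0 <= x * g) by now apply Rmult_le_pos. nra. }
    assert (B2 : e s * (G1 s - G2 s) <= y * g).
    { eapply Rle_trans; [apply Rle_abs|]. rewrite Rabs_mult. fold y g. lra. }
    assert (B3 : 0 <= m * (e s * e s)) by nra.
    assert (B4 : Rabs (u1 s - u2 s) <= x + y).
    { replace (u1 s - u2 s) with (z s + e s * / m) by (unfold z, e; field; lra).
      eapply Rle_trans; [apply Rabs_triang|]. rewrite Rabs_mult, (Rabs_pos_eq (/ m)) by lra.
      fold x y. nra. }
    assert (B5 : g <= hh s * (x + y + eps)).
    { eapply Rle_trans; [exact HG|]. apply Rmult_le_compat_l; lra. }
    assert (B6 : S s = x * x + y * y).
    { unfold S, x, y. rewrite <- !Rabs_mult, !Rabs_pos_eq by nra. reflexivity. }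
    rewrite B6.
    assert (B7 : (x + y) * g <= (x + y) * (hh s * (x + y + eps))) by (apply Rmult_le_compat_l; lra).
    assert (B8 : 2 * (x + y) * (x + y + eps) <= 6 * (x * x + y * y + eps ^ 2)).
    { pose proof (pow2_ge_0 (x - y)). pose proof (pow2_ge_0 (x + y - eps)). pose proof (pow2_ge_0 eps). lra. }
    assert (B9 : hh s * (2 * (x + y) * (x + y + eps)) <= hh s * (6 * (x * x + y * y + eps ^ 2)))
      by (apply Rmult_le_compat_l; lra).
    nra.
  - apply is_lim_mult'; [|exact LE]. apply is_lim_plus'; [exact LS|apply is_lim_const]. }
assert (S t + eps ^ 2 <= (a ^ 2 + eps ^ 2) * exp (6 * H t)).
{ apply Rmult_le_reg_r with (exp (- 6 * H t)); [apply exp_pos|].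
  rewrite Rmult_assoc, <- exp_plus. replace (6 * H t + - 6 * H t) with 0 by ring.
  rewrite exp_0. lra. }
assert ((u1 t - u2 t) ^ 2 + (y1 t - y2 t) ^ 2 <= 4 * S t).
{ replace (u1 t - u2 t) with (z t + e t * / m) by (unfold z, e; field; lra).
  fold (e t). unfold S.
  assert (Im : 0 < / m <= 1).
  { split; [apply Rinv_0_lt_compat; lra|]. rewrite <- Rinv_1. apply Rinv_le_contravar; lra. }
  assert (/ m * / m <= 1) by nra.
  assert ((e t * / m) * (e t * / m) <= e t * e t).
  { replace (e t * / m * (e t * / m)) with (e t * e t * (/ m * / m)) by ring. nra. }
  nra. }
assert (0 <= eps ^ 2) by nra. nra.
Qed.

(** The squared distance times [exp (C * r)] is nondecreasing once [C] dominates the damping and the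
    Lipschitz constant; it vanishes at [t], hence at [s]. The bound [M] is needed because the power
    is Lipschitz only on half-lines bounded above. *)
Lemma orbit_backward_unique (m p : R) (k h u1 y1 u2 y2 : R -> R) (s t M : R) :
  0 < m -> 1 < p -> (forall r : R, continuous k r) -> (forall r, 0 <= k r) ->
  orbit m p k h u1 y1 -> orbit m p k h u2 y2 ->
  s <= t -> (forall r, s <= r <= t -> u1 r <= M /\ u2 r <= M) ->
  u1 t = u2 t -> y1 t = y2 t -> u1 s = u2 s.
Proof.
intros Hm Hp Hk Hk0 O1 O2 Hst HM Eu Ey.
destruct (continuity_ab_maj k s t Hst) as [r0 [HB _]].
{ intros c _. apply continuity_pt_filterlim. apply Hk. }
set (L := k r0 * (p * ppow (p - 1) M)).
assert (HL : 0 <= L).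
{ apply Rmult_le_pos; [auto|]. apply Rmult_le_pos; [lra|apply ppow_nonneg]. }
set (C := 1 + 2 * m + 2 * L).
set (S := fun r => ((u1 r - u2 r) * (u1 r - u2 r) + (y1 r - y2 r) * (y1 r - y2 r)) * exp (C * r)).
assert (HS : S s <= S t).
{ apply (derive_incr S (fun r => (- 2 * (u1 r - u2 r) * (y1 r - y2 r)
    + 2 * (y1 r - y2 r) * (- m * (y1 r - y2 r) + k r * (ppow p (u1 r) - ppow p (u2 r)))
    + C * ((u1 r - u2 r) * (u1 r - u2 r) + (y1 r - y2 r) * (y1 r - y2 r))) * exp (C * r)) s t Hst).
  - intros r _. destruct (O1 r) as [A1 A2]. destruct (O2 r) as [A3 A4]. unfold S.
    der. ring.
  - intros r Hr. apply Rmult_le_pos; [|left; apply exp_pos].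
    destruct (HM r Hr) as [M1 M2].
    pose proof (ppow_lipschitz p M (u1 r) (u2 r) Hp M1 M2) as HLip.
    set (d := u1 r - u2 r) in *. set (e := y1 r - y2 r).
    set (D := k r * (ppow p (u1 r) - ppow p (u2 r))).
    assert (HD : Rabs D <= L * Rabs d).
    { unfold D, L. rewrite Rabs_mult, (Rabs_pos_eq (k r)), Rmult_assoc by auto.
      apply Rmult_le_compat; auto using Rabs_pos. }
    assert (HeD : - (L * (d * d + e * e)) <= 2 * (e * D)).
    { assert (Rabs (e * D) <= Rabs e * (L * Rabs d)).
      { rewrite Rabs_mult. apply Rmult_le_compat_l; auto using Rabs_pos. }
      assert (2 * (Rabs e * Rabs d) <= d * d + e * e).
      { assert (Ed : Rabs d * Rabs d = d * d) by (rewrite <- Rabs_mult; apply Rabs_pos_eq; nra).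
        assert (Ee : Rabs e * Rabs e = e * e) by (rewrite <- Rabs_mult; apply Rabs_pos_eq; nra).
        pose proof (pow2_ge_0 (Rabs e - Rabs d)). lra. }
      pose proof (Rle_abs (- (e * D))) as Ha. rewrite Rabs_Ropp in Ha.
      assert (L * (2 * (Rabs e * Rabs d)) <= L * (d * d + e * e)) by (apply Rmult_le_compat_l; lra).
      nra. }
    unfold C. assert (0 <= d * d) by nra. assert (0 <= e * e) by nra.
    assert (0 <= m * (d * d)) by nra. assert (0 <= L * (d * d + e * e)) by (apply Rmult_le_pos; lra).
    fold D. pose proof (pow2_ge_0 (d - e)). nra. }
unfold S in HS. rewrite Eu, Ey in HS.
pose proof (exp_pos (C * s)).
assert ((u1 s - u2 s) * (u1 s - u2 s) <= 0).
{ assert (((u1 s - u2 s) * (u1 s - u2 s) + (y1 s - y2 s) * (y1 s - y2 s)) * exp (C * s) <= 0).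
  { eapply Rle_trans; [exact HS|]. right; ring. }
  assert ((u1 s - u2 s) * (u1 s - u2 s) + (y1 s - y2 s) * (y1 s - y2 s) <= 0).
  { apply Rmult_le_reg_r with (exp (C * s)); lra. }
  pose proof (pow2_ge_0 (y1 s - y2 s)). lra. }
apply Rminus_diag_uniq. nra.
Qed.

(** * Zeros of a one-parameter family *)

Lemma fun_choice {A B : Type} (P : A -> B -> Prop) :
  (forall a, exists b, P a b) -> exists f : A -> B, forall a, P a (f a).
Proof.
intros H. exists (fun a => proj1_sig (constructive_indefinite_description _ (H a))).
intros a; apply proj2_sig.
Qed.

(** [phi] need not be increasing: [n <= phi n] already carries limits along. *)
Lemma bounded_subsequence (u : nat -> R) (a b : R) : (forall n, a <= u n <= b) ->
  exists (phi : nat -> nat) (l : R),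
    (forall n, (n <= phi n)%nat) /\ is_lim_seq (fun n => u (phi n)) l.
Proof.
intros Hu.
destruct (Bolzano_Weierstrass u (fun c => a <= c <= b) (compact_P3 a b) Hu) as [l Hl].
assert (W : forall n : nat, exists q, (n <= q)%nat /\ Rabs (u q - l) < / (INR n + 1)).
{ intros n. assert (Hn : 0 < / (INR n + 1)).
  { apply Rinv_0_lt_compat. pose proof (pos_INR n). lra. }
  destruct (Hl (disc l (mkposreal _ Hn)) n) as [q [Hq Hd]].
  - exists (mkposreal _ Hn). intros x Hx; exact Hx.
  - exists q; split; auto. }
destruct (fun_choice _ W) as [phi Hphi].
exists phi, l. split; [intros; apply Hphi|].
apply is_lim_seq_spec. intros eps.
destruct (archimed_cor1 eps (cond_pos eps)) as [N [HN HN0]].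
exists N. intros n Hn. eapply Rlt_trans; [apply Hphi|]. eapply Rle_lt_trans; [|exact HN].
apply Rinv_le_contravar; [now apply lt_0_INR|]. apply le_INR in Hn. lra.
Qed.

Lemma ge_id_filterlim (phi : nat -> nat) : (forall n, (n <= phi n)%nat) ->
  filterlim phi eventually eventually.
Proof. intros H P [N HN]. exists N. intros n Hn. apply HN. specialize (H n). lia. Qed.

Lemma bounded_subsequence_tuple (m : nat) (z : nat -> nat -> R) (a b : R) :
  (forall n i, (i < m)%nat -> a <= z n i <= b) ->
  exists (phi : nat -> nat) (l : nat -> R), (forall n, (n <= phi n)%nat) /\
    forall i, (i < m)%nat -> is_lim_seq (fun n => z (phi n) i) (l i).
Proof.
induction m as [|m IH]; intros Hz.
- exists (fun n => n), (fun _ => 0). split; [auto|intros; lia].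
- destruct IH as [phi [l [H1 H2]]]; [intros; apply Hz; lia|].
  destruct (bounded_subsequence (fun n => z (phi n) m) a b) as [psi [x [H3 H4]]].
  { intros; apply Hz; lia. }
  exists (fun n => phi (psi n)), (fun i => if Nat.eq_dec i m then x else l i).
  split.
  + intros n. specialize (H3 n). specialize (H1 (psi n)). lia.
  + intros i Hi. destruct (Nat.eq_dec i m) as [->|Hn]; [exact H4|].
    apply (is_lim_seq_subseq (fun n => z (phi n) i) _ psi); [now apply ge_id_filterlim|].
    apply H2; lia.
Qed.

Lemma filter_forall_lt {T : Type} (F : (T -> Prop) -> Prop) {FF : Filter F}
  (n : nat) (P : nat -> T -> Prop) :
  (forall i, (i < n)%nat -> F (P i)) -> F (fun x => forall i, (i < n)%nat -> P i x).
Proof.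
induction n as [|n IH]; intros H.
- apply filter_forall. intros; lia.
- apply (filter_imp (fun x => (forall i, (i < n)%nat -> P i x) /\ P n x)).
  + intros x [H1 H2] i Hi. destruct (Nat.eq_dec i n) as [->|]; [exact H2|apply H1; lia].
  + apply filter_and; [apply IH; intros; apply H; lia|apply H; lia].
Qed.

Definition near_from (xi0 xi : R) : (R -> Prop) -> Prop := within (Rle xi0) (locally xi).

Lemma near_from_eps (xi0 xi : R) (P : R -> Prop) :
  near_from xi0 xi P <-> exists d, 0 < d /\ forall x, xi0 <= x -> Rabs (x - xi) < d -> P x.
Proof.
split.
- intros [d H]. exists d; split; [apply cond_pos|]. intros x H1 H2. now apply H.
- intros [d [Hd H]]. exists (mkposreal d Hd). intros x H1 H2. now apply H.
Qed.

(** Connectedness of a half-line: consider the supremum of the initial segment on which [P] fails.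
    If [P] holds there, it holds slightly before; if not, it fails slightly beyond. *)
Lemma clopen_half_line (P : R -> Prop) (xi0 : R) :
  (forall x, xi0 <= x -> P x -> near_from xi0 x P) ->
  (forall x, xi0 <= x -> ~ P x -> near_from xi0 x (fun y => ~ P y)) ->
  forall x, xi0 <= x -> P x -> P xi0.
Proof.
intros Ho Hc x Hx HPx. apply NNPP; intros HP0.
set (E := fun y => xi0 <= y <= x /\ forall w, xi0 <= w <= y -> ~ P w).
destruct (completeness E) as [s [Hs1 Hs2]].
{ exists x. intros y [Hy _]; lra. }
{ exists xi0. split; [lra|]. intros w Hw. replace w with xi0 by lra. exact HP0. }
assert (Hs0 : xi0 <= s).
{ apply Hs1. split; [lra|]. intros w Hw. replace w with xi0 by lra. exact HP0. }
assert (Hsx : s <= x) by (apply Hs2; intros y [Hy _]; lra).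
assert (Hbelow : forall w, xi0 <= w < s -> ~ P w).
{ intros w Hw HPw. assert (s <= w); [|lra]. apply Hs2. intros y [Hy1 Hy2].
  apply Rnot_lt_le; intros Hlt. apply (Hy2 w); [lra|exact HPw]. }
destruct (classic (P s)) as [HPs|HPs].
- destruct (proj1 (near_from_eps _ _ _) (Ho s Hs0 HPs)) as [d [Hd HN]].
  destruct (Req_dec s xi0) as [->|Hne]; [contradiction|].
  pose proof (Rmax_l xi0 (s - d / 2)). pose proof (Rmax_r xi0 (s - d / 2)).
  assert (Rmax xi0 (s - d / 2) < s) by (apply Rmax_lub_lt; lra).
  apply (Hbelow (Rmax xi0 (s - d / 2))); [lra|].
  apply HN; [lra|]. apply Rabs_def1; lra.
- destruct (proj1 (near_from_eps _ _ _) (Hc s Hs0 HPs)) as [d [Hd HN]].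
  assert (Hlt : s < x).
  { destruct Hsx as [|E0]; auto. subst s; contradiction. }
  pose proof (Rmin_l x (s + d / 2)). pose proof (Rmin_r x (s + d / 2)).
  assert (s < Rmin x (s + d / 2)) by (apply Rmin_glb_lt; lra).
  assert (Rmin x (s + d / 2) <= s); [|lra].
  apply Hs1. split; [lra|]. intros w Hw.
  destruct (Rlt_le_dec w s) as [H4|H4]; [apply Hbelow; lra|].
  apply HN; [lra|]. apply Rabs_def1; lra.
Qed.

(** This means at least [n] zeros, so nothing about finiteness is presupposed. *)
Definition has_zeros (f : R -> R) (n : nat) : Prop :=
  exists z : nat -> R, (forall i, (i < n)%nat -> f (z i) = 0) /\
    (forall i, (S i < n)%nat -> z i < z (S i)).

Section Zeros.

Variables (d dt : R -> R -> R) (xi0 : R).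
Hypothesis Hder : forall xi t, xi0 <= xi -> is_derive (d xi) t (dt xi t).
Hypothesis Hcont : forall xi t eps, xi0 <= xi -> 0 < eps -> exists del, 0 < del /\
  forall xi' t', xi0 <= xi' -> Rabs (xi' - xi) < del -> Rabs (t' - t) < del ->
    Rabs (d xi' t' - d xi t) < eps /\ Rabs (dt xi' t' - dt xi t) < eps.
Hypothesis Hconf : forall xi, xi0 <= xi -> exists a b,
  near_from xi0 xi (fun xi' => forall t, d xi' t = 0 -> a <= t <= b).
Hypothesis Hsimple : forall xi t, xi0 <= xi -> d xi t = 0 -> dt xi t <> 0.

Lemma zeros_do_not_merge (xi l : R) : xi0 <= xi -> exists del, 0 < del /\
  forall xi' p q, xi0 <= xi' -> Rabs (xi' - xi) < del -> Rabs (p - l) < del -> Rabs (q - l) < del ->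
    p < q -> d xi' p = 0 -> d xi' q = 0 -> False.
Proof.
intros Hxi. destruct (Req_dec (d xi l) 0) as [H0|H0].
- pose proof (Hsimple xi l Hxi H0) as H1. apply Rabs_pos_lt in H1.
  destruct (Hcont xi l _ Hxi H1) as [del [Hdel HN]]. exists del; split; auto.
  intros xi' p q Hx' Hx Hp Hq Hpq Zp Zq.
  destruct (mvt (d xi') (dt xi') p q Hpq) as [c [Hc E]]; [intros; now apply Hder|].
  rewrite Zp, Zq in E.
  assert (E0 : dt xi' c = 0).
  { assert (q - p <> 0) by lra. apply Rmult_eq_reg_r with (q - p); lra. }
  destruct (HN xi' c Hx' Hx) as [_ HC].
  { apply Rabs_def2 in Hp, Hq. apply Rabs_def1; lra. }
  rewrite E0, Rminus_0_l, Rabs_Ropp in HC. lra.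
- apply Rabs_pos_lt in H0.
  destruct (Hcont xi l _ Hxi H0) as [del [Hdel HN]]. exists del; split; auto.
  intros xi' p q Hx' Hx Hp Hq Hpq Zp Zq.
  destruct (HN xi' p Hx' Hx Hp) as [HC _]. rewrite Zp, Rminus_0_l, Rabs_Ropp in HC. lra.
Qed.

Lemma simple_zero_changes_sign (xi z : R) : xi0 <= xi -> d xi z = 0 ->
  at_right 0 (fun eta => d xi (z - eta) * d xi (z + eta) < 0).
Proof.
intros Hxi Hz. pose proof (Hsimple xi z Hxi Hz) as Hl. set (l := dt xi z) in *.
assert (Hl2 : 0 < Rabs l / 2) by (apply Rabs_pos_lt in Hl; lra).
destruct (proj1 (is_derive_Reals _ _ _) (Hder xi z Hxi) _ Hl2) as [del HN]. fold l in HN.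
assert (W : forall h, h <> 0 -> Rabs h < del -> 0 < d xi (z + h) / h * l).
{ intros h Hh Hhd. specialize (HN h Hh Hhd). rewrite Hz, Rminus_0_r in HN.
  set (q := d xi (z + h) / h) in *. apply Rabs_def2 in HN.
  unfold Rabs in HN. destruct (Rcase_abs l); nra. }
exists del. intros eta He1 He2.
assert (He : Rabs eta < del).
{ unfold ball in He1; cbn in He1; unfold AbsRing_ball, abs, minus, plus, opp in He1; cbn in He1.
  now rewrite Ropp_0, Rplus_0_r in He1. }
pose proof (W eta ltac:(lra) He) as W1.
pose proof (W (- eta) ltac:(lra) ltac:(now rewrite Rabs_Ropp)) as W2.
change (z + - eta) with (z - eta) in W2.
replace (d xi (z - eta) * d xi (z + eta)) with
  (- ((d xi (z - eta) / - eta) * (d xi (z + eta) / eta)) * (eta * eta)) by (field; lra).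
set (q1 := d xi (z - eta) / - eta) in *. set (q2 := d xi (z + eta) / eta) in *.
assert (0 < q1 * q2).
{ assert (0 < (q1 * q2) * (l * l)).
  { replace (q1 * q2 * (l * l)) with ((q2 * l) * (q1 * l)) by ring. now apply Rmult_lt_0_compat. }
  assert (0 < l * l) by nra. nra. }
assert (0 < eta * eta) by nra. nra.
Qed.

Lemma sign_change_persists (xi a b : R) : xi0 <= xi -> d xi a * d xi b < 0 ->
  near_from xi0 xi (fun xi' => d xi' a * d xi' b < 0).
Proof.
intros Hxi H.
assert (W : forall t, d xi t <> 0 -> near_from xi0 xi (fun xi' => 0 < d xi' t * d xi t)).
{ intros t Ht. pose proof (Rabs_pos_lt _ Ht) as Ht'.
  destruct (Hcont xi t (Rabs (d xi t) / 2) Hxi ltac:(lra)) as [del [Hdel HN]].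
  apply near_from_eps. exists del; split; auto. intros x Hx Hxd.
  destruct (HN x t Hx Hxd) as [HC _]; [now rewrite Rminus_diag, Rabs_R0|].
  apply Rabs_def2 in HC. unfold Rabs in HC. destruct (Rcase_abs (d xi t)); nra. }
assert (Ha : d xi a <> 0) by (intros E; rewrite E in H; lra).
assert (Hb : d xi b <> 0) by (intros E; rewrite E in H; lra).
apply (filter_imp (fun xi' => 0 < d xi' a * d xi a /\ 0 < d xi' b * d xi b)).
- intros x [H1 H2].
  assert (0 < (d x a * d x b) * (d xi a * d xi b)).
  { replace (d x a * d x b * (d xi a * d xi b)) with
      ((d x a * d xi a) * (d x b * d xi b)) by ring. now apply Rmult_lt_0_compat. }
  nra.
- apply filter_and; now apply W.
Qed.

Lemma zero_between (xi a b : R) : xi0 <= xi -> a <= b -> d xi a * d xi b < 0 ->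
  exists z, a <= z <= b /\ d xi z = 0.
Proof.
intros Hxi Hab H. destruct (IVT_gen (d xi) a b 0) as [z [Hz E]].
- intros t. eapply derive_continuity_pt. now apply Hder.
- destruct (Rle_dec (d xi a) (d xi b)); [rewrite Rmin_left, Rmax_right by lra|
    rewrite Rmin_right, Rmax_left by lra]; nra.
- rewrite Rmin_left, Rmax_right in Hz by lra. now exists z.
Qed.

(** Simple zeros change sign on disjoint intervals [[z i - eta, z i + eta]], and finitely many
    strict sign changes survive a small change of the parameter. *)
Lemma has_zeros_open (n : nat) (xi : R) : xi0 <= xi -> has_zeros (d xi) n ->
  near_from xi0 xi (fun xi' => has_zeros (d xi') n).
Proof.
intros Hxi [z [Hz Hinc]].
assert (HE : at_right 0 (fun eta => (0 < eta /\
   forall i, (i < n)%nat -> d xi (z i - eta) * d xi (z i + eta) < 0) /\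
   forall i, (i < n)%nat -> (S i < n)%nat -> eta < (z (S i) - z i) / 2)).
{ apply filter_and; [apply filter_and|].
  - exists (mkposreal 1 Rlt_0_1). intros; assumption.
  - apply (filter_forall_lt (at_right 0)). intros i Hi. now apply simple_zero_changes_sign, Hz.
  - apply (filter_forall_lt (at_right 0)). intros i Hi.
    destruct (le_lt_dec n (S i)) as [Hn|Hn].
    + exists (mkposreal 1 Rlt_0_1). intros; lia.
    + specialize (Hinc i Hn). assert (Hg : 0 < (z (S i) - z i) / 2) by lra.
      exists (mkposreal _ Hg). intros eta He1 He2 _.
      unfold ball in He1; cbn in He1; unfold AbsRing_ball, abs, minus, plus, opp in He1; cbn in He1.
      rewrite Ropp_0, Rplus_0_r in He1. apply Rabs_def2 in He1. lra. }
destruct (filter_ex _ HE) as [eta [[He0 He1] He2]].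
assert (HN : near_from xi0 xi (fun xi' => forall i, (i < n)%nat ->
   d xi' (z i - eta) * d xi' (z i + eta) < 0)).
{ apply (filter_forall_lt (near_from xi0 xi)). intros i Hi. now apply sign_change_persists, He1. }
apply near_from_eps in HN. apply near_from_eps. destruct HN as [del [Hdel HN]].
exists del; split; auto. intros x Hx Hxd. specialize (HN x Hx Hxd).
assert (W : forall i, exists z', (i < n)%nat -> z i - eta <= z' <= z i + eta /\ d x z' = 0).
{ intros i. destruct (le_lt_dec n i) as [Hn|Hn]; [exists 0; lia|].
  destruct (zero_between x (z i - eta) (z i + eta) Hx ltac:(lra) (HN i Hn)) as [z' Hz'].
  now exists z'. }
destruct (fun_choice _ W) as [z' Hz'].
exists z'. split.
- intros i Hi. now apply Hz'.
- intros i Hi. destruct (Hz' i ltac:(lia)) as [A1 _]. destruct (Hz' (S i) Hi) as [A2 _].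
  specialize (He2 i ltac:(lia) Hi). lra.
Qed.

(** Otherwise parameters tending to [xi] have [n] zeros each. Confinement keeps these in a compact
    interval, a subsequence converges, and the limits are zeros that stay distinct because zeros do
    not merge. *)
Lemma has_zeros_closed (n : nat) (xi : R) : xi0 <= xi -> ~ has_zeros (d xi) n ->
  near_from xi0 xi (fun xi' => ~ has_zeros (d xi') n).
Proof.
intros Hxi HnZ. apply NNPP; intros HN. apply HnZ.
destruct (Hconf xi Hxi) as [a [b Hab]]. apply near_from_eps in Hab. destruct Hab as [d0 [Hd0 Hab]].
assert (W : forall j : nat, exists x : R * (nat -> R), (xi0 <= fst x /\ Rabs (fst x - xi) < d0 /\
   Rabs (fst x - xi) < / (INR j + 1)) /\ (forall i, (i < n)%nat -> d (fst x) (snd x i) = 0) /\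
   (forall i, (S i < n)%nat -> snd x i < snd x (S i))).
{ intros j. apply NNPP; intros HC. apply HN. apply near_from_eps.
  assert (Hj : 0 < / (INR j + 1)).
  { apply Rinv_0_lt_compat. pose proof (pos_INR j). lra. }
  exists (Rmin d0 (/ (INR j + 1))). split; [now apply Rmin_pos|].
  intros x Hx Hxd [z [Hz1 Hz2]]. apply HC. exists (x, z). cbn.
  pose proof (Rmin_l d0 (/ (INR j + 1))). pose proof (Rmin_r d0 (/ (INR j + 1))).
  repeat split; auto; lra. }
destruct (fun_choice _ W) as [s Hs].
destruct (bounded_subsequence_tuple n (fun j i => snd (s j) i) a b) as [phi [l [Hphi Hl]]].
{ intros j i Hi. destruct (Hs j) as [[A1 [A2 A3]] [A4 A5]].
  apply (Hab (fst (s j))); auto. }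
assert (Hxl : is_lim_seq (fun j => fst (s (phi j))) xi).
{ apply is_lim_seq_spec. intros eps.
  destruct (archimed_cor1 eps (cond_pos eps)) as [N [HN1 HN0]].
  exists N. intros j Hj. destruct (Hs (phi j)) as [[A1 [A2 A3]] _].
  eapply Rlt_trans; [apply A3|]. eapply Rle_lt_trans; [|exact HN1].
  apply Rinv_le_contravar; [now apply lt_0_INR|]. specialize (Hphi j).
  assert (Hle : (N <= phi j)%nat) by lia. apply le_INR in Hle. lra. }
assert (Ev : forall (v : nat -> R) (x eps : R), is_lim_seq v x -> 0 < eps ->
   eventually (fun j => Rabs (v j - x) < eps)).
{ intros v x eps Hv He. apply is_lim_seq_spec in Hv. exact (Hv (mkposreal eps He)). }
exists l. split.
- intros i Hi. apply NNPP; intros Hne. apply Rabs_pos_lt in Hne.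
  destruct (Hcont xi (l i) _ Hxi Hne) as [del [Hdel HC]].
  destruct (filter_ex _ (filter_and _ _ (Ev _ _ _ Hxl Hdel) (Ev _ _ _ (Hl i Hi) Hdel)))
    as [j [B1 B2]].
  destruct (Hs (phi j)) as [[A1 [A2 A3]] [A4 A5]].
  destruct (HC _ _ A1 B1 B2) as [HC1 _]. rewrite (A4 i Hi), Rminus_0_l, Rabs_Ropp in HC1. lra.
- intros i Hi. pose proof (Hl i ltac:(lia)) as L1. pose proof (Hl (S i) Hi) as L2.
  assert (Hle : l i <= l (S i)).
  { apply (is_lim_seq_le (fun j => snd (s (phi j)) i) (fun j => snd (s (phi j)) (S i))
      (Finite (l i)) (Finite (l (S i)))); auto.
    intros j. destruct (Hs (phi j)) as [_ [_ A5]]. left; auto. }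
  destruct Hle as [Hlt|Heq]; [exact Hlt|exfalso]. rewrite <- Heq in L2.
  destruct (zeros_do_not_merge xi (l i) Hxi) as [del [Hdel HM]].
  destruct (filter_ex _ (filter_and _ _ (Ev _ _ _ Hxl Hdel)
    (filter_and _ _ (Ev _ _ _ L1 Hdel) (Ev _ _ _ L2 Hdel)))) as [j [B1 [B2 B3]]].
  destruct (Hs (phi j)) as [[A1 [A2 A3]] [A4 A5]].
  apply (HM _ _ _ A1 B1 B2 B3); auto. apply A4; lia.
Qed.

(** Arbitrarily many zeros in a bounded interval would contain pairs at arbitrarily small distance,
    and these would merge at a limit point. *)
Lemma zeros_finite (xi : R) : xi0 <= xi -> exists n, ~ has_zeros (d xi) n.
Proof.
intros Hxi. apply NNPP; intros HN.
assert (HZ : forall n, has_zeros (d xi) n).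
{ intros n. apply NNPP; intros HC. apply HN. now exists n. }
destruct (Hconf xi Hxi) as [a [b Hab]]. apply near_from_eps in Hab. destruct Hab as [d0 [Hd0 Hab]].
specialize (Hab xi Hxi ltac:(now rewrite Rminus_diag, Rabs_R0)).
(* The [n + 2] zeros have [n + 1] gaps, one of which is at most [(b - a) / (n + 1)]. *)
assert (W : forall n : nat, exists x : R * R, fst x < snd x /\ d xi (fst x) = 0 /\ d xi (snd x) = 0 /\
  snd x - fst x <= (b - a) / (INR n + 1)).
{ intros n. apply NNPP; intros HC. destruct (HZ (S (S n))) as [z [Hz1 Hz2]].
  assert (Hn : 0 < INR n + 1) by (pose proof (pos_INR n); lra).
  assert (G : forall i, (i <= n)%nat -> z (S i) - z i > (b - a) / (INR n + 1)).
  { intros i Hi. apply Rnot_le_gt; intros HC'. apply HC. exists (z i, z (S i)). cbn.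
    repeat split; auto; try (apply Hz1; lia). apply Hz2; lia. }
  assert (G' : forall i, (i <= n)%nat -> z (S i) - z O > INR (S i) * ((b - a) / (INR n + 1))).
  { induction i as [|i IH]; intros Hi.
    - rewrite INR_1. specialize (G O Hi). lra.
    - specialize (IH ltac:(lia)). specialize (G (S i) Hi). rewrite (S_INR (S i)). lra. }
  specialize (G' n (le_n _)). rewrite S_INR in G'.
  replace ((INR n + 1) * ((b - a) / (INR n + 1))) with (b - a) in G' by (field; lra).
  pose proof (Hab (z O) (Hz1 O ltac:(lia))). pose proof (Hab (z (S n)) (Hz1 (S n) ltac:(lia))). lra. }
destruct (fun_choice _ W) as [s Hs].
destruct (bounded_subsequence (fun n => fst (s n)) a b) as [phi [l [Hphi Hl]]].
{ intros n. apply Hab. now destruct (Hs n) as [_ [H _]]. }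
destruct (zeros_do_not_merge xi l Hxi) as [del [Hdel HM]].
apply is_lim_seq_spec in Hl. destruct (Hl (mkposreal (del / 2) ltac:(lra))) as [N HNl]. cbn in HNl.
destruct (archimed_cor1 (del / 2 / (Rabs (b - a) + 1))) as [N' [HN' HN0]].
{ apply Rdiv_lt_0_compat; [lra|]. pose proof (Rabs_pos (b - a)); lra. }
set (j := phi (N + N')%nat).
specialize (HNl (N + N')%nat ltac:(lia)). fold j in HNl.
destruct (Hs j) as [A1 [A2 [A3 A4]]].
assert (Hg : (b - a) / (INR j + 1) <= del / 2).
{ assert (Hj : (N' <= j)%nat) by (specialize (Hphi (N + N')%nat); unfold j; lia).
  apply le_INR in Hj. assert (0 < INR N') by now apply lt_0_INR.
  pose proof (Rle_abs (b - a)). pose proof (Rabs_pos (b - a)).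
  assert (/ (INR j + 1) <= / INR N') by (apply Rinv_le_contravar; lra).
  assert (0 < / (INR j + 1)) by (apply Rinv_0_lt_compat; lra).
  apply Rle_trans with ((Rabs (b - a) + 1) * (del / 2 / (Rabs (b - a) + 1))); [|right; field; lra].
  unfold Rdiv at 1.
  apply Rle_trans with ((Rabs (b - a) + 1) * / (INR j + 1)); [apply Rmult_le_compat_r; lra|].
  apply Rmult_le_compat_l; lra. }
apply Rabs_def2 in HNl.
apply (HM xi (fst (s j)) (snd (s j)) Hxi); auto.
- now rewrite Rminus_diag, Rabs_R0.
- apply Rabs_def1; lra.
- apply Rabs_def1; lra.
Qed.

Theorem zeros_uniformly_bounded : exists n, forall xi, xi0 <= xi -> ~ has_zeros (d xi) n.
Proof.
destruct (zeros_finite xi0 (Rle_refl _)) as [n Hn]. exists n. intros xi Hxi HZ. apply Hn.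
apply (clopen_half_line (fun x => has_zeros (d x) n) xi0) with xi; auto.
- intros; now apply has_zeros_open.
- intros; now apply has_zeros_closed.
Qed.

End Zeros.

(** * A Lyapunov function for asymptotically autonomous equations *)

Lemma ppow_lt (p x y : R) : 0 < p -> 0 < y -> x < y -> ppow p x < ppow p y.
Proof.
intros Hp Hy Hxy. destruct (Rlt_le_dec 0 x) as [H|H].
- rewrite !ppow_pos_eq by lra. apply Rlt_Rpower_l; lra.
- rewrite (ppow_neg p x) by lra. now apply ppow_pos.
Qed.

(** A level that is only crossed upwards is never left downwards: at the last time at or above [v],
    the function either exceeds [v] or has a positive derivative. *)
Lemma barrier (F dF : R -> R) (S v : R) :
  (forall s, S <= s -> is_derive F s (dF s)) -> (forall s, S <= s -> F s = v -> 0 < dF s) ->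
  forall s1 s, S <= s1 -> s1 <= s -> v <= F s1 -> v <= F s.
Proof.
intros HF Hv s1 s HS1 Hs HF1. apply Rnot_lt_le; intros Hlt.
set (E := fun t => s1 <= t <= s /\ v <= F t).
destruct (completeness E) as [t [Ht1 Ht2]].
{ exists s. intros t [Ht _]; lra. }
{ exists s1. split; lra. }
assert (Hst : s1 <= t) by (apply Ht1; split; lra).
assert (Hts : t <= s) by (apply Ht2; intros x [Hx _]; lra).
assert (HC : forall eps, 0 < eps -> exists d, 0 < d /\ forall y, Rabs (y - t) < d -> Rabs (F y - F t) < eps).
{ apply eps_of_continuous. eapply derive_continuous. apply HF; lra. }
assert (Hge : v <= F t).
{ apply Rnot_lt_le; intros H. destruct (HC (v - F t) ltac:(lra)) as [d [Hd HN]].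
  enough (t <= t - d) by lra. apply Ht2. intros x [Hx1 Hx2].
  apply Rnot_lt_le; intros Hx3. assert (Hxt : x <= t) by (apply Ht1; split; lra).
  specialize (HN x ltac:(apply Rabs_def1; lra)). apply Rabs_def2 in HN. lra. }
assert (Hlt' : t < s).
{ destruct Hts as [|E0]; auto. subst t. lra. }
assert (Hright : exists d, 0 < d /\ forall y, t < y < t + d -> v <= F y).
{ destruct Hge as [Hgt|Heq].
  - destruct (HC (F t - v) ltac:(lra)) as [d [Hd HN]]. exists d; split; auto.
    intros y Hy. specialize (HN y ltac:(apply Rabs_def1; lra)). apply Rabs_def2 in HN. lra.
  - pose proof (Hv t ltac:(lra) (eq_sym Heq)) as Hpos.
    destruct (proj1 (is_derive_Reals _ _ _) (HF t ltac:(lra)) _ Hpos) as [d HN].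
    exists d; split; [apply cond_pos|]. intros y Hy.
    specialize (HN (y - t) ltac:(lra) ltac:(apply Rabs_def1; lra)).
    replace (t + (y - t)) with y in HN by ring. apply Rabs_def2 in HN.
    assert (0 < (F y - F t) / (y - t)) by lra.
    assert (0 < (F y - F t) / (y - t) * (y - t)) by (apply Rmult_lt_0_compat; lra).
    replace ((F y - F t) / (y - t) * (y - t)) with (F y - F t) in * by (field; lra). lra. }
destruct Hright as [d [Hd HR]].
pose proof (Rmin_l s (t + d / 2)). pose proof (Rmin_r s (t + d / 2)).
assert (t < Rmin s (t + d / 2)) by (apply Rmin_glb_lt; lra).
enough (Rmin s (t + d / 2) <= t) by lra.
apply Ht1. split; [lra|]. apply HR; lra.
Qed.

(** In the band the speed is at least [c], so the top is reached within time [(hi - lo) / c]; the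
    bottom and the top are both barriers. *)
Lemma reach_level (F dF : R -> R) (S lo hi c s1 : R) : 0 < c -> lo <= hi ->
  (forall s, S <= s -> is_derive F s (dF s)) ->
  (forall s, S <= s -> lo <= F s <= hi -> c <= dF s) ->
  S <= s1 -> lo <= F s1 -> exists S', s1 <= S' /\ forall s, S' <= s -> hi <= F s.
Proof.
intros Hc Hlh HF HdF HS1 HF1.
assert (Hlo : forall s, s1 <= s -> lo <= F s).
{ intros s Hs. apply (barrier F dF S lo) with s1; auto.
  intros r Hr E. specialize (HdF r Hr ltac:(lra)). lra. }
assert (Hex : exists s2, s1 <= s2 /\ hi <= F s2).
{ apply NNPP; intros HN.
  assert (Hhi : forall s, s1 <= s -> F s < hi).
  { intros s Hs. apply Rnot_le_lt; intros H. apply HN. now exists s. }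
  set (s2 := s1 + (hi - lo) / c + 1).
  assert (Hs2 : s1 < s2).
  { unfold s2. assert (0 <= (hi - lo) / c); [|lra].
    apply Rmult_le_pos; [lra|left; now apply Rinv_0_lt_compat]. }
  destruct (mvt F dF s1 s2 Hs2) as [x [Hx E]]; [intros; apply HF; lra|].
  pose proof (Hlo x ltac:(lra)). pose proof (Hhi x ltac:(lra)).
  specialize (HdF x ltac:(lra) ltac:(lra)). specialize (Hhi s2 ltac:(lra)).
  assert (c * (s2 - s1) <= dF x * (s2 - s1)) by (apply Rmult_le_compat_r; lra).
  assert (c * (s2 - s1) = hi - lo + c) by (unfold s2; field; lra). lra. }
destruct Hex as [s2 [Hs2 HF2]]. exists s2. split; auto. intros s Hs.
apply (barrier F dF S hi) with s2; auto; try lra.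
intros r Hr E. specialize (HdF r Hr ltac:(lra)). lra.
Qed.

(* [F] increases as long as it is away from the two levels of the equilibria. *)
Lemma lyapunov_converges (F dF q : R -> R) (s0 MF l1 l2 : R) : l1 < l2 ->
  (forall s, s0 <= s -> is_derive F s (dF s)) -> (forall s, s0 <= s -> Rabs (F s) <= MF) ->
  (forall eps, 0 < eps -> exists S, forall s, S <= s -> q s - eps <= dF s) ->
  (forall del, 0 < del -> exists eta, 0 < eta /\ forall s, s0 <= s -> q s < eta ->
     Rabs (F s - l1) < del \/ Rabs (F s - l2) < del) ->
  exists l : R, is_lim F p_infty l.
Proof.
intros Hl HF HB HdF Hq.
set (P := fun l del => exists S, forall s, S <= s -> Rabs (F s - l) <= del).
assert (HP : forall del, 0 < del -> 3 * del < l2 - l1 -> P l1 del \/ P l2 del).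
{ intros del Hd Hd3. destruct (Hq del Hd) as [eta [He Hq']].
  destruct (HdF (eta / 2) ltac:(lra)) as [S1 HS1].
  set (S := Rmax s0 S1). pose proof (Rmax_l s0 S1). pose proof (Rmax_r s0 S1). fold S in H, H0.
  assert (HF' : forall s, S <= s -> is_derive F s (dF s)) by (intros; apply HF; lra).
  assert (Hgrow : forall s, S <= s -> ~ (Rabs (F s - l1) < del \/ Rabs (F s - l2) < del) ->
     eta / 2 <= dF s).
  { intros s Hs HN. specialize (HS1 s ltac:(lra)).
    assert (eta <= q s); [|lra]. apply Rnot_lt_le; intros Hlt. apply HN, Hq'; lra. }
  assert (Hup : forall s, S <= s -> F s < l2 + del).
  { intros s Hs. apply Rnot_le_lt; intros Hge.
    pose proof (Rmax_l (l2 + del) (MF + 1)). pose proof (Rmax_r (l2 + del) (MF + 1)).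
    destruct (reach_level F dF S (l2 + del) (Rmax (l2 + del) (MF + 1)) (eta / 2) s) as [S' [HS' HS'2]];
      auto; try lra.
    - intros r Hr HFr. apply Hgrow; auto. intros [HA|HA]; apply Rabs_def2 in HA; lra.
    - specialize (HS'2 S' (Rle_refl _)). specialize (HB S' ltac:(lra)).
      apply Rabs_le_between in HB. lra. }
  (* Once above the band of [l1], the function must climb to the band of [l2], where the upper bound
     confines it. If it is never above, it climbs to [l1 - del] and stays in the band of [l1]. *)
  destruct (classic (exists s1, S <= s1 /\ l1 + del <= F s1)) as [[s1 [Hs1 HFs1]]|HN].
  - right. destruct (reach_level F dF S (l1 + del) (l2 - del) (eta / 2) s1) as [S' [HS' HS'2]];
      auto; try lra.
    + intros r Hr HFr. apply Hgrow; auto. intros [HA|HA]; apply Rabs_def2 in HA; lra.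
    + exists S'. intros s Hs. specialize (HS'2 s Hs). specialize (Hup s ltac:(lra)).
      apply Rabs_le; lra.
  - left.
    pose proof (Rmin_l (- MF) (l1 - del)). pose proof (Rmin_r (- MF) (l1 - del)).
    destruct (reach_level F dF S (Rmin (- MF) (l1 - del)) (l1 - del) (eta / 2) S) as [S' [HS' HS'2]];
      auto; try lra.
    + intros r Hr HFr. apply Hgrow; auto. intros [HA|HA]; apply Rabs_def2 in HA; lra.
    + specialize (HB S ltac:(lra)). apply Rabs_le_between in HB. lra.
    + exists S'. intros s Hs. specialize (HS'2 s Hs).
      assert (F s < l1 + del).
      { apply Rnot_le_lt; intros HA. apply HN. exists s. split; [lra|auto]. }
      apply Rabs_le; lra. }
assert (Hmono : forall l d1 d2, d1 <= d2 -> P l d1 -> P l d2).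
{ intros l d1 d2 Hd [S HS]. exists S. intros s Hs. specialize (HS s Hs). lra. }
assert (Hlim : forall l, (forall del, 0 < del -> P l del) -> exists l : R, is_lim F p_infty l).
{ intros l H. exists l. apply is_lim_pinf. intros eps He.
  destruct (H (eps / 2) ltac:(lra)) as [S HS]. exists S. intros s Hs. specialize (HS s Hs). lra. }
(* Each width yields one of the two levels; if [l1] fails for the width [d1], it fails for all
   smaller ones, which leaves [l2]. *)
destruct (classic (forall del, 0 < del -> P l1 del)) as [H1|H1]; [now apply (Hlim l1)|].
apply not_all_ex_not in H1. destruct H1 as [d1 H1]. apply imply_to_and in H1. destruct H1 as [Hd1 H1].
apply (Hlim l2). intros del Hdel.
set (d2 := Rmin (Rmin d1 del) ((l2 - l1) / 4)).
pose proof (Rmin_l (Rmin d1 del) ((l2 - l1) / 4)). pose proof (Rmin_r (Rmin d1 del) ((l2 - l1) / 4)).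
pose proof (Rmin_l d1 del). pose proof (Rmin_r d1 del).
assert (Hd2 : 0 < d2) by (unfold d2; repeat apply Rmin_pos; lra).
destruct (HP d2 Hd2 ltac:(unfold d2; lra)) as [HQ|HQ].
- exfalso. apply H1. apply (Hmono l1 d2); [unfold d2; lra|exact HQ].
- apply (Hmono l2 d2); [unfold d2; lra|exact HQ].
Qed.

Section Lyapunov.

Variables (p a b k0 A : R).
Hypotheses (Hp : 1 < p) (Ha : 0 < a) (Hb : 0 < b) (Hk0 : 0 < k0) (HA : 0 < A)
  (HAeq : k0 * ppow (p - 1) A = b).

Definition force (w : R) : R := k0 * ppow p w - b * w.
Definition potential (w : R) : R := k0 * ppow (p + 1) w / (p + 1) - b * (w * w) / 2.

Lemma D_force (w : R -> R) (s dw : R) : is_derive w s dw ->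
  is_derive (fun t => force (w t)) s ((k0 * (p * ppow (p - 1) (w s)) - b) * dw).
Proof.
intros H. unfold force. pose proof (D_ppow p w s dw Hp H) as H1. der. ring.
Qed.

Lemma D_potential (w : R -> R) (s dw : R) : is_derive w s dw ->
  is_derive (fun t => potential (w t)) s (force (w s) * dw).
Proof.
intros H. unfold potential, force.
pose proof (D_ppow (p + 1) w s dw ltac:(lra) H) as H1. der; [lra|lra|].
replace (p + 1 - 1) with p by ring. field. lra.
Qed.

(** The value is [b A^2 (1 / (p + 1) - 1 / 2)]. It separates the energy levels of the equilibria 0
    and [A]. *)
Lemma potential_A_neg : potential A < 0.
Proof.
unfold potential. rewrite ppow_pred. replace (p + 1 - 1) with p by ring. rewrite ppow_pred.
replace (k0 * (ppow (p - 1) A * A * A) / (p + 1)) with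
  (k0 * ppow (p - 1) A * (A * A) * / (p + 1)) by (field; lra).
rewrite HAeq.
assert (/ (p + 1) < / 2) by (apply Rinv_lt_contravar; lra).
assert (0 < b * (A * A)) by (apply Rmult_lt_0_compat; nra). nra.
Qed.

Lemma force_away (del : R) : 0 < del -> exists eta, 0 < eta /\
  forall w, 0 <= w -> del <= w -> del <= Rabs (w - A) -> eta <= Rabs (force w).
Proof.
intros Hd.
assert (E : forall w, force w = w * (k0 * ppow (p - 1) w - b)).
{ intros w. unfold force. rewrite ppow_pred. ring. }
set (e1 := k0 * ppow (p - 1) (A + del) - b).
set (e2 := b - k0 * ppow (p - 1) (A - del)).
assert (H1 : 0 < e1).
{ unfold e1. rewrite <- HAeq.
  assert (ppow (p - 1) A < ppow (p - 1) (A + del)) by (apply ppow_lt; lra). nra. }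
assert (H2 : 0 < e2).
{ unfold e2. rewrite <- HAeq.
  assert (ppow (p - 1) (A - del) < ppow (p - 1) A) by (apply ppow_lt; lra). nra. }
exists (del * Rmin e1 e2).
pose proof (Rmin_l e1 e2). pose proof (Rmin_r e1 e2). pose proof (Rmin_pos e1 e2 H1 H2).
split; [now apply Rmult_lt_0_compat|].
intros w Hw Hdw HwA. rewrite E, Rabs_mult, (Rabs_pos_eq w) by auto.
apply Rmult_le_compat; try lra.
unfold Rabs in HwA. destruct (Rcase_abs (w - A)).
- assert (ppow (p - 1) w <= ppow (p - 1) (A - del)) by (apply ppow_le; lra).
  rewrite <- Rabs_Ropp. eapply Rle_trans; [|apply Rle_abs]. unfold e2 in *. nra.
- assert (ppow (p - 1) (A + del) <= ppow (p - 1) w) by (apply ppow_le; lra).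
  eapply Rle_trans; [|apply Rle_abs]. unfold e1 in *. nra.
Qed.

Variables (sg s0 M : R) (w w1 e : R -> R).
Hypotheses (Hsg : sg = 1 \/ sg = -1)
  (Hw : forall s, s0 <= s -> is_derive w s (w1 s))
  (Hw1 : forall s, s0 <= s -> is_derive w1 s (sg * a * w1 s - force (w s) + e s))
  (HwM : forall s, s0 <= s -> 0 < w s <= M) (Hw1M : forall s, s0 <= s -> Rabs (w1 s) <= M)
  (He : is_lim e p_infty 0).

(** [B1] bounds the slope of the force on [[0, M]]. The energy alone grows like [a * w1 ^ 2]; the
    cross term contributes [gam * force ^ 2], at a cost in [w1 ^ 2] of at most
    [gam * (B1 + a ^ 2 / 2)], and [gam] makes this cost [a / 2]. The sign [sg] covers reversed time
    (the singular orbit) and forward time (the limit orbit), and [F] grows in both cases. *)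
Let B1 : R := k0 * (p * ppow (p - 1) M) + b.
Let gam : R := a / (2 * B1 + a ^ 2).
Let F (s : R) : R := sg * (w1 s * w1 s / 2 + potential (w s)) - gam * (w1 s * force (w s)).
Let dF (s : R) : R := a * (w1 s * w1 s) + sg * e s * w1 s
  - gam * ((sg * a * w1 s - force (w s) + e s) * force (w s)
           + w1 s * ((k0 * (p * ppow (p - 1) (w s)) - b) * w1 s)).

Lemma force_slope_bound_pos : 0 < B1.
Proof.
unfold B1. pose proof (ppow_nonneg (p - 1) M).
assert (0 <= k0 * (p * ppow (p - 1) M)) by (repeat apply Rmult_le_pos; lra). lra.
Qed.

Lemma lyapunov_weight_pos : 0 < gam.
Proof. pose proof force_slope_bound_pos. apply Rdiv_lt_0_compat; nra. Qed.

Lemma lyapunov_derive (s : R) : s0 <= s -> is_derive F s (dF s).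
Proof.
intros Hs. pose proof (Hw s Hs) as H1. pose proof (Hw1 s Hs) as H2.
pose proof (D_force w s _ H1) as H3. pose proof (D_potential w s _ H1) as H4.
unfold F. der; [lra|]. unfold dF. destruct Hsg as [-> | ->]; field.
Qed.

Lemma force_bound : exists B, 0 < B /\ forall s, s0 <= s -> Rabs (force (w s)) <= B.
Proof.
exists (k0 * ppow p M + b * Rabs M + 1). split.
- pose proof (ppow_nonneg p M). pose proof (Rabs_pos M). nra.
- intros s Hs. destruct (HwM s Hs). unfold force.
  eapply Rle_trans; [apply Rabs_triang|]. rewrite Rabs_Ropp.
  pose proof (ppow_nonneg p (w s)).
  rewrite (Rabs_pos_eq M), (Rabs_pos_eq (k0 * _)), (Rabs_pos_eq (b * _)) by (try apply Rmult_le_pos; lra).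
  assert (ppow p (w s) <= ppow p M) by (apply ppow_le; lra). nra.
Qed.

Lemma lyapunov_grows : exists c, 0 < c /\ forall eps, 0 < eps -> exists S, forall s, S <= s ->
  c * (w1 s * w1 s + force (w s) * force (w s)) - eps <= dF s.
Proof.
pose proof force_slope_bound_pos as HB1. pose proof lyapunov_weight_pos as Hg.
destruct force_bound as [B [HB HfB]].
exists (Rmin (a / 2) (gam / 2)). split; [apply Rmin_pos; lra|]. intros eps Heps.
assert (HM : 0 <= M) by (destruct (HwM s0 (Rle_refl _)); lra).
set (C := M + gam * B).
assert (HC : 0 < C) by (unfold C; nra).
destruct (proj1 (is_lim_pinf _ _) He (eps / C) ltac:(now apply Rdiv_lt_0_compat)) as [S HS].
exists (Rmax s0 S). intros s Hs.
pose proof (Rmax_l s0 S). pose proof (Rmax_r s0 S).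
specialize (HS s ltac:(lra)). rewrite Rminus_0_r in HS.
specialize (HfB s ltac:(lra)). pose proof (Hw1M s ltac:(lra)) as Hx. destruct (HwM s ltac:(lra)) as [Hw0 HwM'].
unfold dF. set (x := w1 s) in *. set (g := force (w s)) in *.
set (g' := k0 * (p * ppow (p - 1) (w s)) - b).
assert (Hg' : g' <= B1).
{ unfold g', B1. assert (ppow (p - 1) (w s) <= ppow (p - 1) M) by (apply ppow_le; lra).
  assert (k0 * (p * ppow (p - 1) (w s)) <= k0 * (p * ppow (p - 1) M)).
  { apply Rmult_le_compat_l; [lra|]. apply Rmult_le_compat_l; lra. }
  lra. }
assert (Herr : - eps <= e s * (sg * x - gam * g)).
{ assert (Habs : Rabs (e s * (sg * x - gam * g)) <= eps).
  { rewrite Rabs_mult. apply Rle_trans with (eps / C * C); [|right; field; lra].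
    apply Rmult_le_compat; try apply Rabs_pos; [lra|].
    eapply Rle_trans; [apply Rabs_triang|]. rewrite Rabs_Ropp, !Rabs_mult, (Rabs_pos_eq gam) by lra.
    assert (Rabs sg = 1) as -> by (destruct Hsg as [-> | ->]; [apply Rabs_R1|rewrite Rabs_m1; reflexivity]).
    unfold C. assert (gam * Rabs g <= gam * B) by (apply Rmult_le_compat_l; lra). lra. }
  apply Rabs_le_between in Habs. lra. }
assert (Hcross : - (gam * (g * g / 2 + a * a * (x * x) / 2)) <= - (gam * (sg * a * x * g))).
{ apply Ropp_le_contravar. apply Rmult_le_compat_l; [lra|].
  destruct Hsg as [-> | ->]; [pose proof (pow2_ge_0 (a * x - g))|pose proof (pow2_ge_0 (a * x + g))]; nra. }
assert (Hgam : gam * B1 + gam * (a * a / 2) = a / 2) by (unfold gam; field; nra).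
assert (Hxx : 0 <= x * x) by nra. assert (Hgg : 0 <= g * g) by nra.
assert (gam * (g' * (x * x)) <= gam * B1 * (x * x)).
{ rewrite (Rmult_assoc gam). apply Rmult_le_compat_l; [lra|]. apply Rmult_le_compat_r; lra. }
pose proof (Rmin_l (a / 2) (gam / 2)). pose proof (Rmin_r (a / 2) (gam / 2)).
assert (Rmin (a / 2) (gam / 2) * (x * x) <= a / 2 * (x * x)) by (apply Rmult_le_compat_r; lra).
assert (Rmin (a / 2) (gam / 2) * (g * g) <= gam / 2 * (g * g)) by (apply Rmult_le_compat_r; lra).
replace (a / 2 * (x * x)) with (a * (x * x) - gam * B1 * (x * x) - gam * (a * a * (x * x) / 2)) in *
  by (replace (a / 2) with (a - (gam * B1 + gam * (a * a / 2))) at 1 by lra; field).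
nra.
Qed.

Lemma lyapunov_bounded : exists MF, forall s, s0 <= s -> Rabs (F s) <= MF.
Proof.
destruct force_bound as [B [HB HfB]].
exists ((M * M / 2 + (k0 * ppow (p + 1) M / (p + 1) + b * (M * M) / 2)) + gam * (M * B)).
intros s Hs. specialize (HfB s Hs). pose proof (Hw1M s Hs) as Hx. destruct (HwM s Hs) as [Hw0 HwM'].
pose proof lyapunov_weight_pos as Hg. unfold F.
assert (Hsg1 : Rabs sg = 1) by (destruct Hsg as [-> | ->]; [apply Rabs_R1|rewrite Rabs_m1; reflexivity]).
eapply Rle_trans; [apply Rabs_triang|]. rewrite Rabs_Ropp, !Rabs_mult, Hsg1, Rmult_1_l, (Rabs_pos_eq gam) by lra.
apply Rplus_le_compat.
- eapply Rle_trans; [apply Rabs_triang|]. apply Rplus_le_compat.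
  + unfold Rdiv. rewrite !Rabs_mult, (Rabs_pos_eq (/ 2)) by lra.
    apply Rmult_le_compat_r; [lra|]. apply Rmult_le_compat; auto using Rabs_pos.
  + unfold potential. eapply Rle_trans; [apply Rabs_triang|]. rewrite Rabs_Ropp.
    assert (Hi : 0 < / (p + 1)) by (apply Rinv_0_lt_compat; lra).
    assert (Hq : ppow (p + 1) (w s) <= ppow (p + 1) M) by (apply ppow_le; lra).
    pose proof (ppow_nonneg (p + 1) (w s)) as Hq0.
    rewrite !Rabs_pos_eq.
    * unfold Rdiv. apply Rplus_le_compat.
      -- apply Rmult_le_compat_r; [lra|]. apply Rmult_le_compat_l; lra.
      -- apply Rmult_le_compat_r; [lra|]. apply Rmult_le_compat_l; nra.
    * assert (0 <= b * (w s * w s)) by (apply Rmult_le_pos; nra). lra.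
    * unfold Rdiv. apply Rmult_le_pos; [|lra]. apply Rmult_le_pos; lra.
- apply Rmult_le_compat_l; [lra|]. apply Rmult_le_compat; auto using Rabs_pos.
Qed.

Lemma potential_near (v : R) : forall eps, 0 < eps ->
  exists d, 0 < d /\ forall y, Rabs (y - v) < d -> Rabs (potential y - potential v) < eps.
Proof.
apply (eps_of_continuous potential). eapply derive_continuous.
apply (D_potential (fun t => t) v 1). apply D_id.
Qed.

(** Small dissipation means a small velocity and a small force. The force is small only near 0 and
    near [A], and then [F] is close to the energy of that equilibrium. *)
Lemma lyapunov_levels (c : R) : 0 < c -> forall del, 0 < del -> exists eta, 0 < eta /\
  forall s, s0 <= s -> c * (w1 s * w1 s + force (w s) * force (w s)) < eta ->
    Rabs (F s - 0) < del \/ Rabs (F s - sg * potential A) < del.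
Proof.
intros Hc del Hdel. pose proof lyapunov_weight_pos as Hg.
destruct (potential_near 0 (del / 2) ltac:(lra)) as [d1 [Hd1 HP1]].
destruct (potential_near A (del / 2) ltac:(lra)) as [d2 [Hd2 HP2]].
assert (P0 : potential 0 = 0) by (unfold potential; rewrite ppow_neg by lra; field; lra).
pose proof (Rmin_l d1 d2). pose proof (Rmin_r d1 d2). pose proof (Rmin_pos d1 d2 Hd1 Hd2) as Hd.
destruct (force_away (Rmin d1 d2) Hd) as [eta1 [He1 Haway]].
set (eta2 := del / (2 * (1 + gam))).
assert (He2 : 0 < eta2) by (apply Rdiv_lt_0_compat; lra).
exists (c * Rmin (eta1 * eta1) eta2).
pose proof (Rmin_l (eta1 * eta1) eta2). pose proof (Rmin_r (eta1 * eta1) eta2).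
split; [apply Rmult_lt_0_compat; [lra|apply Rmin_pos; nra]|].
intros s Hs Hq. apply Rmult_lt_reg_l in Hq; [|lra].
destruct (HwM s Hs) as [Hw0 _]. set (x := w1 s) in *. set (g := force (w s)) in *.
assert (Hxx : 0 <= x * x) by nra. assert (Hgg : 0 <= g * g) by nra.
assert (Hsg1 : Rabs sg = 1) by (destruct Hsg as [-> | ->]; [apply Rabs_R1|rewrite Rabs_m1; reflexivity]).
assert (HFP : Rabs (F s - sg * potential (w s)) <= del / 2).
{ unfold F. fold x g.
  replace (sg * (x * x / 2 + potential (w s)) - gam * (x * g) - sg * potential (w s)) with
    (sg * (x * x / 2) - gam * (x * g)) by ring.
  eapply Rle_trans; [apply Rabs_triang|]. rewrite Rabs_Ropp, (Rabs_mult sg), Hsg1, (Rabs_mult gam), (Rabs_pos_eq gam) by lra.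
  rewrite (Rabs_pos_eq (x * x / 2)) by lra.
  assert (Rabs (x * g) <= x * x + g * g).
  { apply Rabs_le. pose proof (pow2_ge_0 (x + g)). pose proof (pow2_ge_0 (x - g)). split; lra. }
  assert (gam * Rabs (x * g) <= gam * (x * x + g * g)) by (apply Rmult_le_compat_l; lra).
  assert ((1 + gam) * (x * x + g * g) <= (1 + gam) * eta2) by (apply Rmult_le_compat_l; lra).
  assert ((1 + gam) * eta2 = del / 2) by (unfold eta2; field; lra). nra. }
assert (Hsgn : forall v, Rabs (potential (w s) - potential v) < del / 2 ->
   Rabs (F s - sg * potential v) < del).
{ intros v Hv. replace (F s - sg * potential v) with
    ((F s - sg * potential (w s)) + sg * (potential (w s) - potential v)) by ring.
  eapply Rle_lt_trans; [apply Rabs_triang|]. rewrite (Rabs_mult sg), Hsg1. lra. }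
destruct (Rlt_le_dec (w s) (Rmin d1 d2)) as [H4|H4].
- left. replace 0 with (sg * potential 0) by (rewrite P0; ring).
  apply Hsgn, HP1. rewrite Rminus_0_r, Rabs_pos_eq; lra.
- destruct (Rlt_le_dec (Rabs (w s - A)) (Rmin d1 d2)) as [H5|H5].
  + right. apply Hsgn, HP2. lra.
  + exfalso. specialize (Haway (w s) ltac:(lra) H4 H5). fold g in Haway.
    assert (Hee : eta1 * eta1 <= Rabs g * Rabs g) by nra.
    rewrite <- Rabs_mult, (Rabs_pos_eq (g * g)) in Hee by lra. lra.
Qed.

Lemma lyapunov_has_limit : exists l : R, is_lim F p_infty l.
Proof.
destruct lyapunov_grows as [c [Hc HdF]]. destruct lyapunov_bounded as [MF HMF].
pose proof potential_A_neg as HPA.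
destruct Hsg as [E|E].
- apply (lyapunov_converges F dF (fun s => c * (w1 s * w1 s + force (w s) * force (w s)))
    s0 MF (sg * potential A) 0); auto using lyapunov_derive.
  + rewrite E; lra.
  + intros del Hdel. destruct (lyapunov_levels c Hc del Hdel) as [eta [He' HL]]. exists eta. split; auto.
    intros s Hs Hq. destruct (HL s Hs Hq); auto.
- apply (lyapunov_converges F dF (fun s => c * (w1 s * w1 s + force (w s) * force (w s)))
    s0 MF 0 (sg * potential A)); auto using lyapunov_derive.
  + rewrite E; lra.
  + intros del Hdel. exact (lyapunov_levels c Hc del Hdel).
Qed.

(** If [w] is at distance [del] from both equilibria, the velocity bound keeps it at distance
    [del / 2] during the time [h = del / (2 * M)]. Then [F] grows by a fixed amount over this time,
    which cannot go on happening since [F] converges. *)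
Lemma near_equilibria (del : R) : 0 < del -> exists S, s0 <= S /\ forall s, S <= s ->
  w s < del \/ Rabs (w s - A) < del.
Proof.
intros Hdel. destruct lyapunov_grows as [c [Hc HdF]]. destruct lyapunov_has_limit as [l Hl].
destruct (force_away (del / 2) ltac:(lra)) as [eta [Heta Haway]].
assert (HM : 0 < M) by (destruct (HwM s0 (Rle_refl _)); lra).
set (h := del / (2 * M)). assert (Hh : 0 < h) by (apply Rdiv_lt_0_compat; lra).
set (c2 := c * (eta * eta)). assert (Hc2 : 0 < c2) by (apply Rmult_lt_0_compat; nra).
destruct (HdF (c2 / 2) ltac:(lra)) as [S1 HS1].
assert (Hc2h : 0 < c2 / 2 * h) by (apply Rmult_lt_0_compat; lra).
destruct (proj1 (is_lim_pinf _ _) Hl (c2 / 2 * h / 2) ltac:(lra)) as [S2 HS2].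
exists (Rmax s0 (Rmax S1 S2)).
pose proof (Rmax_l s0 (Rmax S1 S2)). pose proof (Rmax_r s0 (Rmax S1 S2)).
pose proof (Rmax_l S1 S2). pose proof (Rmax_r S1 S2).
split; [auto|]. intros s Hs. apply NNPP; intros HN.
apply not_or_and in HN. destruct HN as [N1 N2]. apply Rnot_lt_le in N1, N2.
destruct (mvt F dF s (s + h) ltac:(lra)) as [x [Hx E]]; [intros; apply lyapunov_derive; lra|].
assert (Hwx : Rabs (w x - w s) <= del / 2).
{ destruct (Req_dec x s) as [->|Hne]; [rewrite Rminus_diag, Rabs_R0; lra|].
  destruct (mvt w w1 s x ltac:(lra)) as [y [Hy Ey]]; [intros; apply Hw; lra|].
  rewrite Ey, Rabs_mult, (Rabs_pos_eq (x - s)) by lra.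
  replace (del / 2) with (M * h) by (unfold h; field; lra).
  apply Rmult_le_compat; try lra; [apply Rabs_pos|apply Hw1M; lra]. }
destruct (HwM x ltac:(lra)) as [Hwx0 _].
assert (Hf : eta <= Rabs (force (w x))).
{ apply Haway; [lra| |].
  - apply Rabs_le_between in Hwx. lra.
  - assert (Htri : Rabs (w s - A) <= Rabs (w s - w x) + Rabs (w x - A)).
    { replace (w s - A) with ((w s - w x) + (w x - A)) by ring. apply Rabs_triang. }
    rewrite (Rabs_minus_sym (w s) (w x)) in Htri. lra. }
assert (c2 / 2 <= dF x).
{ specialize (HS1 x ltac:(lra)).
  assert (eta * eta <= force (w x) * force (w x)).
  { assert (Hee : eta * eta <= Rabs (force (w x)) * Rabs (force (w x))) by nra.
    rewrite <- Rabs_mult, Rabs_pos_eq in Hee by nra. exact Hee. }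
  assert (0 <= w1 x * w1 x) by nra. unfold c2 in *. nra. }
assert (c2 / 2 * h <= F (s + h) - F s).
{ rewrite E. replace (s + h - s) with h by ring. apply Rmult_le_compat_r; lra. }
pose proof (HS2 s ltac:(lra)) as G1. pose proof (HS2 (s + h) ltac:(lra)) as G2.
apply Rabs_def2 in G1, G2. lra.
Qed.

(** Late values of [w] avoid [A / 2], so by continuity [w] settles on one side of it, hence at one
    equilibrium. *)
Theorem lyapunov_limit : is_lim w p_infty 0 \/ is_lim w p_infty A.
Proof.
destruct (near_equilibria (A / 3) ltac:(lra)) as [S [HS0 HS]].
assert (Hne : forall s, S <= s -> w s <> A / 2).
{ intros s Hs E. destruct (HS s Hs) as [H|H]; [lra|apply Rabs_def2 in H; lra]. }
assert (HIVT : forall s t, S <= s -> s < t -> (w s - A / 2) * (w t - A / 2) < 0 -> False).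
{ intros s t Hs Hst Hneg.
  (* extended by constants, since [IVT_gen] asks for continuity everywhere *)
  destruct (IVT_gen (fun r => w (Rmax S r) - A / 2) s t 0) as [z [Hz Ez]].
  - intros r. apply continuity_pt_filterlim.
    apply (continuous_minus (fun r => w (Rmax S r)) (fun _ => A / 2)); [|apply continuous_const].
    apply (cont_comp w (Rmax S)).
    + apply continuous_of_eps. intros eps Heps. exists eps. split; auto. intros y Hy.
      unfold Rmax. apply Rabs_def2 in Hy.
      destruct (Rle_dec S y), (Rle_dec S r); apply Rabs_def1; lra.
    + eapply derive_continuous. apply Hw. pose proof (Rmax_l S r). lra.
  - rewrite !Rmax_right by lra.
    destruct (Rle_dec (w s - A / 2) (w t - A / 2)); [rewrite Rmin_left, Rmax_right by lra|
      rewrite Rmin_right, Rmax_left by lra]; nra.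
  - apply (Hne (Rmax S z)); [apply Rmax_l|lra]. }
destruct (Rlt_le_dec (w S) (A / 2)) as [Hlt|Hge].
- left. assert (Hall : forall s, S <= s -> w s < A / 2).
  { intros s Hs. apply Rnot_le_lt; intros H. pose proof (Hne s Hs).
    destruct Hs as [Hs|Hs]; [|subst; lra]. apply (HIVT S s); try lra. nra. }
  apply is_lim_pinf. intros eps Heps.
  destruct (near_equilibria (Rmin eps (A / 3)) ltac:(apply Rmin_pos; lra)) as [S' [_ HS']].
  exists (Rmax S S'). intros s Hs. pose proof (Rmax_l S S'). pose proof (Rmax_r S S').
  pose proof (Rmin_l eps (A / 3)). pose proof (Rmin_r eps (A / 3)).
  specialize (Hall s ltac:(lra)). destruct (HwM s ltac:(lra)) as [Hw0 _].
  rewrite Rminus_0_r, Rabs_pos_eq by lra.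
  destruct (HS' s ltac:(lra)) as [G|G]; [lra|apply Rabs_def2 in G; lra].
- right. assert (Hall : forall s, S <= s -> A / 2 < w s).
  { intros s Hs. apply Rnot_le_lt; intros H. pose proof (Hne s Hs). pose proof (Hne S ltac:(lra)).
    destruct Hs as [Hs|Hs]; [|subst; lra]. apply (HIVT S s); try lra. nra. }
  apply is_lim_pinf. intros eps Heps.
  destruct (near_equilibria (Rmin eps (A / 3)) ltac:(apply Rmin_pos; lra)) as [S' [_ HS']].
  exists (Rmax S S'). intros s Hs. pose proof (Rmax_l S S'). pose proof (Rmax_r S S').
  pose proof (Rmin_l eps (A / 3)). pose proof (Rmin_r eps (A / 3)).
  specialize (Hall s ltac:(lra)).
  destruct (HS' s ltac:(lra)) as [G|G]; lra.
Qed.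

End Lyapunov.

(** * Asymptotics of the singular solution *)

Lemma D_flip (f : R -> R) (s l : R) : is_derive f (- s) l -> is_derive (fun s => f (- s)) s (- l).
Proof.
intros H. eapply D_eq; [apply (D_comp f Ropp s l (- (1))); [exact H|]|ring].
apply (D_opp (fun t => t)), D_id.
Qed.

Lemma is_lim_flip (f : R -> R) (l : R) :
  is_lim (fun s => f (- s)) p_infty l -> is_lim f m_infty l.
Proof.
intros H. apply is_lim_minf. intros eps He.
destruct (proj1 (is_lim_pinf _ _) H eps He) as [S HS].
exists (- S). intros t Ht. specialize (HS (- t) ltac:(lra)). now rewrite Ropp_involutive in HS.
Qed.

Lemma is_lim_flip' (f : R -> R) (l : R) :
  is_lim f m_infty l -> is_lim (fun s => f (- s)) p_infty l.
Proof.
intros H. apply is_lim_pinf. intros eps He.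
destruct (proj1 (is_lim_minf _ _) H eps He) as [S HS].
exists (- S). intros t Ht. apply HS; lra.
Qed.

(** The Emden-Fowler change of variables: [(p - 1) * theta = tau] is the scaling that absorbs the
    growth [exp (tau * t)] of [k], so the equation becomes asymptotically autonomous at [-oo]. *)
Lemma emden_fowler (m p tau theta : R) (k h u y : R -> R) : (p - 1) * theta = tau ->
  orbit m p k h u y -> forall t,
  let w := fun t => exp (theta * t) * u t in
  let v := fun t => theta * w t - exp (theta * t) * y t in
  is_derive w t (v t) /\
  is_derive v t (- (m - 2 * theta) * v t + theta * (m - theta) * w t
    - (k t * exp (- tau * t)) * ppow p (w t) - exp (theta * t) * h t).
Proof.
intros Htau O t w v. destruct (O t) as [Hu Hy].
assert (Hw : is_derive w t (v t)) by (unfold w, v; der; unfold w; ring).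
split; [exact Hw|].
assert (E : exp (theta * t) * (k t * ppow p (u t)) = (k t * exp (- tau * t)) * ppow p (w t)).
{ unfold w. rewrite ppow_mult, ppow_exp by apply exp_pos.
  replace (theta * t) with (- tau * t + p * (theta * t)) at 1 by (rewrite <- Htau; ring).
  rewrite exp_plus. ring. }
unfold v at 1. der. rewrite <- E. unfold v, w. ring.
Qed.

Section Singular.

Variables (m p tau theta k0 c : R) (k h u y : R -> R).
Hypotheses (Hm : 0 < m) (Hp : 1 < p) (Htau : (p - 1) * theta = tau) (Hth : 0 < theta)
  (Hsub : 2 * theta < m) (Hk0 : 0 < k0) (Hc : 0 < c)
  (Hk : forall t, 0 <= k t) (Hh : forall t, 0 <= h t) (Hhc : tame c h)
  (Hkap : is_lim (fun t => k t * exp (- tau * t)) m_infty k0)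
  (Ho : orbit m p k h u y) (Hu0 : forall t, 0 < u t)
  (Hinf : forall B, exists T, forall t, t <= T -> B <= u t).

Lemma singular_tau_pos : 0 < tau.
Proof. rewrite <- Htau. apply Rmult_lt_0_compat; lra. Qed.

(** [exp (m * t) * y t] is nondecreasing. A negative value would persist for all earlier times, and
    [u] would be bounded at [-oo]. *)
Lemma singular_y_nonneg (t : R) : 0 <= y t.
Proof.
apply Rnot_lt_le; intros Hlt.
assert (Hy : forall s, s <= t -> y s <= 0).
{ intros s Hs.
  assert (G : exp (m * s) * y s <= exp (m * t) * y t).
  { apply (derive_incr (fun t => exp (m * t) * y t)
      (fun t => exp (m * t) * (k t * ppow p (u t) + h t))); auto.
    - intros r _. destruct (Ho r) as [_ Hy]. der. ring.
    - intros r _. apply Rmult_le_pos; [left; apply exp_pos|].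
      pose proof (Hk r) as Hkr. pose proof (Hh r) as Hhr. pose proof (ppow_nonneg p (u r)). nra. }
  pose proof (exp_pos (m * s)). pose proof (exp_pos (m * t)).
  assert (exp (m * t) * y t < 0) by nra. nra. }
destruct (Hinf (u t + 1)) as [T HT].
specialize (HT (Rmin T t) (Rmin_l _ _)). pose proof (Rmin_r T t).
assert (u (Rmin T t) <= u t); [|lra].
apply (derive_incr u (fun s => - y s)); auto.
- intros s _. apply Ho.
- intros s Hs. specialize (Hy s ltac:(lra)). lra.
Qed.

Lemma kappa_bounds : exists T, forall t, t <= T ->
  k0 / 2 * exp (tau * t) <= k t <= 2 * k0 * exp (tau * t).
Proof.
destruct (proj1 (is_lim_minf _ _) Hkap (k0 / 2) ltac:(lra)) as [T HT].
exists T. intros t Ht. specialize (HT t Ht). apply Rabs_def2 in HT.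
pose proof (exp_pos (tau * t)).
assert (E : k t = k t * exp (- tau * t) * exp (tau * t)).
{ rewrite Rmult_assoc, <- exp_plus. replace (- tau * t + tau * t) with 0 by ring. rewrite exp_0. ring. }
rewrite E. split; apply Rmult_le_compat_r; lra.
Qed.

(** Integrate [exp (m * s) * y s] from [-oo], using [u s >= u t] for [s <= t]; this gives the
    constant [k0 / 2 / (m + tau)]. *)
Lemma singular_y_lower : exists c1 T, 0 < c1 /\ forall t, t <= T ->
  c1 * exp (tau * t) * ppow p (u t) <= y t.
Proof.
pose proof singular_tau_pos as Ht0. destruct kappa_bounds as [T HT].
set (c1 := k0 / 2 / (m + tau)).
assert (Hc1 : 0 < c1) by (apply Rdiv_lt_0_compat; lra).
exists c1, T. split; auto. intros t Ht.
pose proof (ppow_nonneg p (u t)) as HP.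
assert (G : 0 <= exp (m * t) * y t - c1 * ppow p (u t) * exp ((m + tau) * t)).
{ apply (incr_ge_liminf (fun s => exp (m * s) * y s - c1 * ppow p (u t) * exp ((m + tau) * s))
   (fun s => exp (m * s) * (k s * ppow p (u s) + h s - k0 / 2 * exp (tau * s) * ppow p (u t))) t);
   try lra.
  - intros s _. destruct (Ho s) as [_ Hy]. der.
    replace ((m + tau) * s) with (m * s + tau * s) by ring. rewrite exp_plus. unfold c1. field. lra.
  - intros s Hs. apply Rmult_le_pos; [left; apply exp_pos|].
    destruct (HT s ltac:(lra)) as [HT1 _]. pose proof (Hh s) as Hhs.
    assert (Hus : u t <= u s).
    { apply (derive_decr u (fun s => - y s)); auto; [intros; apply Ho|].
      intros r _. pose proof (singular_y_nonneg r). lra. }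
    assert (ppow p (u t) <= ppow p (u s)) by (apply ppow_le; lra).
    pose proof (exp_pos (tau * s)).
    assert (k0 / 2 * exp (tau * s) * ppow p (u t) <= k s * ppow p (u s)).
    { apply Rmult_le_compat; auto. apply Rmult_le_pos; lra. }
    lra.
  - intros eps He.
    assert (L : is_lim (fun s => c1 * ppow p (u t) * exp ((m + tau) * s)) m_infty 0).
    { replace (Finite 0) with (Rbar_mult (c1 * ppow p (u t)) 0) by (cbn; f_equal; ring).
      apply is_lim_scal_l, is_lim_exp_minf. lra. }
    destruct (proj1 (is_lim_minf _ _) L eps He) as [T' HT'].
    exists T'. intros s Hs. specialize (HT' s Hs). apply Rabs_def2 in HT'.
    pose proof (singular_y_nonneg s). pose proof (exp_pos (m * s)).
    assert (0 <= exp (m * s) * y s) by (apply Rmult_le_pos; lra). lra. }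
replace ((m + tau) * t) with (m * t + tau * t) in G by ring. rewrite exp_plus in G.
apply Rmult_le_reg_l with (exp (m * t)); [apply exp_pos|]. lra.
Qed.

Let w (t : R) : R := exp (theta * t) * u t.

Lemma singular_w_pos (t : R) : 0 < w t.
Proof. apply Rmult_lt_0_compat; [apply exp_pos|auto]. Qed.

(** The lower bound on [y] reads [(u^(1 - p))' >= (p - 1) c1 exp (tau t)]. Integrating from [-oo]
    bounds [u] by a multiple of [exp (- theta t)]. *)
Lemma singular_w_bounded : exists M T, 0 < M /\ forall t, t <= T -> w t <= M.
Proof.
pose proof singular_tau_pos as Ht0. destruct singular_y_lower as [c1 [T [Hc1 HT]]].
set (c2 := (p - 1) * c1 / tau).
assert (Hc2 : 0 < c2) by (apply Rdiv_lt_0_compat; nra).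
exists (exp (- ln c2 / (p - 1))), T. split; [apply exp_pos|]. intros t Ht.
assert (G : 0 <= exp ((1 - p) * ln (u t)) - c2 * exp (tau * t)).
{ apply (incr_ge_liminf (fun s => exp ((1 - p) * ln (u s)) - c2 * exp (tau * s))
   (fun s => (p - 1) * (exp ((1 - p) * ln (u s)) * / u s * y s - c1 * exp (tau * s))) T); auto.
  - intros s _. destruct (Ho s) as [Hu _]. pose proof (Hu0 s) as Hu0s. der. unfold c2. field. lra.
  - intros s Hs. apply Rmult_le_pos; [lra|]. specialize (HT s Hs). pose proof (Hu0 s) as Hu0s.
    rewrite ppow_pos_eq in HT by auto. unfold Rpower in HT.
    assert (E : exp ((1 - p) * ln (u s)) * / u s * exp (p * ln (u s)) = 1).
    { replace (exp ((1 - p) * ln (u s)) * / u s * exp (p * ln (u s))) with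
        (exp ((1 - p) * ln (u s)) * exp (p * ln (u s)) * / u s) by ring.
      rewrite <- exp_plus. replace ((1 - p) * ln (u s) + p * ln (u s)) with (ln (u s)) by ring.
      rewrite exp_ln by auto. field; lra. }
    assert (0 < exp ((1 - p) * ln (u s)) * / u s).
    { apply Rmult_lt_0_compat; [apply exp_pos|now apply Rinv_0_lt_compat]. }
    assert (exp ((1 - p) * ln (u s)) * / u s * (c1 * exp (tau * s) * exp (p * ln (u s)))
      <= exp ((1 - p) * ln (u s)) * / u s * y s) by (apply Rmult_le_compat_l; lra).
    replace (exp ((1 - p) * ln (u s)) * / u s * (c1 * exp (tau * s) * exp (p * ln (u s)))) with
      (c1 * exp (tau * s) * (exp ((1 - p) * ln (u s)) * / u s * exp (p * ln (u s)))) in * by ring.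
    rewrite E in *. lra.
  - intros eps He.
    assert (L : is_lim (fun s => c2 * exp (tau * s)) m_infty 0).
    { replace (Finite 0) with (Rbar_mult c2 0) by (cbn; f_equal; ring).
      apply is_lim_scal_l, is_lim_exp_minf. lra. }
    destruct (proj1 (is_lim_minf _ _) L eps He) as [T' HT'].
    exists T'. intros s Hs. specialize (HT' s Hs). apply Rabs_def2 in HT'.
    pose proof (exp_pos ((1 - p) * ln (u s))). lra. }
assert (HL : ln c2 + tau * t <= (1 - p) * ln (u t)).
{ rewrite <- (ln_exp ((1 - p) * ln (u t))), <- (ln_exp (tau * t)), <- ln_mult by (auto; apply exp_pos).
  apply ln_le; [apply Rmult_lt_0_compat; [auto|apply exp_pos]|lra]. }
unfold w. rewrite <- (exp_ln (u t)) by auto. rewrite <- exp_plus. apply exp_mono.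
rewrite <- Htau in HL.
apply Rmult_le_reg_r with (p - 1); [lra|].
replace (- ln c2 / (p - 1) * (p - 1)) with (- ln c2) by (field; lra). lra.
Qed.

(** [y - m u] has the source as its derivative, hence is nondecreasing. The bound controls the
    velocity of [w]. *)
Lemma singular_y_upper : exists D T, 0 <= D /\ forall t, t <= T -> y t <= m * u t + D.
Proof.
exists (Rabs (y 0 - m * u 0)), 0. split; [apply Rabs_pos|]. intros t Ht.
assert (y t - m * u t <= y 0 - m * u 0).
{ apply (derive_incr (fun t => y t - m * u t) (fun t => k t * ppow p (u t) + h t)); auto.
  - intros s _. destruct (Ho s) as [Hu Hy]. der. ring.
  - intros s _. pose proof (Hk s) as Hks. pose proof (Hh s) as Hhs. pose proof (ppow_nonneg p (u s)). nra. }
pose proof (Rle_abs (y 0 - m * u 0)). lra.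
Qed.

Variable A : R.
Hypotheses (HA : 0 < A) (HAeq : k0 * ppow (p - 1) A = theta * (m - theta)).

Lemma inhomogeneity_lim : is_lim h m_infty 0.
Proof.
destruct Hhc as [_ [C [T HT]]]. apply is_lim_minf. intros eps He.
assert (L : is_lim (fun s => C * exp (c * s)) m_infty 0).
{ replace (Finite 0) with (Rbar_mult C 0) by (cbn; f_equal; ring).
  now apply is_lim_scal_l, is_lim_exp_minf. }
destruct (proj1 (is_lim_minf _ _) L eps He) as [T' HT'].
exists (Rmin T T'). intros s Hs. pose proof (Rmin_l T T'). pose proof (Rmin_r T T').
specialize (HT s ltac:(lra)). specialize (HT' s ltac:(lra)). rewrite Rminus_0_r in *.
apply Rabs_def2 in HT'. lra.
Qed.

Lemma singular_dichotomy : is_lim w m_infty 0 \/ is_lim w m_infty A.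
Proof.
destruct singular_w_bounded as [M [T1 [HM HT1]]]. destruct singular_y_upper as [D [T2 [HD HT2]]].
set (T := Rmin 0 (Rmin T1 T2)).
pose proof (Rmin_l 0 (Rmin T1 T2)). pose proof (Rmin_r 0 (Rmin T1 T2)).
pose proof (Rmin_l T1 T2). pose proof (Rmin_r T1 T2). fold T in H, H0.
set (v := fun t => theta * w t - exp (theta * t) * y t).
set (M' := theta * M + m * M + D + M).
assert (HM' : M <= M') by (unfold M'; nra).
pose proof (emden_fowler m p tau theta k h u y Htau Ho) as HEF. cbn zeta in HEF.
set (err := fun t => (k0 - k t * exp (- tau * t)) * ppow p (w t) - exp (theta * t) * h t).
assert (Lerr : is_lim err m_infty 0).
{ apply is_lim_minf. intros eps He. pose proof (ppow_nonneg p M) as HPM.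
  destruct (proj1 (is_lim_minf _ _) Hkap (eps / 2 / (ppow p M + 1))) as [T3 HT3].
  { apply Rdiv_lt_0_compat; lra. }
  destruct (proj1 (is_lim_minf _ _) inhomogeneity_lim (eps / 2) ltac:(lra)) as [T4 HT4].
  exists (Rmin T (Rmin T3 T4)). intros t Ht.
  pose proof (Rmin_l T (Rmin T3 T4)). pose proof (Rmin_r T (Rmin T3 T4)).
  pose proof (Rmin_l T3 T4). pose proof (Rmin_r T3 T4).
  specialize (HT3 t ltac:(lra)). specialize (HT4 t ltac:(lra)). rewrite Rminus_0_r in *.
  unfold err. eapply Rle_lt_trans; [apply Rabs_triang|]. rewrite Rabs_Ropp, !Rabs_mult.
  rewrite (Rabs_minus_sym k0).
  assert (HP : Rabs (ppow p (w t)) <= ppow p M).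
  { rewrite Rabs_pos_eq by apply ppow_nonneg. apply ppow_le; [lra|]. apply HT1; lra. }
  assert (HE : Rabs (exp (theta * t)) <= 1).
  { rewrite Rabs_pos_eq by (left; apply exp_pos). rewrite <- exp_0. apply exp_mono. nra. }
  assert (G1 : Rabs (k t * exp (- tau * t) - k0) * Rabs (ppow p (w t))
    <= eps / 2 / (ppow p M + 1) * (ppow p M + 1)).
  { apply Rmult_le_compat; try apply Rabs_pos; lra. }
  replace (eps / 2 / (ppow p M + 1) * (ppow p M + 1)) with (eps / 2) in G1 by (field; lra).
  assert (G2 : Rabs (exp (theta * t)) * Rabs (h t) <= 1 * Rabs (h t)).
  { apply Rmult_le_compat_r; [apply Rabs_pos|auto]. }
  lra. }
(* Time is reversed, since the limit is taken at [-oo]: the damping becomes growth, so the sign is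
   1, and all deviation from the limit equation is collected in [err]. *)
destruct (lyapunov_limit p (m - 2 * theta) (theta * (m - theta)) k0 A Hp ltac:(lra) ltac:(nra)
  Hk0 HA HAeq 1 (- T) M' (fun s => w (- s)) (fun s => - v (- s)) (fun s => err (- s)))
  as [HL|HL].
- now left.
- intros s Hs. apply D_flip. apply HEF.
- intros s Hs. eapply D_eq.
  + apply D_opp. apply (D_flip v). apply HEF.
  + fold (w (- s)). unfold err, force. ring_simplify. unfold v. ring.
- intros s Hs. split; [apply singular_w_pos|]. specialize (HT1 (- s) ltac:(lra)). lra.
- intros s Hs. rewrite Rabs_Ropp. set (t := - s). assert (Ht : t <= T) by (unfold t; lra).
  specialize (HT1 t ltac:(lra)). specialize (HT2 t ltac:(lra)).
  pose proof (singular_w_pos t). pose proof (singular_y_nonneg t). pose proof (exp_pos (theta * t)) as He.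
  assert (He1 : exp (theta * t) <= 1).
  { rewrite <- exp_0. apply exp_mono. nra. }
  assert (0 <= exp (theta * t) * y t) by (apply Rmult_le_pos; lra).
  assert (exp (theta * t) * y t <= m * w t + D).
  { apply Rle_trans with (exp (theta * t) * (m * u t + D)); [apply Rmult_le_compat_l; lra|].
    unfold w. nra. }
  assert (m * w t <= m * M) by (apply Rmult_le_compat_l; lra).
  assert (0 < theta * w t <= theta * M) by (split; nra).
  unfold v, M'. apply Rabs_le. nra.
- now apply is_lim_flip'.
- left. now apply is_lim_flip.
- right. now apply is_lim_flip.
Qed.

(** The logarithmic slope [- u' / u]: it satisfies a Riccati equation, and [w' = (theta - Y) w]. *)
Let Y (t : R) : R := y t / u t.
Let X (t : R) : R := k t * ppow (p - 1) (u t) + h t / u t.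

Lemma singular_ratio_derive (t : R) : is_derive Y t (Y t * Y t - m * Y t + X t).
Proof.
destruct (Ho t) as [Hu Hy]. pose proof (Hu0 t) as Hu0t. unfold Y. der; [lra|].
unfold X. rewrite (ppow_pred p). field. lra.
Qed.

Lemma singular_ratio_nonneg (t : R) : 0 <= Y t.
Proof.
apply Rmult_le_pos; [apply singular_y_nonneg|left; now apply Rinv_0_lt_compat].
Qed.

Lemma singular_X_eq (t : R) : k t * ppow (p - 1) (u t) = k t * exp (- tau * t) * ppow (p - 1) (w t).
Proof.
unfold w. rewrite ppow_mult, ppow_exp by apply exp_pos.
replace ((p - 1) * (theta * t)) with (tau * t) by (rewrite <- Htau; ring).
replace (k t * exp (- tau * t) * (exp (tau * t) * ppow (p - 1) (u t))) with
  (k t * (exp (- tau * t) * exp (tau * t)) * ppow (p - 1) (u t)) by ring.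
rewrite <- exp_plus. replace (- tau * t + tau * t) with 0 by ring. rewrite exp_0. ring.
Qed.

(* If [w -> 0], then [Y] cannot reach [theta / 2] (otherwise it would exceed [theta] and [w] would
   grow towards [-oo]), so [u = O(exp (- theta t / 2))], the source terms become integrable, and
   [u] is bounded. *)
Lemma singular_not_zero : ~ is_lim w m_infty 0.
Proof.
intros Hw0. pose proof singular_tau_pos as Ht0.
destruct (Hinf 1) as [T1 HT1]. destruct kappa_bounds as [T2 HT2].
(* On [[theta / 2, theta]] the expression [z (m - z)] is at least [theta / 2 * (m - theta)]. Half of
   it is left for [X], and the other half is the speed of [Y] in reversed time. *)
set (c0 := theta / 2 * (m - theta) / 2).
assert (Hc0 : 0 < c0) by (unfold c0; nra).
assert (HX : exists T, forall t, t <= T -> X t <= c0).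
{ destruct (ppow_small (p - 1) ltac:(lra) (c0 / 2 / (2 * k0))) as [d [Hd HS]].
  { apply Rdiv_lt_0_compat; lra. }
  destruct (proj1 (is_lim_minf _ _) Hw0 d Hd) as [T3 HT3].
  destruct (proj1 (is_lim_minf _ _) inhomogeneity_lim (c0 / 2) ltac:(lra)) as [T4 HT4].
  exists (Rmin (Rmin T1 T2) (Rmin T3 T4)). intros t Ht.
  pose proof (Rmin_l (Rmin T1 T2) (Rmin T3 T4)). pose proof (Rmin_r (Rmin T1 T2) (Rmin T3 T4)).
  pose proof (Rmin_l T1 T2). pose proof (Rmin_r T1 T2). pose proof (Rmin_l T3 T4). pose proof (Rmin_r T3 T4).
  specialize (HT1 t ltac:(lra)). specialize (HT3 t ltac:(lra)). specialize (HT4 t ltac:(lra)).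
  destruct (HT2 t ltac:(lra)) as [_ HT2'].
  rewrite Rminus_0_r in *. apply Rabs_def2 in HT3, HT4. pose proof (Hh t) as Hht.
  unfold X. rewrite singular_X_eq.
  assert (G1 : k t * exp (- tau * t) <= 2 * k0).
  { replace (2 * k0) with (2 * k0 * exp (tau * t) * exp (- tau * t)).
    - apply Rmult_le_compat_r; [left; apply exp_pos|auto].
    - rewrite Rmult_assoc, <- exp_plus. replace (tau * t + - tau * t) with 0 by ring. rewrite exp_0; ring. }
  assert (G2 : ppow (p - 1) (w t) <= c0 / 2 / (2 * k0)) by (apply HS; lra).
  assert (G3 : k t * exp (- tau * t) * ppow (p - 1) (w t) <= 2 * k0 * (c0 / 2 / (2 * k0))).
  { apply Rmult_le_compat; auto; [|apply ppow_nonneg].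
    apply Rmult_le_pos; [auto|left; apply exp_pos]. }
  replace (2 * k0 * (c0 / 2 / (2 * k0))) with (c0 / 2) in G3 by (field; lra).
  assert (G4 : h t / u t <= h t).
  { unfold Rdiv. rewrite <- (Rmult_1_r (h t)) at 2. apply Rmult_le_compat_l; [auto|].
    rewrite <- Rinv_1. apply Rinv_le_contravar; lra. }
  lra. }
destruct HX as [T3 HX].
set (T := Rmin (Rmin T1 T2) T3).
pose proof (Rmin_l (Rmin T1 T2) T3). pose proof (Rmin_r (Rmin T1 T2) T3).
pose proof (Rmin_l T1 T2). pose proof (Rmin_r T1 T2). fold T in H, H0.
assert (HY : forall t, t <= T -> Y t < theta / 2).
{ intros t Ht. apply Rnot_le_lt; intros Hge.
  destruct (reach_level (fun s => Y (- s)) (fun s => - (Y (- s) * Y (- s) - m * Y (- s) + X (- s)))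
    (- T) (theta / 2) theta c0 (- t)) as [S [HS1 HS2]]; auto; try lra.
  - intros s Hs. apply (D_flip Y). apply singular_ratio_derive.
  - intros s Hs HYs. specialize (HX (- s) ltac:(lra)). set (z := Y (- s)) in *.
    assert (theta / 2 * (m - theta) <= z * (m - z)) by (apply Rmult_le_compat; lra).
    unfold c0 in *. nra.
  - now rewrite Ropp_involutive.
  - pose proof (singular_w_pos (- S)) as HwS.
    destruct (proj1 (is_lim_minf _ _) Hw0 (w (- S)) HwS) as [T' HT'].
    pose proof (Rmin_l (- S) T'). specialize (HT' (Rmin (- S) T') (Rmin_r _ _)).
    assert (w (- S) <= w (Rmin (- S) T')).
    { apply (derive_decr w (fun t => (theta - Y t) * w t)); auto.
      - intros r _. destruct (emden_fowler m p tau theta k h u y Htau Ho r) as [Hd _].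
        eapply D_eq; [exact Hd|]. cbn. unfold w, Y. pose proof (Hu0 r) as Hu0r. field; lra.
      - intros r Hr. specialize (HS2 (- r) ltac:(lra)). rewrite Ropp_involutive in HS2.
        pose proof (singular_w_pos r). nra. }
    rewrite Rminus_0_r in HT'. apply Rabs_def2 in HT'. lra. }
assert (Hgrowth : forall t, t <= T -> u t <= u T * exp (theta / 2 * T) * exp (- (theta / 2) * t)).
{ intros t Ht.
  assert (G : u t * exp (theta / 2 * t) <= u T * exp (theta / 2 * T)).
  { apply (derive_incr (fun t => u t * exp (theta / 2 * t))
      (fun t => (theta / 2 - Y t) * (u t * exp (theta / 2 * t)))); auto.
    - intros s _. destruct (Ho s) as [Hu _]. der. unfold Y. pose proof (Hu0 s) as Hu0s. field; lra.
    - intros s Hs. specialize (HY s ltac:(lra)). pose proof (Hu0 s) as Hu0s.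
      pose proof (exp_pos (theta / 2 * s)).
      apply Rmult_le_pos; [lra|]. apply Rmult_le_pos; lra. }
  replace (u t) with (u t * exp (theta / 2 * t) * exp (- (theta / 2) * t)).
  - apply Rmult_le_compat_r; [left; apply exp_pos|auto].
  - rewrite Rmult_assoc, <- exp_plus. replace (theta / 2 * t + - (theta / 2) * t) with 0 by ring.
    rewrite exp_0; ring. }
destruct Hhc as [_ [Ch [T4 HT4]]].
set (Ck := 2 * k0 * ppow (p - 1) (u T * exp (theta / 2 * T))).
set (T' := Rmin T T4). pose proof (Rmin_l T T4). pose proof (Rmin_r T T4). fold T' in H3, H4.
assert (HXb : forall t, t <= T' -> X t <= Ck * exp (tau / 2 * t) + Ch * exp (c * t)).
{ intros t Ht. unfold X. apply Rplus_le_compat.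
  - destruct (HT2 t ltac:(lra)) as [_ HT2'].
    apply Rle_trans with (2 * k0 * exp (tau * t) *
      ppow (p - 1) (u T * exp (theta / 2 * T) * exp (- (theta / 2) * t))).
    + apply Rmult_le_compat; auto using ppow_nonneg. apply ppow_le; [lra|]. apply Hgrowth; lra.
    + rewrite ppow_mult, ppow_exp.
      2:{ apply Rmult_lt_0_compat; [auto|apply exp_pos]. }
      replace (tau / 2 * t) with (tau * t + (p - 1) * (- (theta / 2) * t)) by (rewrite <- Htau; field).
      rewrite exp_plus. unfold Ck. right; ring.
  - specialize (HT4 t ltac:(lra)). specialize (HT1 t ltac:(lra)).
    apply Rle_trans with (h t); [|eapply Rle_trans; [apply Rle_abs|exact HT4]].
    unfold Rdiv. rewrite <- (Rmult_1_r (h t)) at 2. apply Rmult_le_compat_l; [auto|].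
    rewrite <- Rinv_1. apply Rinv_le_contravar; lra. }
(* Since [m - mu = theta / 2], the numerator of the derivative of [f] is [Y (theta / 2 - Y)] plus
   the slack in the bound on [X], both nonnegative. So [f] is bounded above at [-oo], and with it
   [ln u]. *)
set (mu := m - theta / 2). assert (Hmu : 0 < mu) by (unfold mu; lra).
set (f := fun t => ln (u t) - Y t / mu + (Ck / (tau / 2) * exp (tau / 2 * t) + Ch / c * exp (c * t)) / mu).
assert (Hf : forall t, t <= T' -> f t <= f T').
{ intros t Ht. apply (derive_incr f (fun t => (Y t * (theta / 2 - Y t) +
    (Ck * exp (tau / 2 * t) + Ch * exp (c * t) - X t)) / mu)); auto.
  - intros s _. destruct (Ho s) as [Hu _]. pose proof (singular_ratio_derive s). pose proof (Hu0 s) as Hu0s.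
    unfold f. der; [lra|lra|]. cbn [pow]. replace (- y s) with (- (Y s * u s)) by (unfold Y; field; lra).
    unfold mu. field. repeat split; lra.
  - intros s Hs. specialize (HXb s ltac:(lra)). specialize (HY s ltac:(lra)). pose proof (singular_ratio_nonneg s).
    apply Rmult_le_pos; [|left; now apply Rinv_0_lt_compat]. nra. }
assert (HCk : 0 <= Ck) by (apply Rmult_le_pos; [lra|apply ppow_nonneg]).
assert (HCh : 0 <= Ch).
{ specialize (HT4 T4 (Rle_refl _)). pose proof (Rabs_pos (h T4)). pose proof (exp_pos (c * T4)). nra. }
assert (Hbd : forall t, t <= T' -> ln (u t) <= f T' + theta / 2 / mu).
{ intros t Ht. specialize (Hf t Ht). unfold f at 1 in Hf. specialize (HY t ltac:(lra)).
  assert (Y t / mu <= theta / 2 / mu).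
  { apply Rmult_le_compat_r; [left; now apply Rinv_0_lt_compat|lra]. }
  assert (0 <= (Ck / (tau / 2) * exp (tau / 2 * t) + Ch / c * exp (c * t)) / mu).
  { apply Rmult_le_pos; [|left; now apply Rinv_0_lt_compat].
    apply Rplus_le_le_0_compat; (apply Rmult_le_pos; [apply Rmult_le_pos; [auto|left; apply Rinv_0_lt_compat; lra]|left; apply exp_pos]). }
  lra. }
destruct (Hinf (exp (f T' + theta / 2 / mu) + 1)) as [T5 HT5].
specialize (HT5 (Rmin T' T5) (Rmin_r _ _)). specialize (Hbd (Rmin T' T5) (Rmin_l _ _)).
apply exp_mono in Hbd. rewrite exp_ln in Hbd by auto. lra.
Qed.

Theorem singular_limit : is_lim (fun t => exp (theta * t) * u t) m_infty A.
Proof. destruct singular_dichotomy as [H|H]; [now apply singular_not_zero in H|exact H]. Qed.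

End Singular.

(** * The limit orbit *)

(* The energy vanishes at [-oo] and decreases, which is where supercriticality enters; this keeps
   the orbit positive and bounded. *)
Theorem limit_orbit_converges (m p tau theta k0 A : R) (u y : R -> R) :
  1 < p -> (p - 1) * theta = tau -> 0 < theta -> 2 * theta < m -> 0 < k0 -> 0 < A ->
  k0 * ppow (p - 1) A = theta * (m - theta) ->
  orbit m p (fun t => k0 * exp (tau * t)) (fun _ => 0) u y -> regular 1 u y ->
  is_lim (fun t => exp (theta * t) * u t) p_infty A.
Proof.
intros Hp Htau Hth Hsub Hk0 HA HAeq O [Lu Ly].
set (a := m - 2 * theta). set (b := theta * (m - theta)) in *.
assert (Ha : 0 < a) by (unfold a; lra). assert (Hb : 0 < b) by (unfold b; nra).
set (w := fun t => exp (theta * t) * u t).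
set (v := fun t => theta * w t - exp (theta * t) * y t).
assert (Dw : forall t : R, is_derive w t (v t)) by (intros t; apply (emden_fowler m p tau theta _ _ u y Htau O t)).
assert (Dv : forall t : R, is_derive v t (-1 * a * v t - force p b k0 (w t) + 0)).
{ intros t. eapply D_eq; [apply (emden_fowler m p tau theta _ _ u y Htau O t)|].
  fold (w t). unfold force. rewrite (Rmult_assoc k0), <- exp_plus.
  replace (tau * t + - tau * t) with 0 by ring. rewrite exp_0. unfold a, b, v. fold (w t). ring. }
set (En := fun t => v t * v t / 2 + potential p b k0 (w t)).
assert (DE : forall t : R, is_derive En t (- a * (v t * v t))).
{ intros t. pose proof (Dw t). pose proof (Dv t).
  pose proof (D_potential p b k0 Hp w t _ (Dw t)). unfold En. der; [lra|]. field. }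
assert (Le : is_lim (fun t => exp (theta * t)) m_infty 0) by now apply is_lim_exp_minf.
assert (Lw : is_lim w m_infty 0).
{ replace (Finite 0) with (Finite (0 * 1)) by (f_equal; ring). now apply is_lim_mult'. }
assert (Lv : is_lim v m_infty 0).
{ replace (Finite 0) with (Finite (theta * 0 - 0 * 0)) by (f_equal; ring).
  apply is_lim_minus'; [|now apply is_lim_mult'].
  replace (Finite (theta * 0)) with (Rbar_mult theta 0) by reflexivity. now apply is_lim_scal_l. }
assert (P0 : potential p b k0 0 = 0) by (unfold potential; rewrite ppow_neg by lra; field; lra).
assert (LE : is_lim En m_infty 0).
{ replace (Finite 0) with (Finite (/ 2 * (0 * 0) + potential p b k0 0)) by (f_equal; rewrite P0; ring).
  apply is_lim_plus'.
  - apply is_lim_ext with (fun t => / 2 * (v t * v t)); [intros; field|].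
    replace (Finite (/ 2 * (0 * 0))) with (Rbar_mult (/ 2) (0 * 0)) by reflexivity.
    apply is_lim_scal_l. now apply is_lim_mult'.
  - apply (is_lim_comp_continuous w (potential p b k0) m_infty 0); [exact Lw|].
    eapply derive_continuous. apply (D_potential p b k0 Hp (fun t => t) 0 1), D_id. }
assert (Hvsq : forall t, - a * (v t * v t) <= 0).
{ intros t. assert (0 <= a * (v t * v t)) by (apply Rmult_le_pos; nra). lra. }
destruct (proj1 (is_lim_minf _ _) Lu (1 / 2) ltac:(lra)) as [T1 HT1].
destruct (proj1 (is_lim_minf _ _) Ly (theta / 2) ltac:(lra)) as [T2 HT2].
set (T := Rmin T1 T2). pose proof (Rmin_l T1 T2) as HTl. pose proof (Rmin_r T1 T2) as HTr.
fold T in HTl, HTr.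
assert (HuT : forall t, t <= T -> 0 < w t).
{ intros t Ht. specialize (HT1 t ltac:(lra)). apply Rabs_def2 in HT1.
  apply Rmult_lt_0_compat; [apply exp_pos|lra]. }
assert (HvT : forall t, t <= T -> 0 < v t).
{ intros t Ht. specialize (HT1 t ltac:(lra)). specialize (HT2 t ltac:(lra)).
  apply Rabs_def2 in HT1, HT2. unfold v, w.
  replace (theta * (exp (theta * t) * u t) - exp (theta * t) * y t) with
    (exp (theta * t) * (theta * u t - y t)) by ring.
  apply Rmult_lt_0_compat; [apply exp_pos|]. nra. }
assert (HE0 : forall t, En t <= 0).
{ intros t. apply (decr_le_lim En (fun t => - a * (v t * v t)) t); auto; lra. }
(* Strictly negative, because the velocity is positive before [T]. This gap excludes every later
   approach to 0. *)
assert (HET : En T < 0).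
{ assert (- En (T - 1) < - En T).
  { apply (derive_incr_strict (fun t => - En t) (fun t => - (- a * (v t * v t)))); [lra| |].
    - intros; now apply D_opp.
    - intros t Ht. specialize (HvT t ltac:(lra)).
      assert (0 < a * (v t * v t)) by (apply Rmult_lt_0_compat; nra). lra. }
  specialize (HE0 (T - 1)). lra. }
assert (HEt : forall t, T <= t -> En t <= En T).
{ intros t Ht. apply (derive_decr En (fun t => - a * (v t * v t))); auto. }
(* At a zero of [w] the energy would be [v^2 / 2 >= 0]. *)
assert (Hw : forall t, T <= t -> 0 < w t).
{ intros t Ht. apply Rnot_le_lt; intros Hneg.
  destruct (IVT_gen w T t 0) as [z [Hz Ez]].
  - intros s. eapply derive_continuity_pt, Dw.
  - specialize (HuT T (Rle_refl _)). rewrite Rmin_right, Rmax_left by lra. lra.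
  - rewrite Rmin_left in Hz by lra. specialize (HEt z ltac:(lra)).
    unfold En at 1 in HEt. rewrite Ez, P0 in HEt. nra. }
assert (Hpot : forall t, potential p b k0 (w t) <= En t) by (intros t; unfold En; nra).
(* The potential is negative only for [w^(p - 1) < Q], so negative energy bounds [w] by [M]. *)
set (Q := b * (p + 1) / (2 * k0)).
assert (HQ : 0 < Q) by (apply Rdiv_lt_0_compat; nra).
set (M := Rpower Q (/ (p - 1))).
assert (HM : 0 < M) by apply exp_pos.
assert (HMQ : ppow (p - 1) M = Q).
{ rewrite ppow_pos_eq by auto. unfold M. rewrite Rpower_mult, Rinv_l, Rpower_1 by lra. reflexivity. }
assert (HwM : forall t, T <= t -> w t <= M).
{ intros t Ht. apply Rnot_lt_le; intros HMw.
  assert (HPQ : Q <= ppow (p - 1) (w t)) by (rewrite <- HMQ; apply ppow_le; lra).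
  specialize (Hpot t). specialize (HEt t Ht). specialize (Hw t Ht).
  assert (Hpn : potential p b k0 (w t) < 0) by lra.
  unfold potential in Hpn. rewrite ppow_pred in Hpn. replace (p + 1 - 1) with p in Hpn by ring.
  rewrite ppow_pred in Hpn.
  assert (HPW : Q * (w t * w t) <= ppow (p - 1) (w t) * (w t * w t)) by (apply Rmult_le_compat_r; nra).
  assert (HK : k0 / (p + 1) * (Q * (w t * w t)) <= k0 / (p + 1) * (ppow (p - 1) (w t) * (w t * w t))).
  { apply Rmult_le_compat_l; [|auto]. left; apply Rdiv_lt_0_compat; lra. }
  replace (k0 / (p + 1) * (Q * (w t * w t))) with (b * (w t * w t) / 2) in HK by (unfold Q; field; lra).
  replace (k0 * (ppow (p - 1) (w t) * w t * w t) / (p + 1)) with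
    (k0 / (p + 1) * (ppow (p - 1) (w t) * (w t * w t))) in Hpn by (field; lra). lra. }
destruct (lyapunov_limit p a b k0 A Hp Ha Hb Hk0 HA HAeq (-1) T ((b + 1) * M) w v (fun _ => 0))
  as [HL|HL]; auto.
- intros t Ht. split; [auto|]. specialize (HwM t Ht). nra.
- intros t Ht. specialize (Hpot t). specialize (HEt t Ht). specialize (Hw t Ht). specialize (HwM t Ht).
  assert (Hv2 : v t * v t <= b * (w t * w t)).
  { unfold En at 1 in HEt. unfold potential in HEt.
    assert (0 <= k0 * ppow (p + 1) (w t) / (p + 1)).
    { apply Rmult_le_pos; [apply Rmult_le_pos; [lra|apply ppow_nonneg]|left; apply Rinv_0_lt_compat; lra]. }
    lra. }
  assert (Hv3 : v t * v t <= ((b + 1) * M) * ((b + 1) * M)).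
  { assert (w t * w t <= M * M) by nra.
    assert (b * (w t * w t) <= b * (M * M)) by (apply Rmult_le_compat_l; lra).
    assert (0 < M * M) by nra. assert (b * (M * M) <= (b + 1) * (b + 1) * (M * M)) by (apply Rmult_le_compat_r; nra).
    nra. }
  assert (0 < (b + 1) * M) by (apply Rmult_lt_0_compat; lra).
  apply Rabs_le. nra.
- apply is_lim_const.
- exfalso. destruct (potential_near p b k0 Hp 0 (- En T) ltac:(lra)) as [d [Hd HN]].
  destruct (proj1 (is_lim_pinf _ _) HL d Hd) as [S HS].
  pose proof (Rmax_l S T). pose proof (Rmax_r S T).
  specialize (HS (Rmax S T) ltac:(auto)). specialize (HN _ HS). rewrite P0 in HN.
  specialize (Hpot (Rmax S T)). specialize (HEt (Rmax S T) ltac:(auto)).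
  apply Rabs_def2 in HN. lra.
Qed.

(** * Blow-up and oscillation *)

(* Sturm comparison of [exp (a t / 2) (wa - wb)] with [sin (om (t - t1))] on a half period. *)
Lemma sturm_no_constant_sign (a b p om t1 B : R) (ka ph wa va wb vb : R -> R) :
  1 < p -> 0 < om -> 0 < B ->
  (forall t : R, is_derive wa t (va t)) -> (forall t : R, is_derive wb t (vb t)) ->
  (forall t : R, is_derive va t (- a * va t + b * wa t - ka t * ppow p (wa t) - ph t)) ->
  (forall t : R, is_derive vb t (- a * vb t + b * wb t - ka t * ppow p (wb t) - ph t)) ->
  (forall t, t1 <= t <= t1 + PI / om -> 0 <= ka t /\
     b + a ^ 2 / 4 + om ^ 2 <= ka t * (p * ppow (p - 1) B)) ->
  (forall t, t1 <= t <= t1 + PI / om -> B <= wb t) ->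
  (forall t, t1 <= t <= t1 + PI / om -> wb t < wa t) -> False.
Proof.
intros Hp Hom HB Dwa Dwb Dva Dvb Hka HwB Hlt.
pose proof PI_RGT_0 as HPI.
assert (HPo : 0 < PI / om) by now apply Rdiv_lt_0_compat.
(* The Wronskian of [exp (a t / 2) (wa - wb)] and the sine, up to sign conventions. It is
   nonincreasing as long as [wa > wb], but negative at the left end and positive at the right
   end. *)
set (W := fun t => exp (a / 2 * t) * (((va t - vb t) + a / 2 * (wa t - wb t)) * sin (om * (t - t1))
   - (wa t - wb t) * (om * cos (om * (t - t1))))).
assert (HW : W (t1 + PI / om) <= W t1).
{ apply (derive_decr W (fun t => exp (a / 2 * t) * (((b + a ^ 2 / 4 + om ^ 2) * (wa t - wb t)
     - ka t * (ppow p (wa t) - ppow p (wb t))) * sin (om * (t - t1))))); [lra| |].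
  - intros t _. pose proof (Dwa t). pose proof (Dwb t). pose proof (Dva t). pose proof (Dvb t).
    unfold W. der. field.
  - intros t Ht. specialize (HwB t Ht). specialize (Hlt t Ht). destruct (Hka t Ht) as [Hk1 Hk2].
    assert (Hsin : 0 <= sin (om * (t - t1))).
    { apply sin_ge_0; [apply Rmult_le_pos; lra|].
      apply Rle_trans with (om * (PI / om)); [apply Rmult_le_compat_l; lra|right; field; lra]. }
    assert (HT : ka t * (p * ppow (p - 1) B * (wa t - wb t)) <= ka t * (ppow p (wa t) - ppow p (wb t))).
    { apply Rmult_le_compat_l; [auto|]. apply ppow_lower_tangent; lra. }
    assert (HT2 : (b + a ^ 2 / 4 + om ^ 2) * (wa t - wb t) <= ka t * (p * ppow (p - 1) B) * (wa t - wb t))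
      by (apply Rmult_le_compat_r; lra).
    pose proof (exp_pos (a / 2 * t)).
    enough (0 <= exp (a / 2 * t) * (- ((b + a ^ 2 / 4 + om ^ 2) * (wa t - wb t)
     - ka t * (ppow p (wa t) - ppow p (wb t))) * sin (om * (t - t1)))) by lra.
    apply Rmult_le_pos; [lra|]. apply Rmult_le_pos; lra. }
assert (HW1 : W t1 < 0).
{ unfold W. rewrite Rminus_diag, Rmult_0_r, sin_0, cos_0.
  specialize (Hlt t1 ltac:(lra)). pose proof (exp_pos (a / 2 * t1)).
  assert (0 < (wa t1 - wb t1) * om) by (apply Rmult_lt_0_compat; lra). nra. }
assert (HW2 : 0 < W (t1 + PI / om)).
{ unfold W. replace (om * (t1 + PI / om - t1)) with PI by (field; lra). rewrite sin_PI, cos_PI.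
  specialize (Hlt (t1 + PI / om) ltac:(lra)). pose proof (exp_pos (a / 2 * (t1 + PI / om))).
  assert (0 < (wa (t1 + PI / om) - wb (t1 + PI / om)) * om) by (apply Rmult_lt_0_compat; lra). nra. }
lra.
Qed.

(** The hypotheses are symmetric in [wa] and [wb], so neither sign of the difference persists over
    the half period. *)
Lemma sturm_zero (a b p om t1 B : R) (ka ph wa va wb vb : R -> R) :
  1 < p -> 0 < om -> 0 < B ->
  (forall t : R, is_derive wa t (va t)) -> (forall t : R, is_derive wb t (vb t)) ->
  (forall t : R, is_derive va t (- a * va t + b * wa t - ka t * ppow p (wa t) - ph t)) ->
  (forall t : R, is_derive vb t (- a * vb t + b * wb t - ka t * ppow p (wb t) - ph t)) ->
  (forall t, t1 <= t <= t1 + PI / om -> 0 <= ka t /\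
     b + a ^ 2 / 4 + om ^ 2 <= ka t * (p * ppow (p - 1) B)) ->
  (forall t, t1 <= t <= t1 + PI / om -> B <= wb t /\ B <= wa t) ->
  exists z, t1 <= z <= t1 + PI / om /\ wa z = wb z.
Proof.
intros Hp Hom HB Dwa Dwb Dva Dvb Hka HwB.
assert (E1 : exists t, t1 <= t <= t1 + PI / om /\ wa t - wb t <= 0).
{ apply NNPP; intros HN. apply (sturm_no_constant_sign a b p om t1 B ka ph wa va wb vb); auto.
  - intros t Ht. now apply HwB.
  - intros t Ht. apply Rnot_le_lt; intros H. apply HN. exists t. split; [auto|lra]. }
assert (E2 : exists t, t1 <= t <= t1 + PI / om /\ 0 <= wa t - wb t).
{ apply NNPP; intros HN. apply (sturm_no_constant_sign a b p om t1 B ka ph wb vb wa va); auto.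
  - intros t Ht. now apply HwB.
  - intros t Ht. apply Rnot_le_lt; intros H. apply HN. exists t. split; [auto|lra]. }
destruct E1 as [x [Hx Hx']]. destruct E2 as [y [Hy Hy']].
destruct (IVT_gen (fun t => wa t - wb t) x y 0) as [z [Hz Ez]].
- intros t. eapply derive_continuity_pt. apply D_minus; auto.
- rewrite Rmin_left, Rmax_right by lra. lra.
- exists z. split; [|lra]. pose proof (Rmin_glb x y t1). pose proof (Rmax_lub x y (t1 + PI / om)).
  split; [apply Rle_trans with (Rmin x y)|apply Rle_trans with (Rmax x y)]; try apply Hz;
  [apply Rmin_glb|apply Rmax_lub]; lra.
Qed.

(** * Rescaled regular orbits *)

Lemma regular_y_nonneg (m p xi : R) (k h u y : R -> R) : 0 < m ->
  (forall t, 0 <= k t) -> (forall t, 0 <= h t) -> orbit m p k h u y -> regular xi u y ->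
  forall t, 0 <= y t.
Proof.
intros Hm Hk Hh O [_ Ly] t.
assert (G : 0 <= exp (m * t) * y t).
{ apply (incr_ge_lim (fun t => exp (m * t) * y t)
    (fun t => exp (m * t) * (k t * ppow p (u t) + h t)) t); try lra.
  - intros s _. destruct (O s) as [_ H]. der. ring.
  - intros s _. apply Rmult_le_pos; [left; apply exp_pos|].
    specialize (Hk s). specialize (Hh s). pose proof (ppow_nonneg p (u s)). nra.
  - replace (Finite 0) with (Finite (0 * 0)) by (f_equal; ring).
    apply is_lim_mult'; [now apply is_lim_exp_minf|auto]. }
pose proof (exp_pos (m * t)). nra.
Qed.

Lemma regular_u_le (m p xi : R) (k h u y : R -> R) : 0 < m ->
  (forall t, 0 <= k t) -> (forall t, 0 <= h t) -> orbit m p k h u y -> regular xi u y ->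
  forall t, u t <= xi.
Proof.
intros Hm Hk Hh O Hr t.
apply (decr_le_lim u (fun t => - y t) t); try lra.
- intros; apply O.
- intros s _. pose proof (regular_y_nonneg m p xi k h u y Hm Hk Hh O Hr s). lra.
- apply Hr.
Qed.

Lemma is_lim_shift_minf (f : R -> R) (a l : R) :
  is_lim f m_infty l -> is_lim (fun t => f (t + a)) m_infty l.
Proof.
intros H. apply is_lim_minf. intros eps He.
destruct (proj1 (is_lim_minf _ _) H eps He) as [T HT].
exists (T - a). intros t Ht. apply HT; lra.
Qed.

Lemma D_shift (f : R -> R) (a t l : R) : is_derive f (t + a) l -> is_derive (fun t => f (t + a)) t l.
Proof.
intros H. eapply D_eq; [apply (D_comp f (fun t => t + a) t l (1 + 0)); [exact H|]|ring].
der. ring.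
Qed.

(* The blow-up [v(s) = u(s + l) / xi], [xi = exp (- theta l)], solves an equation that tends to
   the one of the limit orbit as [l -> -oo]. *)
Lemma blow_up_orbit (m p tau theta l : R) (k h u y : R -> R) : (p - 1) * theta = tau ->
  orbit m p k h u y ->
  orbit m p (fun s => exp (- tau * l) * k (s + l)) (fun s => exp (theta * l) * h (s + l))
    (fun s => exp (theta * l) * u (s + l)) (fun s => exp (theta * l) * y (s + l)).
Proof.
intros Htau O t. destruct (O (t + l)) as [Hu Hy].
pose proof (D_shift u l t _ Hu). pose proof (D_shift y l t _ Hy).
split.
- der. ring.
- der. rewrite ppow_mult, ppow_exp by apply exp_pos.
  replace (p * (theta * l)) with (tau * l + theta * l) by (rewrite <- Htau; ring).
  rewrite exp_plus.
  assert (E : exp (- tau * l) * exp (tau * l) = 1).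
  { rewrite <- exp_plus. replace (- tau * l + tau * l) with 0 by ring. apply exp_0. }
  replace (exp (- tau * l) * k (t + l) * (exp (tau * l) * exp (theta * l) * ppow p (u (t + l))))
    with ((exp (- tau * l) * exp (tau * l)) * k (t + l) * exp (theta * l) * ppow p (u (t + l))) by ring.
  rewrite E. ring.
Qed.

Section BlowUp.

Variables (m p tau theta k0 c A : R) (k h : R -> R).
Hypotheses (Hm : 1 <= m) (Hp : 1 < p) (Htau : (p - 1) * theta = tau) (Hth : 0 < theta)
  (Hsub : 2 * theta < m) (Hk0 : 0 < k0) (Hc : 0 < c)
  (Hk : forall t, 0 <= k t) (Hh : forall t, 0 <= h t) (Hhc : tame c h)
  (Hkap : is_lim (fun t => k t * exp (- tau * t)) m_infty k0)
  (HA : 0 < A) (HAeq : k0 * ppow (p - 1) A = theta * (m - theta)).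

(** Both orbits have the value 1 at [-oo], so Gronwall's estimate is applied with [a = 0]; the
    differences in [k] and [h] enter through its [eps]. The threshold [L] is uniform over all
    regular orbits with the given value. *)
Lemma blow_up_close (u0 y0 : R -> R) (T eps : R) : 0 < eps ->
  orbit m p (fun t => k0 * exp (tau * t)) (fun _ => 0) u0 y0 -> regular 1 u0 y0 ->
  exists L, forall l u y, l <= L -> orbit m p k h u y -> regular (exp (- theta * l)) u y ->
    forall s, s <= T -> Rabs (exp (theta * l) * u (s + l) - u0 s) <= eps.
Proof.
intros Heps O0 R0.
assert (Ht0 : 0 < tau) by (rewrite <- Htau; apply Rmult_lt_0_compat; lra).
set (hh := fun s => (k0 * p + 1) * exp (tau * s) + exp (c * s)).
set (H := fun s => (k0 * p + 1) / tau * exp (tau * s) + / c * exp (c * s)).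
assert (Hhh0 : forall s, 0 <= hh s).
{ intros s. unfold hh. pose proof (exp_pos (tau * s)). pose proof (exp_pos (c * s)).
  assert (0 < (k0 * p + 1) * exp (tau * s)) by (apply Rmult_lt_0_compat; nra). lra. }
assert (DH : forall s : R, is_derive H s (hh s)).
{ intros s. unfold H, hh. der. field. lra. }
assert (LH : is_lim H m_infty 0).
{ replace (Finite 0) with (Finite ((k0 * p + 1) / tau * 0 + / c * 0)) by (f_equal; ring).
  apply is_lim_plus'.
  - replace (Finite ((k0 * p + 1) / tau * 0)) with (Rbar_mult ((k0 * p + 1) / tau) 0) by reflexivity.
    now apply is_lim_scal_l, is_lim_exp_minf.
  - replace (Finite (/ c * 0)) with (Rbar_mult (/ c) 0) by reflexivity.
    now apply is_lim_scal_l, is_lim_exp_minf. }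
(* Chosen so that [4 * e1 ^ 2 * exp (6 * H T) = eps ^ 2]. *)
set (e1 := eps / (2 * exp (3 * H T))).
assert (HE3 : 0 < exp (3 * H T)) by apply exp_pos.
assert (He1 : 0 < e1) by (apply Rdiv_lt_0_compat; lra).
destruct (proj1 (is_lim_minf _ _) Hkap e1 He1) as [T1 HT1].
pose proof Hhc as [_ [C [T2 HC]]].
assert (LC : is_lim (fun l => C * exp (c * l)) m_infty 0).
{ replace (Finite 0) with (Rbar_mult C 0) by (cbn; f_equal; ring).
  now apply is_lim_scal_l, is_lim_exp_minf. }
destruct (proj1 (is_lim_minf _ _) LC e1 He1) as [T3 HT3].
exists (Rmin (Rmin 0 T3) (Rmin (T1 - T) (T2 - T))). intros l u y Hl O R s Hs.
pose proof (Rmin_l (Rmin 0 T3) (Rmin (T1 - T) (T2 - T))).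
pose proof (Rmin_r (Rmin 0 T3) (Rmin (T1 - T) (T2 - T))).
pose proof (Rmin_l 0 T3). pose proof (Rmin_r 0 T3).
pose proof (Rmin_l (T1 - T) (T2 - T)). pose proof (Rmin_r (T1 - T) (T2 - T)).
set (v := fun s => exp (theta * l) * u (s + l)). set (yv := fun s => exp (theta * l) * y (s + l)).
pose proof (blow_up_orbit m p tau theta l k h u y Htau O) as Ov. fold v yv in Ov.
assert (Rv : regular 1 v yv).
{ destruct R as [Ru Ry]. split.
  - replace (Finite 1) with (Rbar_mult (exp (theta * l)) (exp (- theta * l))).
    + apply is_lim_scal_l. now apply is_lim_shift_minf.
    + cbn. f_equal. rewrite <- exp_plus. replace (theta * l + - theta * l) with 0 by ring. apply exp_0.
  - replace (Finite 0) with (Rbar_mult (exp (theta * l)) 0) by (cbn; f_equal; ring).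
    apply is_lim_scal_l. now apply is_lim_shift_minf. }
assert (Hv1 : forall r, v r <= 1).
{ apply (regular_u_le m p 1 _ _ v yv ltac:(lra)) with (4 := Rv) (3 := Ov).
  - intros r. apply Rmult_le_pos; [left; apply exp_pos|auto].
  - intros r. apply Rmult_le_pos; [left; apply exp_pos|auto]. }
assert (Hu1 : forall r, u0 r <= 1).
{ apply (regular_u_le m p 1 _ _ u0 y0 ltac:(lra)) with (4 := R0) (3 := O0).
  - intros r. apply Rmult_le_pos; [lra|left; apply exp_pos].
  - intros r. lra. }
assert (HP1 : forall q, ppow q 1 = 1).
{ intros q. rewrite ppow_pos_eq by lra. unfold Rpower. now rewrite ln_1, Rmult_0_r, exp_0. }
assert (Main : (v s - u0 s) ^ 2 + (yv s - y0 s) ^ 2 <= 4 * (0 ^ 2 + e1 ^ 2) * exp (6 * H s)).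
{ apply (gronwall_minf m T e1 0 v yv u0 y0 _ _ hh H Hm (fun t _ => Ov t) (fun t _ => O0 t)); auto; try lra.
  - intros r Hr. specialize (HT1 (r + l) ltac:(lra)). specialize (HC (r + l) ltac:(lra)).
    specialize (HT3 l ltac:(lra)). rewrite Rminus_0_r in HT3.
    pose proof (ppow_lipschitz p 1 (v r) (u0 r) Hp (Hv1 r) (Hu1 r)) as HL. rewrite HP1, Rmult_1_r in HL.
    assert (HPv : 0 <= ppow p (v r) <= 1).
    { split; [apply ppow_nonneg|]. rewrite <- (HP1 p). apply ppow_le; [lra|auto]. }
    assert (Ek : exp (- tau * l) * k (r + l) = exp (tau * r) * (k (r + l) * exp (- tau * (r + l)))).
    { replace (- tau * l) with (tau * r + - tau * (r + l)) by ring. rewrite exp_plus. ring. }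
    rewrite Ek. set (ka := k (r + l) * exp (- tau * (r + l))) in *.
    replace (exp (tau * r) * ka * ppow p (v r) + exp (theta * l) * h (r + l) -
      (k0 * exp (tau * r) * ppow p (u0 r) + 0)) with
      (exp (tau * r) * ((ka - k0) * ppow p (v r)) + exp (tau * r) * (k0 * (ppow p (v r) - ppow p (u0 r)))
       + exp (theta * l) * h (r + l)) by ring.
    pose proof (exp_pos (tau * r)) as Hexp.
    assert (B1 : Rabs (exp (tau * r) * ((ka - k0) * ppow p (v r))) <= exp (tau * r) * e1).
    { rewrite Rabs_mult, (Rabs_pos_eq (exp _)) by lra. apply Rmult_le_compat_l; [lra|].
      rewrite Rabs_mult, (Rabs_pos_eq (ppow _ _)) by lra. pose proof (Rabs_pos (ka - k0)). nra. }
    assert (B2 : Rabs (exp (tau * r) * (k0 * (ppow p (v r) - ppow p (u0 r))))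
      <= exp (tau * r) * (k0 * (p * Rabs (v r - u0 r)))).
    { rewrite !Rabs_mult, (Rabs_pos_eq (exp _)), (Rabs_pos_eq k0) by lra.
      apply Rmult_le_compat_l; [lra|]. apply Rmult_le_compat_l; lra. }
    assert (B3 : Rabs (exp (theta * l) * h (r + l)) <= exp (c * r) * e1).
    { rewrite Rabs_mult, (Rabs_pos_eq (exp _)) by (left; apply exp_pos).
      assert (exp (theta * l) <= 1) by (rewrite <- exp_0; apply exp_mono; nra).
      replace (c * (r + l)) with (c * r + c * l) in HC by ring. rewrite exp_plus in HC.
      pose proof (exp_pos (c * r)). pose proof (Rabs_pos (h (r + l))).
      assert (C * exp (c * l) <= e1) by (apply Rabs_def2 in HT3; lra).
      apply Rle_trans with (1 * Rabs (h (r + l))); [apply Rmult_le_compat_r; lra|].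
      assert (exp (c * r) * (C * exp (c * l)) <= exp (c * r) * e1) by (apply Rmult_le_compat_l; lra).
      lra. }
    eapply Rle_trans; [apply Rabs_triang|].
    eapply Rle_trans; [apply Rplus_le_compat_r, Rabs_triang|].
    unfold hh. pose proof (exp_pos (c * r)). pose proof (Rabs_pos (v r - u0 r)).
    assert (0 <= exp (tau * r) * Rabs (v r - u0 r)) by (apply Rmult_le_pos; lra).
    assert (0 <= exp (c * r) * Rabs (v r - u0 r)) by (apply Rmult_le_pos; lra).
    assert (0 <= k0 * p * exp (tau * r) * e1).
    { apply Rmult_le_pos; [|lra]. apply Rmult_le_pos; [|lra]. apply Rmult_le_pos; lra. }
    nra.
  - replace (Finite 0) with (Finite (1 - 1)) by (f_equal; ring).
    apply is_lim_minus'; [apply Rv|apply R0].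
  - apply Rv.
  - apply R0. }
assert (HHs : H s <= H T).
{ apply (derive_incr H hh); auto. }
assert (exp (6 * H s) <= exp (3 * H T) * exp (3 * H T)).
{ rewrite <- exp_plus. apply exp_mono. lra. }
assert (Hsq : (v s - u0 s) ^ 2 <= eps ^ 2).
{ assert (4 * (0 ^ 2 + e1 ^ 2) * exp (6 * H s) <= 4 * (0 ^ 2 + e1 ^ 2) * (exp (3 * H T) * exp (3 * H T))).
  { apply Rmult_le_compat_l; [nra|auto]. }
  replace (4 * (0 ^ 2 + e1 ^ 2) * (exp (3 * H T) * exp (3 * H T))) with (eps ^ 2) in *
    by (unfold e1; field; lra).
  pose proof (pow2_ge_0 (yv s - y0 s)). lra. }
fold (v s). apply Rabs_le. nra.
Qed.

(* The Joseph-Lundgren condition: the linearization at the singular solution oscillates. *)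
Hypothesis HJL : theta * (m - theta) + (m - 2 * theta) ^ 2 / 4 < p * (theta * (m - theta)).

(** By continuity the strict inequality survives the replacement of [k0] and [A] by [k0 - del] and
    [A - del]. Half of the slack [g] pays for this, and the other half is [om ^ 2]. *)
Lemma oscillation_margin : exists om del, 0 < om /\ 0 < del < A /\ del < k0 /\
  theta * (m - theta) + (m - 2 * theta) ^ 2 / 4 + om ^ 2 <= (k0 - del) * (p * ppow (p - 1) (A - del)).
Proof.
set (b := theta * (m - theta)) in *. set (g := p * b - (b + (m - 2 * theta) ^ 2 / 4)).
assert (Hg : 0 < g) by (unfold g; lra).
set (f := fun x => (k0 - x) * (p * Rpower (A - x) (p - 1))).
assert (Cf : continuous f 0).
{ assert (HR : is_derive (fun x => Rpower (A - x) (p - 1)) 0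
    ((p - 1) * Rpower (A - 0) (p - 1 - 1) * (0 - 1))).
  { apply (D_comp (fun s => Rpower s (p - 1)) (fun x => A - x)).
    - apply is_derive_Rpower; lra.
    - der. ring. }
  eapply derive_continuous. unfold f. der. reflexivity. }
assert (f0 : f 0 = p * b).
{ unfold f. rewrite !Rminus_0_r, <- HAeq, <- ppow_pos_eq by auto. ring. }
destruct (eps_of_continuous f 0 Cf (g / 2) ltac:(lra)) as [d [Hd HN]].
set (del := Rmin (d / 2) (Rmin (A / 2) (k0 / 2))).
pose proof (Rmin_l (d / 2) (Rmin (A / 2) (k0 / 2))). pose proof (Rmin_r (d / 2) (Rmin (A / 2) (k0 / 2))).
pose proof (Rmin_l (A / 2) (k0 / 2)). pose proof (Rmin_r (A / 2) (k0 / 2)).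
assert (Hdel : 0 < del) by (unfold del; repeat apply Rmin_pos; lra).
fold del in H, H0.
exists (sqrt (g / 2)), del. split; [apply sqrt_lt_R0; lra|]. split; [lra|]. split; [lra|].
rewrite pow2_sqrt by lra.
specialize (HN del ltac:(rewrite Rminus_0_r, Rabs_pos_eq; lra)). rewrite f0 in HN.
rewrite ppow_pos_eq by lra. change ((k0 - del) * (p * Rpower (A - del) (p - 1))) with (f del).
apply Rabs_def2 in HN. unfold g in *. lra.
Qed.

(** On [n] consecutive windows after [T0 + l] both [wa] and [wb] are at least [A - del], so Sturm
    comparison yields a zero in each. *)
Theorem many_intersections (c' : R) (us ys : R -> R) : 0 < c' ->
  tame c' (fun t => k0 * exp (tau * t)) ->
  orbit m p k h us ys -> is_lim (fun t => exp (theta * t) * us t) m_infty A ->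
  forall n, exists Xi, forall xi u y, Xi <= xi -> orbit m p k h u y -> regular xi u y ->
    has_zeros (fun t => u t - us t) n.
Proof.
intros Hc' Htame Os Ls n.
destruct oscillation_margin as [om [del [Hom [[Hdel HdA] [Hdk Hmargin]]]]].
destruct (regular_orbit_exists m p c' 1 (fun t => k0 * exp (tau * t)) (fun _ => 0))
  as [u0 [y0 [O0 [R0 _]]]]; try lra; auto.
{ split; [intros; apply continuous_const|]. exists 0, 0. intros. rewrite Rabs_R0. lra. }
{ intros t. apply Rmult_le_pos; [lra|left; apply exp_pos]. }
{ intros; lra. }
pose proof (limit_orbit_converges m p tau theta k0 A u0 y0 Hp Htau Hth Hsub Hk0 HA HAeq O0 R0) as L0.
destruct (proj1 (is_lim_pinf _ _) L0 (del / 2) ltac:(lra)) as [T0 HT0].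
pose proof PI_RGT_0 as HPI.
assert (HPo : 0 < PI / om) by now apply Rdiv_lt_0_compat.
(* Windows of length [PI / om] are spaced by [P], one unit more, so zeros from different windows are
   distinct. The error [e1] is divided by [exp (theta * Tm)], the largest factor by which the
   rescaling multiplies it. *)
set (P := PI / om + 1). set (Tm := T0 + INR n * P).
set (e1 := del / 2 / exp (theta * Tm)).
assert (He1 : 0 < e1) by (apply Rdiv_lt_0_compat; [lra|apply exp_pos]).
destruct (blow_up_close u0 y0 Tm e1 He1 O0 R0) as [L1 HL1].
destruct (proj1 (is_lim_minf _ _) Ls del Hdel) as [L2 HL2].
destruct (proj1 (is_lim_minf _ _) Hkap del Hdel) as [L3 HL3].
set (L := Rmin L1 (Rmin (L2 - Tm) (L3 - Tm))).
pose proof (Rmin_l L1 (Rmin (L2 - Tm) (L3 - Tm))). pose proof (Rmin_r L1 (Rmin (L2 - Tm) (L3 - Tm))).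
pose proof (Rmin_l (L2 - Tm) (L3 - Tm)). pose proof (Rmin_r (L2 - Tm) (L3 - Tm)). fold L in H, H0.
exists (exp (- theta * L)). intros xi u y Hxi O R.
assert (Hxi0 : 0 < xi) by (pose proof (exp_pos (- theta * L)); lra).
(* The shift for which the blow-up has the value 1 at [-oo]; large [xi] means [l] near [-oo]. *)
set (l := - ln xi / theta).
assert (El : xi = exp (- theta * l)).
{ unfold l. replace (- theta * (- ln xi / theta)) with (ln xi) by (field; lra). now rewrite exp_ln. }
assert (Hl : l <= L).
{ apply Rnot_lt_le; intros Hlt.
  assert (xi < exp (- theta * L)); [|lra]. rewrite El. apply exp_increasing. nra. }
rewrite El in R.
specialize (HL1 l u y ltac:(lra) O R).
set (wa := fun t => exp (theta * t) * u t). set (wb := fun t => exp (theta * t) * us t).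
pose proof (emden_fowler m p tau theta k h u y Htau O) as EFa.
pose proof (emden_fowler m p tau theta k h us ys Htau Os) as EFb. cbn zeta in EFa, EFb.
assert (Hwin : forall t, T0 + l <= t <= Tm + l -> A - del <= wb t /\ A - del <= wa t).
{ intros t Ht. split.
  - specialize (HL2 t ltac:(lra)). apply Rabs_def2 in HL2. unfold wb. lra.
  - specialize (HL1 (t - l) ltac:(lra)). specialize (HT0 (t - l) ltac:(lra)).
    replace (t - l + l) with t in HL1 by ring.
    apply Rabs_def2 in HT0. apply Rabs_le_between in HL1.
    assert (E : wa t = exp (theta * (t - l)) * (exp (theta * l) * u t)).
    { unfold wa. replace (theta * t) with (theta * (t - l) + theta * l) by ring.
      rewrite exp_plus. ring. }
    assert (B : exp (theta * (t - l)) * e1 <= del / 2).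
    { apply Rle_trans with (exp (theta * Tm) * e1).
      - apply Rmult_le_compat_r; [lra|]. apply exp_mono. apply Rmult_le_compat_l; lra.
      - unfold e1. right. field. apply Rgt_not_eq, exp_pos. }
    pose proof (exp_pos (theta * (t - l))).
    assert (exp (theta * (t - l)) * (u0 (t - l) - e1) <= wa t).
    { rewrite E. apply Rmult_le_compat_l; lra. }
    lra. }
assert (W : forall i, exists z, (i < n)%nat ->
  T0 + l + INR i * P <= z <= T0 + l + INR i * P + PI / om /\ u z = us z).
{ intros i. destruct (le_lt_dec n i) as [Hn|Hn]; [exists 0; intros; lia|].
  assert (Hin : forall t, T0 + l + INR i * P <= t <= T0 + l + INR i * P + PI / om ->
     T0 + l <= t <= Tm + l).
  { intros t Ht. pose proof (pos_INR i). assert (Hi : (S i <= n)%nat) by lia. apply le_INR in Hi.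
    rewrite S_INR in Hi. assert (0 < P) by (unfold P; lra).
    assert (0 <= INR i * P) by (apply Rmult_le_pos; lra).
    assert ((INR i + 1) * P <= INR n * P) by (apply Rmult_le_compat_r; lra).
    unfold Tm. assert (PI / om <= P) by (unfold P; lra). lra. }
  destruct (sturm_zero (m - 2 * theta) (theta * (m - theta)) p om (T0 + l + INR i * P) (A - del)
    (fun t => k t * exp (- tau * t)) (fun t => exp (theta * t) * h t) wa
    (fun t => theta * wa t - exp (theta * t) * y t) wb (fun t => theta * wb t - exp (theta * t) * ys t))
    as [z [Hz Ez]]; auto; try lra.
  - intros t; apply EFa.
  - intros t; apply EFb.
  - intros t; apply EFa.
  - intros t; apply EFb.
  - intros t Ht. specialize (Hin t Ht). specialize (HL3 t ltac:(lra)). apply Rabs_def2 in HL3.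
    split; [lra|]. eapply Rle_trans; [exact Hmargin|]. apply Rmult_le_compat_r; [|lra].
    apply Rmult_le_pos; [lra|apply ppow_nonneg].
  - exists z. intros _. split; [exact Hz|]. unfold wa, wb in Ez.
    apply Rmult_eq_reg_l with (exp (theta * z)); [exact Ez|]. apply Rgt_not_eq, exp_pos. }
destruct (fun_choice _ W) as [z Hz].
exists z. split.
- intros i Hi. destruct (Hz i Hi) as [_ E]. lra.
- intros i Hi. destruct (Hz i ltac:(lia)) as [E1 _]. destruct (Hz (S i) Hi) as [E2 _].
  rewrite S_INR in E2. unfold P in *. lra.
Qed.

End BlowUp.

(** * Positive regular orbits *)

(** Near [-oo] the orbit is positive, so [exp (m * t) * y t] increases strictly there and does not
    decrease later. Hence a regular orbit that reaches zero is negative afterwards. *)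
Lemma regular_y_pos (m p xi : R) (k h u y : R -> R) : 0 < m -> 0 < xi ->
  (forall t, 0 < k t) -> (forall t, 0 <= h t) -> orbit m p k h u y -> regular xi u y ->
  forall t, 0 < y t.
Proof.
intros Hm Hxi Hk Hh O Hr t.
assert (Hk' : forall t, 0 <= k t) by (intros r; left; auto).
pose proof (regular_y_nonneg m p xi k h u y Hm Hk' Hh O Hr) as Hy.
destruct (proj1 (is_lim_minf _ _) (proj1 Hr) xi Hxi) as [T HT].
assert (DZ : forall s : R, is_derive (fun t => exp (m * t) * y t) s
   (exp (m * s) * (k s * ppow p (u s) + h s))).
{ intros s. destruct (O s) as [_ Hd]. der. ring. }
pose proof (Rmin_l T t). pose proof (Rmin_r T t). set (s := Rmin T t) in *.
assert (G1 : exp (m * (s - 1)) * y (s - 1) < exp (m * s) * y s).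
{ apply (derive_incr_strict _ _ (s - 1) s ltac:(lra) (fun r _ => DZ r)).
  intros r Hr'. specialize (HT r ltac:(lra)). apply Rabs_def2 in HT.
  apply Rmult_lt_0_compat; [apply exp_pos|].
  assert (0 < k r * ppow p (u r)).
  { apply Rmult_lt_0_compat; [auto|]. apply ppow_pos; lra. }
  specialize (Hh r). lra. }
assert (G2 : exp (m * s) * y s <= exp (m * t) * y t).
{ apply (derive_incr _ _ s t ltac:(lra) (fun r _ => DZ r)).
  intros r _. apply Rmult_le_pos; [left; apply exp_pos|].
  specialize (Hk' r). specialize (Hh r). pose proof (ppow_nonneg p (u r)). nra. }
pose proof (Rmult_le_pos _ _ (Rlt_le _ _ (exp_pos (m * (s - 1)))) (Hy (s - 1))).
pose proof (exp_pos (m * t)).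
apply Rnot_le_lt; intros Hneg. assert (exp (m * t) * y t <= 0) by nra. lra.
Qed.

(** Gronwall's estimate with [eps = 0]; [C] depends only on the bounds [M] and [T], so the
    dependence on [xi] is uniform on a half-line. *)
Lemma regular_lipschitz (m p c M T : R) (k h : R -> R) : 1 <= m -> 1 < p -> 0 < c -> tame c k ->
  (forall t, 0 <= k t) -> (forall t, 0 <= h t) -> 0 < M ->
  exists C, 0 < C /\ forall xi1 xi2 u1 y1 u2 y2, xi1 <= M -> xi2 <= M ->
    orbit m p k h u1 y1 -> regular xi1 u1 y1 -> orbit m p k h u2 y2 -> regular xi2 u2 y2 ->
    forall t, t <= T -> Rabs (u1 t - u2 t) <= C * Rabs (xi1 - xi2) /\
      Rabs (y1 t - y2 t) <= C * Rabs (xi1 - xi2).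
Proof.
intros Hm Hp Hc Hkc Hk Hh HM.
set (L := p * ppow (p - 1) M).
assert (HL : 0 < L) by (apply Rmult_lt_0_compat; [lra|now apply ppow_pos]).
set (H := fun t => L * tail_integral c k t).
assert (DH : forall t : R, is_derive H t (L * k t)).
{ intros t. pose proof (is_derive_tail_integral c k Hc Hkc t). unfold H. der. ring. }
exists (2 * exp (3 * H T)). split; [pose proof (exp_pos (3 * H T)); lra|].
intros xi1 xi2 u1 y1 u2 y2 Hx1 Hx2 O1 R1 O2 R2 t Ht.
assert (Hu1 : forall s, u1 s <= M).
{ intros s. pose proof (regular_u_le m p xi1 k h u1 y1 ltac:(lra) Hk Hh O1 R1 s). lra. }
assert (Hu2 : forall s, u2 s <= M).
{ intros s. pose proof (regular_u_le m p xi2 k h u2 y2 ltac:(lra) Hk Hh O2 R2 s). lra. }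
assert (Main : (u1 t - u2 t) ^ 2 + (y1 t - y2 t) ^ 2 <= 4 * ((xi1 - xi2) ^ 2 + 0 ^ 2) * exp (6 * H t)).
{ apply (gronwall_minf m T 0 (xi1 - xi2) u1 y1 u2 y2 _ _ (fun t => L * k t) H Hm
    (fun t _ => O1 t) (fun t _ => O2 t)); auto; try lra.
  - intros s _. replace (k s * ppow p (u1 s) + h s - (k s * ppow p (u2 s) + h s)) with
      (k s * (ppow p (u1 s) - ppow p (u2 s))) by ring.
    rewrite Rabs_mult, (Rabs_pos_eq (k s)), Rplus_0_r by auto.
    pose proof (ppow_lipschitz p M _ _ Hp (Hu1 s) (Hu2 s)) as HLip. fold L in HLip.
    apply Rle_trans with (k s * (L * Rabs (u1 s - u2 s))); [apply Rmult_le_compat_l; auto|right; ring].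
  - intros s _. apply Rmult_le_pos; [lra|auto].
  - unfold H. replace (Finite 0) with (Rbar_mult L 0) by (cbn; f_equal; ring).
    now apply is_lim_scal_l, is_lim_tail_integral.
  - apply is_lim_minus'; [apply R1|apply R2].
  - apply R1.
  - apply R2. }
assert (HHt : H t <= H T).
{ unfold H. apply Rmult_le_compat_l; [lra|]. now apply tail_integral_mono. }
set (C := 2 * exp (3 * H T)). assert (HC : 0 < C) by (unfold C; pose proof (exp_pos (3 * H T)); lra).
assert (Hsq : (u1 t - u2 t) ^ 2 + (y1 t - y2 t) ^ 2 <= (C * Rabs (xi1 - xi2)) ^ 2).
{ eapply Rle_trans; [exact Main|]. rewrite Rpow_mult_distr, RPow_abs, Rabs_pos_eq by apply pow2_ge_0.
  unfold C. replace ((2 * exp (3 * H T)) ^ 2) with (4 * (exp (3 * H T) * exp (3 * H T))) by ring.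
  rewrite <- exp_plus. assert (exp (6 * H t) <= exp (3 * H T + 3 * H T)) by (apply exp_mono; lra).
  pose proof (pow2_ge_0 (xi1 - xi2)). nra. }
assert (0 <= C * Rabs (xi1 - xi2)) by (apply Rmult_le_pos; [lra|apply Rabs_pos]).
pose proof (pow2_ge_0 (u1 t - u2 t)). pose proof (pow2_ge_0 (y1 t - y2 t)).
split; apply Rabs_le; nra.
Qed.

Theorem arbitrarily_large_positive_orbits (m p tau theta k0 c A : R) (k h us ys : R -> R) :
  1 <= m -> 1 < p -> (p - 1) * theta = tau -> 0 < theta -> 2 * theta < m -> 0 < k0 -> 0 < c ->
  (forall t, 0 < k t) -> (forall t, 0 <= h t) -> tame c k -> tame c h ->
  is_lim (fun t => k t * exp (- tau * t)) m_infty k0 ->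
  0 < A -> k0 * ppow (p - 1) A = theta * (m - theta) ->
  theta * (m - theta) + (m - 2 * theta) ^ 2 / 4 < p * (theta * (m - theta)) ->
  orbit m p k h us ys -> (forall t, 0 < us t) ->
  (forall B, exists T, forall t, t <= T -> B <= us t) ->
  forall Xi, exists xi u y, Xi <= xi /\ orbit m p k h u y /\ regular xi u y /\ forall t, 0 < u t.
Proof.
intros Hm Hp Htau Hth Hsub Hk0 Hc Hkpos Hh Hkc Hhc Hkap HA HAeq HJL Os Hus Hinf Xi.
assert (Hk : forall t, 0 <= k t) by (intros t; left; auto).
assert (Ht0 : 0 < tau) by (rewrite <- Htau; apply Rmult_lt_0_compat; lra).
assert (Ls : is_lim (fun t => exp (theta * t) * us t) m_infty A).
{ apply (singular_limit m p tau theta k0 c k h us ys); auto; lra. }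
apply NNPP; intros HN.
set (xi0 := Rmax Xi 1). pose proof (Rmax_l Xi 1) as Hxi0l. pose proof (Rmax_r Xi 1) as Hxi0r.
fold xi0 in Hxi0l, Hxi0r.
assert (W : forall xi, exists uy : (R -> R) * (R -> R), xi0 <= xi ->
  orbit m p k h (fst uy) (snd uy) /\ regular xi (fst uy) (snd uy)).
{ intros xi. destruct (Rle_dec xi0 xi) as [Hx|Hx].
  - destruct (regular_orbit_exists m p c xi k h) as [u [y [O [Hr _]]]]; auto; try lra.
    exists (u, y). auto.
  - exists (fun _ => 0, fun _ => 0). intros; contradiction. }
destruct (fun_choice _ W) as [fam Hfam].
set (u := fun xi => fst (fam xi)). set (y := fun xi => snd (fam xi)).
assert (O : forall xi, xi0 <= xi -> orbit m p k h (u xi) (y xi)) by (intros; now apply Hfam).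
assert (Hreg : forall xi, xi0 <= xi -> regular xi (u xi) (y xi)) by (intros; now apply Hfam).
assert (Hle : forall xi t, xi0 <= xi -> u xi t <= xi).
{ intros xi t Hx. apply (regular_u_le m p xi k h (u xi) (y xi)); auto; lra. }
assert (Hypos : forall xi t, xi0 <= xi -> 0 < y xi t).
{ intros xi t Hx. apply (regular_y_pos m p xi k h (u xi) (y xi)); auto; lra. }
assert (Hdecr : forall xi s t, xi0 <= xi -> s < t -> u xi t < u xi s).
{ intros xi s t Hx Hst. enough (- u xi s < - u xi t) by lra.
  apply (derive_incr_strict (fun t => - u xi t) (fun t => y xi t)); auto.
  intros r _. destruct (O xi Hx r) as [Hd _]. der. ring. }
assert (Hhit : forall xi, xi0 <= xi -> exists t, u xi t <= 0).
{ intros xi Hx. apply NNPP; intros HC. apply HN. exists xi, (u xi), (y xi).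
  repeat split; try apply O; try apply Hreg; auto; [lra|].
  intros t. apply Rnot_le_lt; intros H. apply HC. now exists t. }
set (d := fun xi t => u xi t - us t). set (dt := fun xi t => - y xi t - - ys t).
assert (Hder : forall xi t, xi0 <= xi -> is_derive (d xi) t (dt xi t)).
{ intros xi t Hx. apply D_minus; [apply O; auto|apply Os]. }
assert (Hclose : forall xi T, xi0 <= xi -> exists C, 0 < C /\ forall xi' t, xi0 <= xi' ->
   Rabs (xi' - xi) < 1 -> t <= T ->
   Rabs (u xi' t - u xi t) <= C * Rabs (xi' - xi) /\ Rabs (y xi' t - y xi t) <= C * Rabs (xi' - xi)).
{ intros xi T Hx.
  destruct (regular_lipschitz m p c (xi + 1) T k h Hm Hp Hc Hkc Hk Hh ltac:(lra)) as [C [HC HL]].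
  exists C. split; auto. intros xi' t Hx' Hxx Ht. apply Rabs_def2 in Hxx.
  apply HL; auto; lra. }
destruct (zeros_uniformly_bounded d dt xi0) as [n Hn]; auto.
- intros xi t eps Hx He.
  destruct (Hclose xi (t + 1) Hx) as [C [HC HL]].
  destruct (eps_of_continuous (d xi) t (derive_continuous _ _ _ (Hder xi t Hx)) (eps / 2) ltac:(lra))
    as [d1 [Hd1 HN1]].
  destruct (eps_of_continuous (dt xi) t) with (eps := eps / 2) as [d2 [Hd2 HN2]]; [|lra|].
  { eapply derive_continuous. apply D_minus; apply D_opp; [apply O; auto|apply Os]. }
  set (del := Rmin (Rmin d1 d2) (Rmin 1 (eps / 2 / C))).
  pose proof (Rmin_l (Rmin d1 d2) (Rmin 1 (eps / 2 / C))).
  pose proof (Rmin_r (Rmin d1 d2) (Rmin 1 (eps / 2 / C))).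
  pose proof (Rmin_l d1 d2). pose proof (Rmin_r d1 d2).
  pose proof (Rmin_l 1 (eps / 2 / C)). pose proof (Rmin_r 1 (eps / 2 / C)).
  assert (HeC : 0 < eps / 2 / C) by (apply Rdiv_lt_0_compat; lra).
  exists del. fold del in H, H0. split; [unfold del; repeat apply Rmin_pos; lra|].
  intros xi' t' Hx' Hxx Htt.
  specialize (HN1 t' ltac:(lra)). specialize (HN2 t' ltac:(lra)).
  destruct (HL xi' t' Hx' ltac:(lra)) as [Hu Hy].
  { apply Rabs_def2 in Htt. lra. }
  assert (Hsmall : C * Rabs (xi' - xi) < eps / 2).
  { apply Rlt_le_trans with (C * (eps / 2 / C)); [apply Rmult_lt_compat_l; lra|right; field; lra]. }
  split.
  + replace (d xi' t' - d xi t) with ((u xi' t' - u xi t') + (d xi t' - d xi t)) by (unfold d; ring).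
    eapply Rle_lt_trans; [apply Rabs_triang|]. lra.
  + replace (dt xi' t' - dt xi t) with (- (y xi' t' - y xi t') + (dt xi t' - dt xi t))
      by (unfold dt; ring).
    eapply Rle_lt_trans; [apply Rabs_triang|]. rewrite Rabs_Ropp. lra.
- intros xi Hx.
  (* Before [a] the singular orbit exceeds [xi + 2], hence all nearby regular orbits. At [b + 1] the
     orbit of [xi] is strictly negative, which at [b] is not guaranteed; so nearby orbits are
     negative from there on, while [us] is positive. *)
  destruct (Hinf (xi + 2)) as [a Ha]. destruct (Hhit xi Hx) as [b Hb].
  destruct (Hclose xi (b + 1) Hx) as [C [HC HL]].
  assert (Hneg : u xi (b + 1) < 0) by (specialize (Hdecr xi b (b + 1) Hx ltac:(lra)); lra).
  exists a, (b + 1). apply near_from_eps.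
  assert (HuC : 0 < - u xi (b + 1) / C) by (apply Rdiv_lt_0_compat; lra).
  exists (Rmin 1 (- u xi (b + 1) / C)). split; [apply Rmin_pos; lra|].
  intros xi' Hx' Hxx t Hz.
  pose proof (Rmin_l 1 (- u xi (b + 1) / C)). pose proof (Rmin_r 1 (- u xi (b + 1) / C)).
  split; apply Rnot_lt_le; intros Hlt; unfold d in Hz.
  + specialize (Ha t ltac:(lra)). specialize (Hle xi' t Hx'). apply Rabs_def2 in Hxx. lra.
  + destruct (HL xi' (b + 1) Hx' ltac:(lra) ltac:(lra)) as [Hu _].
    assert (C * Rabs (xi' - xi) < C * (- u xi (b + 1) / C)) by (apply Rmult_lt_compat_l; lra).
    replace (C * (- u xi (b + 1) / C)) with (- u xi (b + 1)) in * by (field; lra).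
    apply Rabs_le_between in Hu.
    specialize (Hdecr xi' (b + 1) t Hx' ltac:(lra)). specialize (Hus t). lra.
- intros xi t Hx Hz Hdt. unfold d in Hz. unfold dt in Hdt.
  (* A double zero would make the two orbits agree on [(-oo, t]], although one is at most [xi] and
     the other unbounded. As [us] is nonincreasing, [us s] bounds it on [[s, t]]. *)
  assert (Heq : forall s, s <= t -> u xi s = us s).
  { intros s Hs. apply (orbit_backward_unique m p k h (u xi) (y xi) us ys s t (Rmax xi (us s)));
      auto; try lra.
    - apply Hkc.
    - intros r Hr. pose proof (Rmax_l xi (us s)). pose proof (Rmax_r xi (us s)).
      pose proof (Hle xi r Hx). split; [lra|].
      enough (us r <= us s) by lra.
      apply (derive_decr us (fun t => - ys t)); [lra|intros; apply Os|].
      intros r' _.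
      pose proof (singular_y_nonneg m p k h us ys Hk Hh Os Hinf r'). lra. }
  destruct (Hinf (xi + 1)) as [T HT]. specialize (HT (Rmin T t) (Rmin_l _ _)).
  rewrite <- Heq in HT by apply Rmin_r. specialize (Hle xi (Rmin T t) Hx). lra.
- assert (Htame : tame tau (fun t => k0 * exp (tau * t))).
  { split.
    - intros t. eapply derive_continuous. der. reflexivity.
    - exists k0, 0. intros t _. rewrite Rabs_pos_eq; [lra|].
      apply Rmult_le_pos; [lra|left; apply exp_pos]. }
  destruct (many_intersections m p tau theta k0 c A k h Hm Hp Htau Hth Hsub Hk0 Hc Hk Hh Hhc Hkap
    HA HAeq HJL tau us ys Ht0 Htame Os Ls n) as [Xi' HXi].
  pose proof (Rmax_l xi0 Xi') as Hl. pose proof (Rmax_r xi0 Xi') as Hr.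
  apply (Hn (Rmax xi0 Xi') Hl). apply (HXi (Rmax xi0 Xi') (u (Rmax xi0 Xi')) (y (Rmax xi0 Xi'))); auto.
Qed.

(** * Back to the radial variable *)

(** With [x = m - 2 * theta] the last inequality is [x^2 < 2 tau (m + x)], that is [x < tau + S],
    where [S^2 = tau (2 m + tau)]. Solving for [p] through [theta = tau / (p - 1)] gives the formula
    of [p_JL]. *)
Lemma exponent_conditions (N : nat) (alpha p : R) : (3 <= N)%nat -> -2 < alpha ->
  p_S N alpha < p -> Rbar_lt (Finite p) (p_JL N alpha) ->
  let m := INR N - 2 in let tau := 2 + alpha in let theta := tau / (p - 1) in
  1 <= m /\ 1 < p /\ 0 < theta /\ 2 * theta < m /\
  theta * (m - theta) + (m - 2 * theta) ^ 2 / 4 < p * (theta * (m - theta)).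
Proof.
intros HN Hal HpS HJL m tau theta.
assert (Hm : 1 <= m) by (apply le_INR in HN; cbn in HN; unfold m; lra).
assert (Htau : 0 < tau) by (unfold tau; lra).
assert (HpS' : 1 + 2 * tau / m < p).
{ replace (1 + 2 * tau / m) with (p_S N alpha); [auto|].
  unfold p_S, tau. fold m. replace (INR N) with (m + 2) by (unfold m; ring). field. lra. }
assert (Htm : 0 < 2 * tau / m) by (apply Rdiv_lt_0_compat; lra).
assert (Hp : 1 < p) by lra.
assert (Hth : 0 < theta) by (apply Rdiv_lt_0_compat; lra).
assert (Eth : (p - 1) * theta = tau) by (unfold theta; field; lra).
assert (Hsub : 2 * theta < m).
{ apply Rmult_lt_reg_l with (p - 1); [lra|].
  replace ((p - 1) * (2 * theta)) with (2 * tau) by (rewrite <- Eth; ring).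
  apply Rmult_lt_reg_r with (/ m); [apply Rinv_0_lt_compat; lra|].
  replace ((p - 1) * m * / m) with (p - 1) by (field; lra).
  unfold Rdiv in HpS'. lra. }
repeat (split; [assumption|]).
set (x := m - 2 * theta). assert (Hx : 0 < x < m) by (unfold x; lra).
enough (Hq : x ^ 2 < 2 * tau * (m + x)).
{ replace (p * (theta * (m - theta))) with (theta * (m - theta) + (p - 1) * theta * (m - theta)) by ring.
  rewrite Eth. replace (m - theta) with ((m + x) / 2) by (unfold x; field). lra. }
unfold p_JL in HJL. destruct (Rlt_dec (10 + 4 * alpha) (INR N)) as [HNl|HNl].
- cbn in HJL.
  replace (INR N - 4 - alpha) with (m - tau) in HJL by (unfold m, tau; ring).
  replace ((2 + alpha) * (2 * INR N - 2 + alpha)) with (tau * (2 * m + tau)) in HJL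
    by (unfold m, tau; ring).
  change (2 + alpha) with tau in HJL.
  assert (Hm4 : 4 * tau < m) by (unfold m, tau; lra).
  assert (Hrad : 0 <= tau * (2 * m + tau)) by (apply Rmult_le_pos; lra).
  set (S := sqrt (tau * (2 * m + tau))) in *.
  assert (HS2 : S * S = tau * (2 * m + tau)) by (apply sqrt_sqrt; auto).
  assert (HS0 : 0 <= S) by apply sqrt_pos.
  assert (HSt : tau < S) by (apply Rnot_le_lt; intros HC; nra).
  assert (HSm : S < m - tau) by (apply Rnot_le_lt; intros HC; nra).
  assert (Hth2 : m - tau - S < 2 * theta).
  { apply Rmult_lt_reg_l with (p - 1); [lra|].
    replace ((p - 1) * (2 * theta)) with (2 * tau) by (rewrite <- Eth; ring).
    apply Rlt_le_trans with (2 * tau / (m - tau - S) * (m - tau - S)).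
    - apply Rmult_lt_compat_r; lra.
    - right; field; lra. }
  assert (x < tau + S) by (unfold x; lra).
  nra.
(* The dimension bound [N <= 10 + 4 alpha] is [m <= 4 * tau], and then [0 < x < m] alone gives the
   inequality. *)
- assert (m <= 4 * tau) by (unfold m, tau; lra). nra.
Qed.

(** This is [r^2 K(r)] at [r = exp t]: multiplying the radial equation by [r^2] gives its linear
    part constant coefficients in [t]. *)
Definition log_potential (K : R -> R) (t : R) : R := exp (2 * t) * K (exp t).

Lemma continuous_log_potential (K : R -> R) : (forall r, 0 < r -> continuous K r) ->
  forall t : R, continuous (log_potential K) t.
Proof.
intros HK t. apply cont_mult; [apply cont_exp_lin|].
apply (cont_comp K exp); [eapply derive_continuous, is_derive_exp|apply HK, exp_pos].
Qed.

Lemma orbit_of_solution (N : nat) (K f : R -> R) (p mu : R) (v : R -> R) :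
  solves_E N K f p mu v -> exists y,
  orbit (INR N - 2) p (log_potential K) (fun t => mu * log_potential f t) (fun t => v (exp t)) y.
Proof.
intros [u1 [u2 H]]. exists (fun t => - (exp t * u1 (exp t))). intros t.
destruct (H (exp t) (exp_pos t)) as [D1 [D2 [_ [Hpos Heq]]]].
pose proof (D_comp v exp t _ _ D1 (is_derive_exp t)) as C1.
pose proof (D_comp u1 exp t _ _ D2 (is_derive_exp t)) as C2.
pose proof (exp_pos t).
split.
- eapply D_eq; [exact C1|]. ring.
- eapply D_eq; [apply D_opp, D_mult; [apply is_derive_exp|exact C2]|].
  unfold log_potential. rewrite ppow_pos_eq by auto.
  replace (2 * t) with (t + t) by ring. rewrite exp_plus.
  set (r := exp t) in *.
  replace (u2 r) with (- ((INR N - 1) / r * u1 r + K r * Rpower (v r) p + mu * f r)) by lra.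
  field. lra.
Qed.

Lemma solution_of_orbit (N : nat) (K f : R -> R) (p mu : R) (u y : R -> R) : 1 < p ->
  (forall r, 0 < r -> continuous K r) -> (forall r, 0 < r -> continuous f r) ->
  orbit (INR N - 2) p (log_potential K) (fun t => mu * log_potential f t) u y ->
  (forall t, 0 < u t) -> solves_E N K f p mu (fun r => u (ln r)).
Proof.
intros Hp HK Hf O Hu.
assert (DU : forall r, 0 < r -> is_derive (fun r => u (ln r)) r (- y (ln r) / r)).
{ intros r Hr. eapply D_eq.
  - apply (D_comp u ln); [apply O|now apply is_derive_ln].
  - field; lra. }
assert (DY : forall r, 0 < r -> is_derive (fun r => - y (ln r) / r) r
   (- ((INR N - 1) / r * (- y (ln r) / r) + K r * Rpower (u (ln r)) p + mu * f r))).
{ intros r Hr. destruct (O (ln r)) as [_ Hd].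
  pose proof (D_comp y ln r _ _ Hd (is_derive_ln r Hr)) as Hc.
  der; [lra|]. unfold log_potential. rewrite ppow_pos_eq by auto.
  replace (2 * ln r) with (ln r + ln r) by ring. rewrite exp_plus, exp_ln by auto. field; lra. }
exists (fun r => - y (ln r) / r),
  (fun r => - ((INR N - 1) / r * (- y (ln r) / r) + K r * Rpower (u (ln r)) p + mu * f r)).
intros r Hr. split; [auto|]. split; [auto|]. split; [|split; [auto|ring]].
apply (continuous_opp (fun r => (INR N - 1) / r * (- y (ln r) / r) + K r * Rpower (u (ln r)) p + mu * f r)).
apply cont_plus; [apply cont_plus|].
- apply cont_mult.
  + eapply derive_continuous. der; [lra|reflexivity].
  + eapply derive_continuous. now apply DY.
- apply cont_mult; [now apply HK|].
  apply (continuous_ext (fun r => ppow p (u (ln r)))).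
  + intros s. now apply ppow_pos_eq.
  + apply (cont_comp (ppow p) (fun r => u (ln r))); [|now apply continuous_ppow].
    eapply derive_continuous. now apply DU.
- apply (cont_mult (fun _ => mu)); [apply continuous_const|now apply Hf].
Qed.

Lemma at_right_0_eps (g : R -> R) (l : R) : filterlim g (at_right 0) (locally l) <->
  forall eps, 0 < eps -> exists d, 0 < d /\ forall r, 0 < r < d -> Rabs (g r - l) < eps.
Proof.
split.
- intros H eps He. destruct (proj1 (filterlim_locally g l) H (mkposreal eps He)) as [d Hd].
  exists d. split; [apply cond_pos|]. intros r Hr. apply (Hd r); [|lra].
  apply Rabs_def1; unfold minus, plus, opp; cbn; lra.
- intros H. apply filterlim_locally. intros eps. destruct (H eps (cond_pos eps)) as [d [Hd HN]].
  exists (mkposreal d Hd). intros r Hr Hr0. apply HN.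
  apply Rabs_def2 in Hr. unfold minus, plus, opp in Hr; cbn in Hr. lra.
Qed.

Lemma is_lim_kappa (K : R -> R) (alpha k0 : R) :
  filterlim (fun r => K r / Rpower r alpha) (at_right 0) (locally k0) ->
  is_lim (fun t => log_potential K t * exp (- (2 + alpha) * t)) m_infty k0.
Proof.
intros H. apply is_lim_minf. intros eps He.
destruct (proj1 (at_right_0_eps _ _) H eps He) as [d [Hd HN]].
exists (ln d - 1). intros t Ht.
assert (Htd : exp t < d) by (rewrite <- (exp_ln d) by auto; apply exp_increasing; lra).
specialize (HN (exp t) (conj (exp_pos t) Htd)).
replace (log_potential K t * exp (- (2 + alpha) * t)) with (K (exp t) / Rpower (exp t) alpha); [auto|].
unfold log_potential, Rpower, Rdiv. rewrite ln_exp, <- exp_Ropp.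
replace (- (2 + alpha) * t) with (- (2 * t) + - (alpha * t)) by ring. rewrite exp_plus.
rewrite (exp_Ropp (2 * t)). field. apply Rgt_not_eq, exp_pos.
Qed.

Lemma tame_weaken (c c' : R) (F : R -> R) : c' <= c -> tame c F -> tame c' F.
Proof.
intros Hcc [HF [C [T H]]]. split; auto. exists (Rabs C), (Rmin T 0). intros t Ht.
pose proof (Rmin_l T 0). pose proof (Rmin_r T 0).
eapply Rle_trans; [apply H; lra|]. apply Rle_trans with (Rabs C * exp (c * t)).
- apply Rmult_le_compat_r; [left; apply exp_pos|apply Rle_abs].
- apply Rmult_le_compat_l; [apply Rabs_pos|]. apply exp_mono. nra.
Qed.

Lemma tame_of_kappa (k : R -> R) (tau k0 : R) : (forall t : R, continuous k t) ->
  is_lim (fun t => k t * exp (- tau * t)) m_infty k0 -> tame tau k.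
Proof.
intros Hk H. split; auto.
destruct (proj1 (is_lim_minf _ _) H 1 ltac:(lra)) as [T HT].
exists (Rabs k0 + 1), T. intros t Ht. specialize (HT t Ht).
replace (k t) with (k t * exp (- tau * t) * exp (tau * t)).
- rewrite Rabs_mult, (Rabs_pos_eq (exp (tau * t))) by (left; apply exp_pos).
  apply Rmult_le_compat_r; [left; apply exp_pos|].
  replace (k t * exp (- tau * t)) with ((k t * exp (- tau * t) - k0) + k0) by ring.
  eapply Rle_trans; [apply Rabs_triang|]. lra.
- rewrite Rmult_assoc, <- exp_plus. replace (- tau * t + tau * t) with 0 by ring. rewrite exp_0; ring.
Qed.

Lemma tame_log_potential (f : R -> R) (nu C delta : R) : 0 < delta ->
  (forall r, 0 < r -> continuous f r) ->
  (forall r, 0 < r < delta -> Rabs (f r) <= C * Rpower r nu) ->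
  tame (2 + nu) (log_potential f).
Proof.
intros Hd Hf H. split; [now apply continuous_log_potential|].
exists C, (ln delta - 1). intros t Ht.
assert (Htd : exp t < delta) by (rewrite <- (exp_ln delta) by auto; apply exp_increasing; lra).
specialize (H (exp t) (conj (exp_pos t) Htd)). unfold Rpower in H. rewrite ln_exp in H.
unfold log_potential. rewrite Rabs_mult, (Rabs_pos_eq (exp (2 * t))) by (left; apply exp_pos).
replace ((2 + nu) * t) with (2 * t + nu * t) by ring. rewrite exp_plus.
replace (C * (exp (2 * t) * exp (nu * t))) with (exp (2 * t) * (C * exp (nu * t))) by ring.
apply Rmult_le_compat_l; [left; apply exp_pos|auto].
Qed.

Lemma arbitrarily_large_bounded_solutions (N : nat) (K f : R -> R) (alpha k0 mu p : R) :
  (3 <= N)%nat -> 0 <= mu -> K_standing K -> K0_cond K alpha k0 -> f_standing f -> F0_cond f ->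
  p_S N alpha < p -> Rbar_lt (Finite p) (p_JL N alpha) ->
  (exists ustar : R -> R, singular_solution N K f p mu ustar) ->
  forall Xi, exists (xi : R) (u : R -> R), Xi <= xi /\ solves_E N K f p mu u /\
    filterlim u (at_right 0) (locally xi).
Proof.
intros HN Hmu HK [Hal [Hk0 HKlim]] [Hf _] [nu [C [delta [Hnu [Hdel HfC]]]]] HpS HJL [us [Hs Hslim]] Xi.
destruct (exponent_conditions N alpha p HN Hal HpS HJL) as [Hm [Hp [Hth [Hsub HJL']]]].
set (m := INR N - 2) in *. set (tau := 2 + alpha) in *. set (theta := tau / (p - 1)) in *.
assert (Htau : (p - 1) * theta = tau) by (unfold theta; field; lra).
assert (Ht0 : 0 < tau) by (unfold tau; lra).
set (k := log_potential K). set (h := fun t => mu * log_potential f t).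
assert (HKc : forall r, 0 < r -> continuous K r) by (intros; now apply HK).
assert (Hfc : forall r, 0 < r -> continuous f r) by (intros; now apply Hf).
assert (Hkap : is_lim (fun t => k t * exp (- tau * t)) m_infty k0) by now apply is_lim_kappa.
(* A common decay rate for [k] and [h], positive since [alpha > -2] and [nu > -2]. *)
set (c := Rmin tau (2 + nu)).
assert (Hc : 0 < c) by (apply Rmin_pos; lra).
set (b := theta * (m - theta)) in *.
assert (Hb : 0 < b) by (apply Rmult_lt_0_compat; lra).
destruct (orbit_of_solution N K f p mu us Hs) as [ys Os].
(* The amplitude [A] is the explicit solution of [k0 A^(p - 1) = b]. *)
destruct (arbitrarily_large_positive_orbits m p tau theta k0 c (Rpower (b / k0) (/ (p - 1))) k h
  (fun t => us (exp t)) ys) with (Xi := Xi) as [xi [u [y [Hxi [O [Hr Hu]]]]]]; auto.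
- intros t. apply Rmult_lt_0_compat; [apply exp_pos|]. apply HK, exp_pos.
- intros t. apply Rmult_le_pos; [auto|]. apply Rmult_le_pos; [left; apply exp_pos|]. apply Hf, exp_pos.
- apply tame_weaken with tau; [apply Rmin_l|].
  apply tame_of_kappa with k0; [now apply continuous_log_potential|auto].
- apply tame_weaken with (2 + nu); [apply Rmin_r|]. apply tame_scal.
  now apply (tame_log_potential f nu C delta).
- apply exp_pos.
- rewrite ppow_pos_eq by apply exp_pos. rewrite Rpower_mult, Rinv_l, Rpower_1.
  + fold b. field; lra.
  + apply Rdiv_lt_0_compat; lra.
  + lra.
- intros t. destruct Hs as [u1 [u2 H]]. now destruct (H (exp t) (exp_pos t)) as [_ [_ [_ [Hpos _]]]].
- intros B. destruct (Hslim (fun x => B < x)) as [d Hd].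
  { exists B. auto. }
  exists (ln d - 1). intros t Ht. left. apply (Hd (exp t)); [|apply exp_pos].
  assert (exp t < d) by (rewrite <- (exp_ln d) by apply cond_pos; apply exp_increasing; lra).
  pose proof (exp_pos t).
  apply Rabs_def1; unfold minus, plus, opp; cbn; lra.
- exists xi, (fun r => u (ln r)). split; [auto|]. split.
  + now apply (solution_of_orbit N K f p mu u y).
  + apply at_right_0_eps. intros eps He.
    destruct (proj1 (is_lim_minf _ _) (proj1 Hr) eps He) as [T HT].
    exists (exp T). split; [apply exp_pos|]. intros r Hr'. apply HT.
    rewrite <- (ln_exp T). apply ln_le; lra.
Qed.

Theorem theorem1p3 (N : nat) (K f : R -> R) (alpha k0 mu p : R) :
  (3 <= N)%nat ->
  0 <= mu ->
  K_standing K -> K0_cond K alpha k0 ->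
  f_standing f -> F0_cond f ->
  p_S N alpha < p -> Rbar_lt (Finite p) (p_JL N alpha) ->
  (exists ustar : R -> R, singular_solution N K f p mu ustar) ->
  exists u : nat -> (R -> R),
    (forall j, bounded_solution N K f p mu (u j)) /\
    (forall i j, i <> j -> exists r, 0 < r /\ u i r <> u j r) /\
    (* ||u_j||_{L^oo(0,oo)} -> oo *)
    (forall M : R, exists J : nat, forall j, (J <= j)%nat ->
        exists r, 0 < r /\ M < Rabs (u j r)).
Proof.
intros HN Hmu HK HK0 Hf HF0 HpS HJL Hus.
assert (W : forall Xi : R, exists s : R * (R -> R), Xi <= fst s /\ solves_E N K f p mu (snd s) /\
  filterlim (snd s) (at_right 0) (locally (fst s))).
{ intros Xi. destruct (arbitrarily_large_bounded_solutions N K f alpha k0 mu p HN Hmu HK HK0 Hf HF0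
    HpS HJL Hus Xi) as [xi [u Hu]]. now exists (xi, u). }
destruct (fun_choice _ W) as [F HF].
(* Each value at the origin exceeds the previous one by at least 1. So the limits at 0 are distinct,
   which separates the solutions, and unbounded, which forces the sup norms to infinity. *)
set (s := fix s (j : nat) := match j with O => F 0 | S j => F (fst (s j) + 1) end).
assert (Hs : forall j, solves_E N K f p mu (snd (s j)) /\
   filterlim (snd (s j)) (at_right 0) (locally (fst (s j)))) by (intros [|j]; apply HF).
assert (Hstep : forall j, fst (s j) + 1 <= fst (s (S j))) by (intros j; apply HF).
assert (Hge : forall j, INR j <= fst (s j)).
{ induction j as [|j IH]; [apply HF|]. rewrite S_INR. specialize (Hstep j). lra. }
assert (Hinc : forall i j, (i < j)%nat -> fst (s i) < fst (s j)).
{ intros i j. induction 1 as [|j Hij IH].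
  - specialize (Hstep i). lra.
  - specialize (Hstep j). lra. }
assert (Hdist : forall i j, (i < j)%nat -> exists r, 0 < r /\ snd (s i) r <> snd (s j) r).
{ intros i j Hij. specialize (Hinc i j Hij).
  destruct (proj1 (at_right_0_eps _ _) (proj2 (Hs i)) ((fst (s j) - fst (s i)) / 2) ltac:(lra)) as [d1 [Hd1 H1]].
  destruct (proj1 (at_right_0_eps _ _) (proj2 (Hs j)) ((fst (s j) - fst (s i)) / 2) ltac:(lra)) as [d2 [Hd2 H2]].
  pose proof (Rmin_l d1 d2). pose proof (Rmin_r d1 d2). pose proof (Rmin_pos d1 d2 Hd1 Hd2).
  exists (Rmin d1 d2 / 2). split; [lra|]. intros E.
  specialize (H1 (Rmin d1 d2 / 2) ltac:(lra)). specialize (H2 (Rmin d1 d2 / 2) ltac:(lra)).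
  rewrite E in H1. apply Rabs_def2 in H1, H2. lra. }
exists (fun j => snd (s j)). split; [|split].
- intros j. split; [apply Hs|]. exists (fst (s j)). apply Hs.
- intros i j Hij. destruct (Nat.lt_total i j) as [H|[H|H]]; [now apply Hdist|contradiction|].
  destruct (Hdist j i H) as [r [Hr Hne]]. exists r. auto.
- intros M. destruct (INR_unbounded M) as [J HJ]. exists J. intros j Hj.
  apply le_INR in Hj. specialize (Hge j).
  destruct (proj1 (at_right_0_eps _ _) (proj2 (Hs j)) (fst (s j) - M) ltac:(lra)) as [d [Hd H]].
  exists (d / 2). split; [lra|]. specialize (H (d / 2) ltac:(lra)). apply Rabs_def2 in H.
  eapply Rlt_le_trans; [|apply Rle_abs]. lra.
Qed.
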